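(* Let $G$ be a definably connected solvable group definable in an o-minimal structure. Then Cartan subgroups of $G$ exist and are conjugate in $G$, and they are definably connected and selfnormalizing. Moreover, for any Cartan subgroup $Q$ of $G$, the (definable) set $Q_0$ of elements of $Q$ contained in a unique $G$-conjugate of $Q$ is large in $Q$ and largely generous in $G$.
   Context: Definability is with parameters in a fixed o-minimal structure; $\dim$ denotes the usual o-minimal dimension of definable sets (quotients of definable groups by definable subgroups are treated as definable sets, as groups definable in o-minimal structures eliminate imaginaries). A definable group is definably connected if it has no proper definable subgroup of finite index. A subgroup $Q$ of a group $G$ is a Cartan subgroup if $Q$ is nilpotent and maximal nilpotent in $G$, and every normal finite-index subgroup $X$ of $Q$ has finite index in $N_G(X)$. For definable sets $X\subseteq Y$, $X$ is large in $Y$ if $\dim(Y\setminus X)<\dim(Y)$. For a definable subset $X$ of a definable group $G$, let $X^G=\{x^g: x\in X, g\in G\}$; $X$ is largely generous in $G$ if $X^G$ is large in $G$. *)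

(* Defs.v *)
From HB Require Import structures.
From mathcomp Require Import all_boot all_order ssralg ssrint interval.
From mathcomp Require Import boolp classical_sets.
Set Implicit Arguments. Unset Strict Implicit. Unset Printing Implicit Defensive.
Import Order.TTheory.
Local Open Scope classical_set_scope.
Local Open Scope order_scope.

Section Coords.
Variable M : Type.

Definition catp m n (x : 'I_m -> M) (y : 'I_n -> M) : 'I_(m + n) -> M :=
  fun i => match split i with inl j => x j | inr j => y j end.

Definition extp n (x : 'I_n -> M) (t : M) : 'I_n.+1 -> M :=
  fun i => match unlift ord_max i with Some j => x j | None => t end.

Definition initp n (x : 'I_n.+1 -> M) : 'I_n -> M :=
  fun i => x (widen_ord (leqnSn n) i).
Definition tailp n (x : 'I_n.+1 -> M) : 'I_n -> M :=
  fun i => x (lift ord0 i).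
End Coords.

(* O-minimal structures (van den Dries, Ch. 1, (1.2) and (1.3.2)).           *)
(* S n is the collection of definable (with parameters) subsets of M^n.      *)

Unset Implicit Arguments.
Record ominimal_structure (d : Order.disp_t) (M : orderType d) := OMin {
  defs : forall n : nat, set (set ('I_n -> M));
  om_nonempty : exists x : M, True;
  om_dense : forall x y : M, x < y -> exists z, x < z /\ z < y;
  om_no_max : forall x : M, exists y, x < y;
  om_no_min : forall x : M, exists y, y < x;
  defs0 : forall n, defs n set0;
  defsU : forall n A B, defs n A -> defs n B -> defs n (A `|` B);
  defsC : forall n A, defs n A -> defs n (~` A);
  defs_timesM : forall n A, defs n A -> defs n.+1 [set x | A (initp x)];
  defs_Mtimes : forall n A, defs n A -> defs n.+1 [set x | A (tailp x)];
  defs_diag : forall n (i j : 'I_n), defs n [set x | x i = x j];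
  defs_proj : forall n A, defs n.+1 A ->
                defs n [set x | exists t, A (extp x t)];
  defs_lt : defs 2 [set x | x ord0 < x ord_max];
  defs1 : forall A : set ('I_1 -> M),
    defs 1 A <-> exists s : seq (interval M),
                   A = [set x | has (fun I => x ord0 \in I) s]
}.
Set Implicit Arguments.
Arguments defs {d M} _ n.
Arguments ominimal_structure {d} M.

(* o-minimal dimension of a subset X of M^n:                                 *)
(* dim X >= k iff some coordinate projection M^n -> M^k maps X onto a set    *)
(* with nonempty interior (i.e. containing an open box);  dim set0 = -1      *)
(* (playing the role of -oo).                                                *)

Definition dim_ge (d : Order.disp_t) (M : orderType d) n
    (X : set ('I_n -> M)) (k : nat) : Prop :=
  exists f : 'I_k -> 'I_n, injective f /\
  exists a b : 'I_k -> M, (forall i, a i < b i) /\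
    forall y : 'I_k -> M, (forall i, a i < y i /\ y i < b i) ->
      exists x, X x /\ forall i, x (f i) = y i.

Definition dim (d : Order.disp_t) (M : orderType d) n
    (X : set ('I_n -> M)) : int :=
  if `[< exists x, X x >] then
    Posz (\max_(k < n.+1 | `[< dim_ge X k >]) (k : nat))%N
  else Negz 0.

Record group_law (T : Type) := GroupLaw {
  gmul : T -> T -> T;
  ginv : T -> T;
  gone : T;
  gmulA : forall x y z, gmul x (gmul y z) = gmul (gmul x y) z;
  gmul1 : forall x, gmul gone x = x;
  gmulV : forall x, gmul (ginv x) x = gone
}.

Section GroupTheory.
Variables (T : Type) (G : group_law T).
Local Notation "x * y" := (gmul G x y).
Local Notation "x ^-1" := (ginv G x).
Local Notation "1" := (gone G).

Definition is_subgroup (H : set T) : Prop :=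
  H 1 /\ (forall x y, H x -> H y -> H (x * y)) /\ (forall x, H x -> H (x ^-1)).

Definition gen (A : set T) : set T :=
  [set x | forall H, is_subgroup H -> A `<=` H -> H x].

Definition conj (x g : T) : T := g^-1 * x * g.
Definition conjs (H : set T) (g : T) : set T := [set conj x g | x in H].
Definition comm (x y : T) : T := x^-1 * y^-1 * x * y.
Definition commg (A B : set T) : set T :=
  gen [set comm x y | x in A & y in B].

Fixpoint lcs (H : set T) (i : nat) : set T :=
  if i is i'.+1 then commg (lcs H i') H else H.
Definition nilpotent (H : set T) : Prop :=
  is_subgroup H /\ exists c, lcs H c = [set 1].

Fixpoint derived (H : set T) (i : nat) : set T :=
  if i is i'.+1 then commg (derived H i') (derived H i') else H.
Definition solvable (H : set T) : Prop :=
  is_subgroup H /\ exists c, derived H c = [set 1].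

Definition normalizer (H : set T) : set T :=
  [set g | conjs H g = H].
Definition normalizer_in (K H : set T) : set T := K `&` normalizer H.

Definition normal (H K : set T) : Prop :=
  is_subgroup H /\ H `<=` K /\ forall g, K g -> conjs H g = H.

Definition finite_index (H K : set T) : Prop :=
  is_subgroup H /\ H `<=` K /\
  exists (k : nat) (g : 'I_k -> T), K `<=` [set x | exists i, H ((g i)^-1 * x)].

Definition cartan (K Q : set T) : Prop :=
  Q `<=` K /\ nilpotent Q /\
  (forall Q', Q `<=` Q' -> Q' `<=` K -> nilpotent Q' -> Q' = Q) /\
  (forall X, normal X Q -> finite_index X Q ->
     finite_index X (normalizer_in K X)).

Definition conj_closure (X K : set T) : set T :=
  [set conj x g | x in X & g in K].
End GroupTheory.

Record definable_group (d : Order.disp_t) (M : orderType d)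
    (S : ominimal_structure M) (n : nat) (T : Type) := DefGroup {
  dg_law : group_law T;
  dg_emb : T -> ('I_n -> M);
  dg_emb_inj : injective dg_emb;
  dg_def_carrier : defs S n (range dg_emb);
  dg_def_mul : defs S (n + n + n)
    [set catp (catp (dg_emb a) (dg_emb b)) (dg_emb (gmul dg_law a b)) |
       a in [set: T] & b in [set: T]]
}.

Section DefinableGroupNotions.
Variables (d : Order.disp_t) (M : orderType d) (S : ominimal_structure M)
          (n : nat) (T : Type) (G : definable_group S n T).

Definition gdefinable (X : set T) : Prop := defs S n (dg_emb G @` X).

Definition gdim (X : set T) : int := dim (dg_emb G @` X).

Definition large (X Y : set T) : Prop := (gdim (Y `\` X) < gdim Y)%O.

Definition largely_generous (X : set T) : Prop :=
  large (conj_closure (dg_law G) X setT) setT.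

Definition def_connected (H : set T) : Prop :=
  gdefinable H /\ is_subgroup (dg_law G) H /\
  forall K, gdefinable K -> is_subgroup (dg_law G) K -> K `<=` H ->
    finite_index (dg_law G) K H -> K = H.
End DefinableGroupNotions.

(* Main.v *)
From HB Require Import structures.
From mathcomp Require Import all_boot all_order ssralg ssrint interval.
From mathcomp Require Import boolp classical_sets.
From mathcomp Require Import zify.
Require Import Defs.

(* Call a subgroup Carter if it is definable, definably connected, nilpotent  *)
(* and of finite index in its normalizer. Existence, conjugacy,               *)
(* self-normalization and genericity of Carter subgroups of G are proved by   *)
(* induction on dim G, for G not nilpotent. Let A be an infinite definably    *)
(* connected normal subgroup, central if Z(G) is infinite and minimal (hence  *)
(* abelian) otherwise, and let Q/A be a Carter subgroup of G/A. If Q <> G, a  *)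
(* Carter subgroup of Q is one of G, by a Frattini argument. If Q = G, then   *)
(* G/A is nilpotent, and there is an element g, central modulo A, with        *)
(* C_A(g) = 1; then G is the semidirect product of A and C_G(g), which is a   *)
(* Carter subgroup. The elements x with C_A(x) <> 1 form a set of smaller     *)
(* dimension: on a coset of the preimage U of the center of G/C_G(A), the     *)
(* groups C_A(x) for x distinct modulo C_G(A) are independent, so only        *)
(* boundedly many are nontrivial, whereas dim U > dim C_G(A).                 *)
(* A Cartan subgroup equals its definable hull, its connected component is    *)
(* Carter, and a self-normalizing connected group has no proper overgroup in  *)
(* which it is normal; so Cartan and Carter subgroups coincide.               *)
(* From o-minimality one needs the additivity of dimension, which rests on    *)
(* exchanging two quantifiers "for all t in some interval", and the finite    *)
(* index of definable subgroups of full dimension, which rests on the         *)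
(* finiteness of the number of definably connected components.                *)

Set Implicit Arguments. Unset Strict Implicit. Unset Printing Implicit Defensive.
Import Order.TTheory.
Local Open Scope classical_set_scope.

Arguments om_nonempty {d M} _.
Arguments om_dense {d M} _ {x y}.
Arguments om_no_max {d M} _ x.
Arguments om_no_min {d M} _ x.
Arguments defs0 {d M} _ n.
Arguments defsU {d M _ n A B}.
Arguments defsC {d M _ n A}.
Arguments defs_Mtimes {d M _ n A}.
Arguments defs_diag {d M} _ n.
Arguments defs_proj {d M _ n A}.
Arguments defs_lt {d M} _.
Arguments defs1 {d M _}.

(** * Definable sets and interpretable sorts *)

Section DefinableSets.
Context {d : Order.disp_t} {M : orderType d} {S : ominimal_structure M}.

(** The core is [carter_theory_solvable], by induction on dimension. Let [G] be connected, solvable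
    and not nilpotent, and let [Q] be the preimage of a Carter subgroup of [G / A], for a well
    chosen connected normal subgroup [A] of positive dimension.

    If [Q] is proper, induction gives a Carter subgroup [P] of [Q], and [carter_theory_lift] shows
    by Frattini arguments that [P] serves for [G]. Genericity of [P] in [Q] and of [Q] in [G]
    combine in [generic_trans], which compares the dimension of a union of conjugates with that of
    its pieces ([gclos_ge], [gclos_le]).

    If [Q = G], then [G / A] is nilpotent. A central [A] would make [G] nilpotent, so the center has
    dimension 0 and [A] is minimal and abelian. Elements that are central modulo C_G(A) act on [A]
    by equivariant maps, and a form of Schur's lemma shows that such a map is trivial or has no
    fixed point except 1 ([fixed_U]). A suitable [g], central modulo [A], acts nontrivially
    ([exists_central]), so [G] is the semidirect product of [A] and C_G(g). An [x] with C_A(x) = 1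
    is conjugate into C_G(g), and lies in only one conjugate of C_G(g) if it lies in C_G(g) itself.
    The other elements have smaller dimension ([bad_lt]), and [carter_theory_complement] concludes.
    The passage between Carter and Cartan subgroups is [carter_cartan] and [cartan_conj].

    Two facts from o-minimality support this. Additivity of dimension ([dge_fibres]) comes from
    [fat_swap], propagated through all coordinates by [swaps_dpow]. The bound on the index of
    definable subgroups of full dimension ([separated_bound]) comes from the finite cover by
    connected pieces ([cc_all]) and the continuity of generic translations. A recurring device is
    [generic_parameter]: if each point of a set admits a full-dimensional set of good parameters,
    then one parameter is good on a subset of the same dimension. Groups live on interpretable
    sorts, so that definable subgroups and quotients are again groups of the same kind, to which the
    induction applies. *)

Lemma eq_defs n (A B : set ('I_n -> M)) :
  (forall x, A x <-> B x) -> defs S n A -> defs S n B.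
Proof. by move=> AB; have -> : A = B by apply/funext => x; apply/propext. Qed.

Lemma defsT n : defs S n setT.
Proof.
apply: (eq_defs (A := ~` set0)); last exact/defsC/defs0.
by move=> x; split=> // _; case.
Qed.

Lemma defsI n (A B : set ('I_n -> M)) :
  defs S n A -> defs S n B -> defs S n (A `&` B).
Proof.
move=> dA dB; apply: (eq_defs (A := ~` (~` A `|` ~` B))); last first.
  by apply/defsC/defsU; exact: defsC.
by move=> x; rewrite setCU !setCK.
Qed.

Lemma defs_forall n k (A : 'I_k -> set ('I_n -> M)) :
  (forall i, defs S n (A i)) -> defs S n [set x | forall i, A i x].
Proof.
elim: k A => [|k IH] A dA.
  by apply: (eq_defs (A := setT)) (defsT _) => x; split=> // _ [].
apply: (eq_defs (A := A ord0 `&` [set x | forall i, A (lift ord0 i) x])).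
  move=> x; split=> [[A0 As] i|Ax]; last by split.
  by case: (unliftP ord0 i) => [j|] ->.
by apply: defsI (dA _) (IH (fun i => A (lift ord0 i)) _) => i; apply: dA.
Qed.

Lemma defs_cyl m (A : set ('I_m -> M)) n : defs S m A ->
  defs S (n + m) [set z | A (fun i => z (rshift n i))].
Proof.
move=> dA; elim: n => [|n IH].
  apply: eq_defs dA => x /=.
  by have -> : (fun i => x (rshift 0 i)) = x
    by apply/funext => i; congr (x _); apply: val_inj.
refine (@eq_defs (n + m).+1 _ _ _ (defs_Mtimes IH)) => x /=.
have -> // : (fun i => tailp x (rshift n i)) = (fun i => x (rshift n.+1 i)).
by apply/funext => i; congr (x _); apply: val_inj.
Qed.

Lemma defs_proj_widen N (A : set ('I_N -> M)) n (le_nN : n <= N) : defs S N A ->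
  defs S n [set x | exists2 z, A z & forall i, z (widen_ord le_nN i) = x i].
Proof.
move=> dA; have [e|ltnN] := eqVneq n N.
  subst n; apply: eq_defs dA => x; split=> [Ax|[z Az zx]].
    by exists x => // i; congr x; apply: val_inj.
  by have <- : z = x by apply/funext => i; rewrite -zx; congr z; apply: val_inj.
have {}ltnN : n < N by rewrite ltn_neqAle ltnN.
elim: N A dA le_nN ltnN => [//|N IH] A dA le_nN; rewrite ltnS => lenN.
have {IH dA} : defs S n [set x | exists2 z, (exists t, A (extp z t)) &
    forall i, z (widen_ord lenN i) = x i].
  have [e|ltnN] := eqVneq n N; last first.
    by apply: IH (defs_proj dA) _ _; rewrite ltn_neqAle ltnN.
  subst n; apply: eq_defs (defs_proj dA) => x; split=> [Ax|[z Az zx]].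
    by exists x => // i; congr x; apply: val_inj.
  by have <- : z = x by apply/funext => i; rewrite -zx; congr z; apply: val_inj.
apply: eq_defs => x /=; split.
  move=> [z [t Azt] zx]; exists (extp z t) => // i; rewrite -zx /extp.
  case: unliftP => [j /(congr1 val) /= e|/(congr1 val) /= e].
    by congr z; apply: val_inj; rewrite /= e /bump leqNgt ltn_ord.
  by have := ltn_ord i; rewrite e ltnNge lenN.
move=> [z Az zx]; exists (fun i => z (lift ord_max i)).
  exists (z ord_max); rewrite (_ : extp _ _ = z) //.
  by apply/funext => i; rewrite /extp; case: unliftP => [j|] ->.
move=> i; rewrite -zx; congr z; apply: val_inj => /=.
by rewrite /bump leqNgt (leq_trans (ltn_ord i)).
Qed.

Lemma catp_l m n (x : 'I_m -> M) (y : 'I_n -> M) i : catp x y (lshift n i) = x i.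
Proof. by rewrite /catp (unsplitK (inl i)). Qed.

Lemma catp_r m n (x : 'I_m -> M) (y : 'I_n -> M) i : catp x y (rshift m i) = y i.
Proof. by rewrite /catp (unsplitK (inr i)). Qed.

Lemma catp_eta m n (z : 'I_(m + n) -> M) :
  catp (fun i => z (lshift n i)) (fun i => z (rshift m i)) = z.
Proof. by apply/funext => i; rewrite /catp -[in RHS](splitK i); case: split. Qed.

Lemma defs_ex m n (Z : set ('I_(m + n) -> M)) : defs S (m + n) Z ->
  defs S m [set v | exists w, Z (catp v w)].
Proof.
move=> dZ; apply: eq_defs (defs_proj_widen (leq_addr n m) dZ) => v.
have wl i : widen_ord (leq_addr n m) i = lshift n i by exact: val_inj.
split=> [[z Zz zv]|[w Zvw]].
  exists (fun i => z (rshift m i)).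
  by have -> : v = (fun i => z (lshift n i)); [apply/funext => i; rewrite -zv wl|rewrite catp_eta].
by exists (catp v w) => // i; rewrite wl catp_l.
Qed.

(** The condition [A (x \o f)] says that some [w] in [A] has its coordinates tied to those of [x] by
    diagonals, so it is a projection of an intersection of basic sets. *)
Lemma defs_reindex m n (f : 'I_m -> 'I_n) (A : set ('I_m -> M)) :
  defs S m A -> defs S n [set x : 'I_n -> M | A (x \o f)].
Proof.
move=> dA.
have dD := defs_forall (fun i : 'I_m => defs_diag S (n + m) (lshift m (f i)) (rshift n i)).
apply: eq_defs (defs_ex (defsI (defs_cyl n dA) dD)) => x /=; split.
  move=> [w [Aw wx]]; rewrite (_ : x \o f = fun i => catp x w (rshift n i)) //.
  by apply/funext => i; rewrite -wx catp_l.
move=> Ax; exists (x \o f); split; last by move=> i; rewrite catp_l catp_r.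
by rewrite (_ : (fun i => _) = x \o f) //; apply/funext => i; rewrite catp_r.
Qed.

Lemma defs_coord1 (A : set ('I_1 -> M)) n (i : 'I_n) :
  defs S 1 A -> defs S n [set x | A (fun=> x i)].
Proof. by move=> /(defs_reindex (fun=> i)). Qed.

Lemma defs_const n (i : 'I_n) c : defs S n [set x | x i = c].
Proof.
apply: (@defs_coord1 [set x | x ord0 = c]); apply/defs1.
exists [:: Interval (BLeft c) (BRight c)]; apply/funext => x; apply/propext => /=.
rewrite orbF in_itv /=; split=> [->|]; first by rewrite lexx.
by move=> h; apply: le_anti; rewrite andbC.
Qed.
End DefinableSets.

(* An interpretable sort: a type that is, via [iprj], a quotient of a          *)
(* definable set by a definable equivalence relation.                          *)
Record isort (d : Order.disp_t) (M : orderType d) (S : ominimal_structure M) := ISort {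
  icar :> Type;
  iar : nat;
  idom : set ('I_iar -> M);
  iprj : ('I_iar -> M) -> icar;
  iprj_surj : forall x, exists2 v, idom v & iprj v = x;
  idom_def : defs S iar idom;
  iker_def : defs S (iar + iar)
    [set z : 'I_(iar + iar) -> M | [/\ idom (z \o lshift iar), idom (z \o @rshift iar _) &
                iprj (z \o lshift iar) = iprj (z \o @rshift iar _)]]
}.
Arguments idom {d M S} i.
Arguments iprj {d M S i}.

(** * A calculus of definability over interpretable sorts *)

Section Definability.
Context {d : Order.disp_t} {M : orderType d} {S : ominimal_structure M}.
Local Notation isort := (isort S).

Definition dset (X : isort) (P : X -> Prop) : Prop :=
  defs S (iar X) [set v | idom X v /\ P (iprj v)].

Lemma catpl m n (x : 'I_m -> M) (y : 'I_n -> M) : catp x y \o lshift n = x.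
Proof. by apply/funext => i; rewrite /= catp_l. Qed.

Lemma catpr m n (x : 'I_m -> M) (y : 'I_n -> M) : catp x y \o @rshift m _ = y.
Proof. by apply/funext => i; rewrite /= catp_r. Qed.

Section Product.
Variables X Y : isort.
Let dom := [set z : 'I_(iar X + iar Y) -> M | idom X (z \o lshift (iar Y)) /\ idom Y (z \o @rshift (iar X) _)].
Let prj (z : 'I_(iar X + iar Y) -> M) : X * Y :=
  (iprj (z \o lshift (iar Y)), iprj (z \o @rshift (iar X) _)).

Let prj_surj p : exists2 v, dom v & prj v = p.
Proof.
case: p => x y; have [v dv <-] := iprj_surj x; have [w dw <-] := iprj_surj y.
by exists (catp v w); rewrite /dom /prj /= catpl catpr.
Qed.

Let dom_def : defs S _ dom.
Proof. exact: defsI (defs_reindex _ (idom_def X)) (defs_reindex _ (idom_def Y)). Qed.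

Let ker_def : defs S _ [set z : 'I_((iar X + iar Y) + (iar X + iar Y)) -> M | [/\ dom (z \o lshift _), dom (z \o @rshift _ _) &
  prj (z \o lshift _) = prj (z \o @rshift _ _)]].
Proof.
pose l := @lshift (iar X + iar Y) (iar X + iar Y).
pose r := @rshift (iar X + iar Y) (iar X + iar Y).
pose f (i : 'I_(iar X + iar X)) : 'I_((iar X + iar Y) + (iar X + iar Y)) :=
  match split i with inl j => l (lshift _ j) | inr j => r (lshift _ j) end.
pose g (i : 'I_(iar Y + iar Y)) : 'I_((iar X + iar Y) + (iar X + iar Y)) :=
  match split i with inl j => l (rshift _ j) | inr j => r (rshift _ j) end.
have fl (z : _ -> M) : (z \o f) \o lshift _ = z \o l \o lshift _ :> (_ -> M).
  by apply/funext => i; rewrite /= /f (unsplitK (inl i)).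
have fr (z : _ -> M) : (z \o f) \o @rshift _ _ = z \o r \o lshift _ :> (_ -> M).
  by apply/funext => i; rewrite /= /f (unsplitK (inr i)).
have gl (z : _ -> M) : (z \o g) \o lshift _ = z \o l \o @rshift _ _ :> (_ -> M).
  by apply/funext => i; rewrite /= /g (unsplitK (inl i)).
have gr (z : _ -> M) : (z \o g) \o @rshift _ _ = z \o r \o @rshift _ _ :> (_ -> M).
  by apply/funext => i; rewrite /= /g (unsplitK (inr i)).
apply: eq_defs (defsI (defs_reindex f (iker_def X)) (defs_reindex g (iker_def Y))) => z /=.
rewrite fl fr gl gr /dom /prj /l /r /=; split.
  by move=> [[? ? ->] [? ? ->]].
by move=> [[? ?] [? ?] [-> ->]].
Qed.

Canonical prod_isort : isort := ISort prj_surj dom_def ker_def.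
End Product.

Section Base.
Let prj1 (v : 'I_1 -> M) : M := v ord0.
Let prj1_surj x : exists2 v, setT v & prj1 v = x.
Proof. by exists (fun=> x). Qed.
Let ker1_def : defs S (1 + 1)
  [set z : 'I_(1 + 1) -> M | [/\ setT (z \o lshift 1), setT (z \o @rshift 1 _) &
     prj1 (z \o lshift 1) = prj1 (z \o @rshift 1 _)]].
Proof. by apply: eq_defs (defs_diag S _ (lshift 1 ord0) (rshift 1 ord0)) => z; split=> // -[]. Qed.
Canonical line_isort : isort := ISort prj1_surj (defsT 1) ker1_def.

Variable n : nat.
Let prjn_surj (x : 'I_n -> M) : exists2 v, setT v & id v = x.
Proof. by exists x. Qed.
Let kern_def : defs S (n + n)
  [set z : 'I_(n + n) -> M | [/\ setT (z \o lshift n), setT (z \o @rshift n _) &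
     id (z \o lshift n) = id (z \o @rshift n _) :> ('I_n -> M)]].
Proof.
apply: eq_defs (defs_forall (fun i : 'I_n => defs_diag S _ (lshift n i) (rshift n i))).
by move=> z /=; split=> [h|[_ _ h] i]; [split=> //; apply/funext|have := congr1 (@^~ i) h].
Qed.
Canonical power_isort : isort := ISort prjn_surj (defsT n) kern_def.
End Base.

Definition dmap (X Y : isort) (f : X -> Y) : Prop :=
  @dset (prod_isort X Y) (fun p => f p.1 = p.2).

Lemma eq_dset (X : isort) (P Q : X -> Prop) : (forall x, P x <-> Q x) -> dset P -> dset Q.
Proof. by move=> PQ; have -> : P = Q by apply/funext => x; apply/propext. Qed.

Lemma dset_not (X : isort) (P : X -> Prop) : dset P -> dset (fun x => ~ P x).
Proof.
move=> dP; apply: eq_defs (defsI (idom_def X) (defsC dP)) => v /=.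
split=> [[dv nP]|[dv nP]]; split=> //; first by move=> p; apply: nP.
by apply/not_andP; right.
Qed.

Lemma dset_and (X : isort) (P Q : X -> Prop) :
  dset P -> dset Q -> dset (fun x => P x /\ Q x).
Proof.
by move=> dP dQ; apply: eq_defs (defsI dP dQ) => v; split=> [[[? ?] []]|[? []]].
Qed.

Lemma dset_and3 (X : isort) (P Q R : X -> Prop) : dset P -> dset Q -> dset R ->
  dset (fun x => [/\ P x, Q x & R x]).
Proof.
move=> dP dQ dR; apply: eq_dset (dset_and dP (dset_and dQ dR)) => x.
by split=> [[? []]|[]].
Qed.

Lemma dset_or (X : isort) (P Q : X -> Prop) :
  dset P -> dset Q -> dset (fun x => P x \/ Q x).
Proof.
move=> dP dQ; apply: eq_defs (defsU dP dQ) => v /=.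
by split=> [[] [? ?]|[? []]]; [split=> //; left|split=> //; right|left|right].
Qed.

Lemma dset_imp (X : isort) (P Q : X -> Prop) :
  dset P -> dset Q -> dset (fun x => P x -> Q x).
Proof.
move=> dP dQ; apply: eq_dset (dset_or (dset_not dP) dQ) => x.
by split=> [[]//|PQ]; case: (pselect (P x)) => ?; [right; apply: PQ|left].
Qed.

Lemma dset_iff (X : isort) (P Q : X -> Prop) :
  dset P -> dset Q -> dset (fun x => P x <-> Q x).
Proof. by move=> dP dQ; apply: dset_and; apply: dset_imp. Qed.

Lemma dset_prop (X : isort) (P : Prop) : dset (fun _ : X => P).
Proof.
have [p|np] := pselect P; first by apply: eq_defs (idom_def X) => v; split=> // -[].
by apply: eq_defs (defs0 S _) => v; split=> // -[].
Qed.

Lemma dset_ex (X Y : isort) (R : X -> Y -> Prop) :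
  @dset (prod_isort X Y) (fun p => R p.1 p.2) -> dset (fun x => exists y, R x y).
Proof.
move=> /defs_ex; apply: eq_defs => v /=; split.
  by move=> [w []]; rewrite catpl catpr => -[dv dw] Rvw; split=> //; exists (iprj w).
move=> [dv [y Ry]]; have [w dw wy] := iprj_surj y; exists w.
by rewrite catpl catpr wy.
Qed.

Lemma dset_all (X Y : isort) (R : X -> Y -> Prop) :
  @dset (prod_isort X Y) (fun p => R p.1 p.2) -> dset (fun x => forall y, R x y).
Proof.
move=> dR; have := dset_not (dset_ex (R := fun x y => ~ R x y) (dset_not dR)).
apply: eq_dset => x; split=> [nex y|Rx [y]]; last exact.
by apply: contrapT => nR; apply: nex; exists y.
Qed.

Lemma dset_comp (X Y : isort) (P : Y -> Prop) (f : X -> Y) :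
  dset P -> dmap f -> dset (fun x => P (f x)).
Proof.
move=> dP df; apply: eq_defs (defs_ex (defsI df (defs_reindex (@rshift (iar X) _) dP))) => v /=.
split.
  move=> [w []]; rewrite catpl catpr => -[[dv dw] fvw] [_ Pw].
  by split=> //; rewrite fvw.
move=> [dv Pf]; have [w dw wy] := iprj_surj (f (iprj v)); exists w.
by rewrite catpl catpr wy.
Qed.

Lemma dmap_id (X : isort) : dmap (fun x : X => x).
Proof. by apply: eq_defs (iker_def X) => z; split=> [[]|[[]]]. Qed.

Lemma dmap_fst (X Y : isort) : dmap (fst : prod_isort X Y -> X).
Proof.
pose f (i : 'I_(iar X + iar X)) : 'I_((iar X + iar Y) + iar X) :=
  match split i with inl j => lshift (iar X) (lshift (iar Y) j) | inr j => rshift _ j end.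
have fl (z : _ -> M) : (z \o f) \o lshift _ = z \o lshift _ \o lshift _ :> (_ -> M).
  by apply/funext => i; rewrite /= /f (unsplitK (inl i)).
have fr (z : _ -> M) : (z \o f) \o @rshift _ _ = z \o @rshift _ _ :> (_ -> M).
  by apply/funext => i; rewrite /= /f (unsplitK (inr i)).
apply: eq_defs (defsI (defs_reindex f (iker_def X)) (defs_reindex (@lshift _ _) (idom_def (prod_isort X Y)))) => z /=.
by rewrite fl fr; split=> [[[]]|[[[]]]].
Qed.

Lemma dmap_snd (X Y : isort) : dmap (snd : prod_isort X Y -> Y).
Proof.
pose f (i : 'I_(iar Y + iar Y)) : 'I_((iar X + iar Y) + iar Y) :=
  match split i with inl j => lshift (iar Y) (rshift (iar X) j) | inr j => rshift _ j end.
have fl (z : _ -> M) : (z \o f) \o lshift _ = z \o lshift _ \o @rshift _ _ :> (_ -> M).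
  by apply/funext => i; rewrite /= /f (unsplitK (inl i)).
have fr (z : _ -> M) : (z \o f) \o @rshift _ _ = z \o @rshift _ _ :> (_ -> M).
  by apply/funext => i; rewrite /= /f (unsplitK (inr i)).
apply: eq_defs (defsI (defs_reindex f (iker_def Y)) (defs_reindex (@lshift _ _) (idom_def (prod_isort X Y)))) => z /=.
by rewrite fl fr; split=> [[[]]|[[[]]]].
Qed.

Lemma dmap_pair (X Y Z : isort) (f : X -> Y) (g : X -> Z) :
  dmap f -> dmap g -> @dmap X (prod_isort Y Z) (fun x => (f x, g x)).
Proof.
move=> df dg.
pose l := @lshift (iar X) (iar Y + iar Z); pose r := @rshift (iar X) (iar Y + iar Z).
pose u (i : 'I_(iar X + iar Y)) := match split i with
  inl j => l j | inr j => r (lshift _ j) end.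
pose v (i : 'I_(iar X + iar Z)) := match split i with
  inl j => l j | inr j => r (rshift _ j) end.
have ul (z : _ -> M) : (z \o u) \o lshift _ = z \o l :> (_ -> M).
  by apply/funext => i; rewrite /= /u (unsplitK (inl i)).
have ur (z : _ -> M) : (z \o u) \o @rshift _ _ = z \o r \o lshift _ :> (_ -> M).
  by apply/funext => i; rewrite /= /u (unsplitK (inr i)).
have vl (z : _ -> M) : (z \o v) \o lshift _ = z \o l :> (_ -> M).
  by apply/funext => i; rewrite /= /v (unsplitK (inl i)).
have vr (z : _ -> M) : (z \o v) \o @rshift _ _ = z \o r \o @rshift _ _ :> (_ -> M).
  by apply/funext => i; rewrite /= /v (unsplitK (inr i)).
apply: eq_defs (defsI (defs_reindex u df) (defs_reindex v dg)) => z /=.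
rewrite ul ur vl vr; split; first by move=> [[[? ?] ->] [[? ?] ->]].
by move=> [[? []] ? ? [-> ->]].
Qed.

Lemma dset_eq (X Y : isort) (f g : X -> Y) : dmap f -> dmap g -> dset (fun x => f x = g x).
Proof. by move=> df dg; apply: (dset_comp (dmap_id Y) (dmap_pair df dg)). Qed.

Lemma dmap_comp (X Y Z : isort) (g : Y -> Z) (f : X -> Y) :
  dmap g -> dmap f -> dmap (fun x => g (f x)).
Proof.
move=> dg df.
pose l := @lshift (iar X + iar Z) (iar Y); pose r := @rshift (iar X + iar Z) (iar Y).
pose u (i : 'I_(iar X + iar Y)) := match split i with
  inl j => l (lshift _ j) | inr j => r j end.
pose v (i : 'I_(iar Y + iar Z)) := match split i with
  inl j => r j | inr j => l (rshift _ j) end.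
have ul (z : _ -> M) : (z \o u) \o lshift _ = z \o l \o lshift _ :> (_ -> M).
  by apply/funext => i; rewrite /= /u (unsplitK (inl i)).
have ur (z : _ -> M) : (z \o u) \o @rshift _ _ = z \o r :> (_ -> M).
  by apply/funext => i; rewrite /= /u (unsplitK (inr i)).
have vl (z : _ -> M) : (z \o v) \o lshift _ = z \o r :> (_ -> M).
  by apply/funext => i; rewrite /= /v (unsplitK (inl i)).
have vr (z : _ -> M) : (z \o v) \o @rshift _ _ = z \o l \o @rshift _ _ :> (_ -> M).
  by apply/funext => i; rewrite /= /v (unsplitK (inr i)).
apply: eq_defs (defs_ex (defsI (defs_reindex u df) (defs_reindex v dg))) => z /=; split.
  by move=> [w []]; rewrite ul ur vl vr /l /r catpl catpr => -[[? ?] ->] [[? ?] ->].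
move=> [[dx dz] fz]; have [w dw wy] := iprj_surj (f (iprj (z \o lshift _))).
by exists w; rewrite ul ur vl vr /l /r catpl catpr wy.
Qed.

(** Parameters enter here: a point is given by a representative [w], whose coordinates are named by
    [defs_const], and its class is definable through the kernel relation. *)
Lemma dmap_const (X Y : isort) (c : Y) : dmap (fun _ : X => c).
Proof.
have dc : dset (fun y : Y => c = y).
  have [w dw <-] := iprj_surj c.
  have dw' := defs_forall (fun i => defs_const (S := S) (rshift (iar Y) i) (w i)).
  pose sw (i : 'I_(iar Y + iar Y)) := match split i with
    inl j => rshift (iar Y) j | inr j => lshift (iar Y) j end.
  have swl (z : _ -> M) : (z \o sw) \o lshift _ = z \o @rshift _ _ :> (_ -> M).
    by apply/funext => i; rewrite /= /sw (unsplitK (inl i)).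
  have swr (z : _ -> M) : (z \o sw) \o @rshift _ _ = z \o lshift _ :> (_ -> M).
    by apply/funext => i; rewrite /= /sw (unsplitK (inr i)).
  apply: eq_defs (defs_ex (defsI dw' (defs_reindex sw (iker_def Y)))) => v /=; split.
    move=> [w' [e []]]; rewrite swl swr catpl catpr.
    by have -> : w' = w by apply/funext => i; rewrite -e catp_r.
  by move=> [dv wv]; exists w; rewrite swl swr catpl catpr; split=> // i; rewrite catp_r.
exact: dset_comp dc (dmap_snd X Y).
Qed.

Lemma dset_ltM (X : isort) (f g : X -> M) : @dmap X line_isort f -> @dmap X line_isort g ->
  dset (fun x => (f x < g x)%O).
Proof.
move=> df dg; apply: (dset_comp (P := fun p : prod_isort line_isort line_isort => (p.1 < p.2)%O)) (dmap_pair df dg).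
apply: eq_defs (defs_lt S) => z /=.
have -> : lshift 1 ord0 = ord0 :> 'I_(1 + 1) by exact: val_inj.
have -> : rshift 1 ord0 = ord_max :> 'I_(1 + 1) by exact: val_inj.
by split=> // -[].
Qed.

Lemma dset_leM (X : isort) (f g : X -> M) : @dmap X line_isort f -> @dmap X line_isort g ->
  dset (fun x => (f x <= g x)%O).
Proof.
move=> df dg; apply: eq_dset (dset_not (dset_ltM dg df)) => x.
by rewrite leNgt; split=> /negP.
Qed.

Lemma dset_forall_fin (X : isort) k (P : 'I_k -> X -> Prop) :
  (forall i, dset (P i)) -> dset (fun x => forall i, P i x).
Proof.
move=> dP; apply: eq_defs (defsI (idom_def X) (defs_forall dP)) => v /=.
by split=> [[? h]|[? h]]; split=> // i; have [] := h i.
Qed.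

Lemma dmap_coord (X : isort) n (f : X -> ('I_n -> M)) (i : 'I_n) :
  @dmap X (power_isort n) f -> @dmap X line_isort (fun x => f x i).
Proof.
apply: (@dmap_comp X (power_isort n) line_isort (fun v => v i)).
apply: eq_defs (defs_diag S _ (lshift 1 i) (rshift n ord0)) => z /=.
by split=> // -[].
Qed.

Lemma dmap_fun (X : isort) n (f : X -> ('I_n -> M)) :
  (forall i, @dmap X line_isort (fun x => f x i)) -> @dmap X (power_isort n) f.
Proof.
move=> df; apply: (eq_dset (X := prod_isort X (power_isort n)) (P := fun p => forall i, f p.1 i = p.2 i)).
  by move=> [x w] /=; split=> [h|->]; first by apply/funext.
apply: dset_forall_fin => i; apply: dset_eq.
  exact: dmap_comp (df i) (dmap_fst _ _).
exact: dmap_coord (dmap_snd _ _).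
Qed.

Lemma dset_forall_ord (X : isort) k (P : 'I_k -> X -> Prop) :
  (forall i, dset (P i)) -> dset (fun x => forall i, P i x).
Proof. exact: dset_forall_fin. Qed.
Lemma dmap_extp (X : isort) n (f : X -> ('I_n -> M)) (g : X -> M) :
  @dmap X (power_isort n) f -> @dmap X line_isort g ->
  @dmap X (power_isort n.+1) (fun x => extp (f x) (g x)).
Proof.
move=> df dg; apply: dmap_fun => i; rewrite /extp.
by case: (unlift ord_max i) => [j|//]; apply: dmap_coord.
Qed.

Lemma dmap_proj1 (X Y Z : isort) (f : X -> Y * Z) :
  @dmap X (prod_isort Y Z) f -> dmap (fun x => (f x).1).
Proof. by move=> df; apply: (dmap_comp (dmap_fst Y Z) df). Qed.
Lemma dmap_proj2 (X Y Z : isort) (f : X -> Y * Z) :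
  @dmap X (prod_isort Y Z) f -> dmap (fun x => (f x).2).
Proof. by move=> df; apply: (dmap_comp (dmap_snd Y Z) df). Qed.
End Definability.

(** Reads a first-order formula off the goal and applies the matching closure lemma; definable maps
    and relations in the context serve as atoms. Constants come early, so that the later
    higher-order patterns meet terms that depend on the bound variable. *)
Ltac dstep := match goal with
 | |- is_true _ => fail 1
 | |- @dmap _ _ _ ?X ?Y (fun x => x) => exact (dmap_id X)
 | |- @dmap _ _ _ ?X ?Y (fun x => ?c) => exact (@dmap_const _ _ _ X Y c)
 | |- @dmap _ _ _ ?X _ (fun x => fst (@?f x)) => refine (dmap_proj1 (X := X) (f := f) _)
 | |- @dmap _ _ _ ?X _ (fun x => snd (@?f x)) => refine (dmap_proj2 (X := X) (f := f) _)
 | |- @dmap _ _ _ ?X _ (fun x => (@?f x, @?g x)) => refine (dmap_pair (X := X) (f := f) (g := g) _ _)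
 | |- @dmap _ _ _ ?X _ (fun x => extp (@?f x) (@?g x)) => refine (dmap_extp (X := X) (f := f) (g := g) _ _)
 | H : @dmap _ _ _ ?Y ?Z ?f |- @dmap _ _ _ ?X _ (fun x => ?f (@?g x)) =>
     refine (dmap_comp (X := X) (f := g) H _)
 | |- @dmap _ _ _ ?X _ (fun x => _ _) => refine (dmap_coord (X := X) _ _)
 | |- @dset _ _ _ ?X (fun x => ?P) => exact (@dset_prop _ _ _ X P)
 | |- @dset _ _ _ ?X (fun x => ~ (@?P x)) => refine (dset_not (X := X) (P := P) _)
 | |- @dset _ _ _ ?X (fun x => (@?P x) /\ (@?Q x)) => refine (dset_and (X := X) (P := P) (Q := Q) _ _)
 | |- @dset _ _ _ ?X (fun x => and3 (@?P x) (@?Q x) (@?R x)) =>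
     refine (dset_and3 (X := X) (P := P) (Q := Q) (R := R) _ _ _)
 | |- @dset _ _ _ ?X (fun x => (@?P x) \/ (@?Q x)) => refine (dset_or (X := X) (P := P) (Q := Q) _ _)
 | |- @dset _ _ _ ?X (fun x => (@?P x) <-> (@?Q x)) => refine (dset_iff (X := X) (P := P) (Q := Q) _ _)
 | |- @dset _ _ _ ?X (fun x => (@?P x) -> (@?Q x)) => refine (dset_imp (X := X) (P := P) (Q := Q) _ _)
 | |- @dset _ _ _ ?X (fun x => is_true (Order.lt (@?f x) (@?g x))) => refine (dset_ltM (X := X) (f := f) (g := g) _ _)
 | |- @dset _ _ _ ?X (fun x => is_true (Order.le (@?f x) (@?g x))) => refine (dset_leM (X := X) (f := f) (g := g) _ _)
 | |- @dset _ _ _ ?X (fun x => @eq _ (@?f x) (@?g x)) => refine (dset_eq (X := X) (f := f) (g := g) _ _)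
 | |- @dset _ _ _ ?X (fun x => exists y, @?P x y) => refine (dset_ex (X := X) (R := P) _)
 | |- @dset _ _ _ ?X (fun x => forall y : 'I_ _, @?P x y) => refine (dset_forall_ord (X := X) (P := fun i x => P x i) _); intro
 | |- @dset _ _ _ ?X (fun x => forall y, @?P x y) => refine (dset_all (X := X) (R := P) _)
 | H : @dset _ _ _ ?Y ?A |- @dset _ _ _ ?X (fun x => ?A (@?f x)) => refine (dset_comp (X := X) (P := A) (f := f) H _)
 | H : @dset _ _ _ (prod_isort ?Y ?Z) (fun p => ?A (fst p) (snd p))
   |- @dset _ _ _ ?X (fun x => ?A (@?f x) (@?g x)) =>
     refine (dset_comp (X := X) (f := fun x => (f x, g x)) H _)
 | H : @dset _ _ _ (prod_isort (prod_isort ?Y ?Z) ?W) (fun p => ?A (fst (fst p)) (snd (fst p)) (snd p))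
   |- @dset _ _ _ ?X (fun x => ?A (@?f x) (@?g x) (@?h x)) =>
     refine (dset_comp (X := X) (f := fun x => (f x, g x, h x)) H _)
 end.
Ltac deta := match goal with
 | |- @dset _ _ _ _ (fun _ => _) => fail 1
 | |- @dset _ _ _ ?X ?P => change (dset (X := X) (fun x => P x))
 | |- @dmap _ _ _ _ _ (fun _ => _) => fail 1
 | |- @dmap _ _ _ ?X ?Y ?f => change (dmap (X := X) (Y := Y) (fun x => f x))
 end.
(* A hook, redefined below as new definable operations become available. *)
Ltac dext := fail.
Ltac dfn := repeat (first [assumption | dext | dstep | deta]; cbn [fst snd]).

(** * Definable subsets of the line *)

Section OneVariable.
Context {d : Order.disp_t} {M : orderType d} {S : ominimal_structure M}.
Local Notation L := (line_isort (S := S)).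
Local Notation "x < y" := (Order.lt x y).
Local Notation "x <= y" := (Order.le x y).
Implicit Types (P Q : M -> Prop) (x y z : M).

(** For a definable set of the line, not containing an interval means being finite ([not_fat_list]),
    so [fat] acts as the quantifier for infinitely many points. *)
Definition fat P := exists a b, a < b /\ forall x, a < x -> x < b -> P x.

Lemma fat_mono P Q : (forall x, P x -> Q x) -> fat P -> fat Q.
Proof. by move=> PQ [a [b [ab h]]]; exists a, b; split=> // x ax xb; apply/PQ/h. Qed.

Lemma fat_ne P : fat P -> exists x, P x.
Proof. by move=> [a [b [/(om_dense S)[x [ax xb]] h]]]; exists x; apply: h. Qed.

Lemma dset_fat (X : isort S) (R : X -> M -> Prop) :
  @dset _ _ S (prod_isort X L) (fun p => R p.1 p.2) -> dset (fun u : X => fat (R u)).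
Proof. by move=> dR; rewrite /fat; dfn. Qed.

(** Membership in a finite union of intervals can only change at an endpoint, and [s] lists the
    endpoints. *)
Lemma switch_points P : @dset _ _ S L P -> exists s : seq M, forall x y, x < y ->
  (forall e, e \in s -> x <= e -> e <= y -> False) -> P x <-> P y.
Proof.
move=> /defs1[s sP].
have {sP} Ps x : P x <-> has (fun I => x \in I) s.
  by have := congr1 (@^~ (fun=> x)) sP => /= <-; split=> // -[].
pose ends (I : interval M) := let: Interval l u := I in
  (if l is BSide _ x then [:: x] else [::]) ++ (if u is BSide _ x then [:: x] else [::]).
exists (flatten (map ends s)) => x y xy nos; rewrite !Ps.
elim: s nos {Ps} => //= I s IH nos.
have /IH{}IH : forall e, e \in flatten (map ends s) -> x <= e -> e <= y -> False.
  by move=> e es; apply: nos; rewrite mem_cat es orbT.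
suff : (x \in I) = (y \in I) by move=> ->; split=> /orP[->//|/IH ->]; rewrite orbT.
have {IH}nos e : e \in ends I -> (e < x) || (y < e).
  move=> eI; apply: contrapT => /negP; rewrite negb_or -!leNgt => /andP[xe ey].
  by apply: (nos e) => //; rewrite mem_cat eI.
case: I nos => l u /= nos; rewrite !in_itv /=; congr (_ && _).
- case: l nos => [b e|//] /(_ e); rewrite mem_head => /(_ isT) /orP[ex|ye].
    have ey := lt_trans ex xy.
    by rewrite /Order.lteif; case: b; rewrite ?ex ?ey ?(ltW ex) ?(ltW ey).
  have xe := lt_trans xy ye.
  by rewrite /Order.lteif; case: b; rewrite ?(leNgt e) ?xe ?ye // !ltNge (ltW xe) (ltW ye).
- case: u nos => [b e|//] /(_ e); rewrite mem_cat mem_head orbT => /(_ isT) /orP[ex|ye].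
    have ey := lt_trans ex xy.
    by rewrite /Order.lteif; case: b; rewrite /= ?(leNgt _ e) ?ex ?ey // !ltNge (ltW ex) (ltW ey).
  have xe := lt_trans xy ye.
  by rewrite /Order.lteif; case: b; rewrite /= ?xe ?ye ?(ltW xe) ?(ltW ye).
Qed.

Lemma right_gap (s : seq M) a : exists2 b, a < b & forall e, e \in s -> a < e -> b < e.
Proof.
elim: s => [|e s [b ab IH]]; first by have [b ab] := om_no_max S a; exists b.
have [ae|ea] := ltP a e; last first.
  exists b => // f; rewrite inE => /predU1P[->|]; last exact: IH.
  by move=> /lt_le_trans /(_ ea); rewrite ltxx.
have [c [ac]] := om_dense S (x := a) (y := Order.min b e) ltac:(by rewrite lt_min ab).
rewrite lt_min => /andP[cb ce]; exists c => // f; rewrite inE => /predU1P[->//|fs af].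
exact: lt_trans cb (IH _ fs af).
Qed.

Lemma left_gap (s : seq M) a : exists2 b, b < a & forall e, e \in s -> e < a -> e < b.
Proof.
elim: s => [|e s [b ab IH]]; first by have [b ab] := om_no_min S a; exists b.
have [ae|ea] := ltP e a; last first.
  exists b => // f; rewrite inE => /predU1P[->|]; last exact: IH.
  by move=> /(le_lt_trans ea); rewrite ltxx.
have [c [cb ca]] := om_dense S (x := Order.max b e) (y := a) ltac:(by rewrite gt_max ab).
move: cb; rewrite gt_max => /andP[bc ec]; exists c => // f; rewrite inE => /predU1P[->//|fs af].
exact: lt_trans (IH _ fs af) bc.
Qed.

(** Immediately to the right of [a] there is an interval free of switch points. *)
Lemma right_germ P a : @dset _ _ S L P -> exists2 b, a < b &
  (forall x, a < x -> x < b -> P x) \/ (forall x, a < x -> x < b -> ~ P x).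
Proof.
move=> /switch_points[s sP]; have [b ab nos] := right_gap s a; exists b => //.
have cst x y : a < x -> x < y -> y < b -> P x <-> P y.
  move=> ax xy yb; apply: sP => // e es xe ey.
  by have := lt_trans (nos e es (lt_le_trans ax xe)) (le_lt_trans ey yb); rewrite ltxx.
have [c [ac cb]] := om_dense S ab; have [Pc|nPc] := pselect (P c); [left|right].
  by move=> x ax xb; have [xc|cx|->//] := ltgtP x c; [apply/(cst x c)|apply/(cst c x)].
by move=> x ax xb Px; apply: nPc; have [xc|cx|<-//] := ltgtP x c;
  [apply/(cst x c)|apply/(cst c x)].
Qed.

(** The germ of [P] to the right of the left end [a] decides: where [P] fails, [Q] must hold. *)
Lemma fat_or P Q : @dset _ _ S L P -> fat (fun x => P x \/ Q x) -> fat P \/ fat Q.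
Proof.
move=> dP [a [b [ab h]]]; have [c ac [cP|cP]] := right_germ a dP; [left|right];
  exists a, (Order.min b c); rewrite lt_min ab ac; split=> // x ax;
  rewrite lt_min => /andP[xb xc]; first exact: cP.
by have [/(cP x ax xc)|] := h x ax xb.
Qed.

Lemma not_fat_list P : @dset _ _ S L P -> ~ fat P -> exists s : seq M, forall x, P x -> x \in s.
Proof.
move=> /switch_points[s sP] nfP; exists s => x Px; apply: contrapT => /negP xs; apply: nfP.
have [a ax la] := left_gap s x; have [b xb rb] := right_gap s x.
exists a, b; split; first exact: lt_trans xb.
move=> y ay yb; have [yx|xy|->//] := ltgtP y x.
  apply/(sP y x yx) => // e es ye ex.
  have /(la e es) : e < x by rewrite lt_neqAle ex andbT; apply: contra xs => /eqP <-.
  by move=> /(le_lt_trans ye) /(lt_trans ay); rewrite ltxx.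
apply/(sP x y xy) => // e es xe ey.
have /(rb e es) : x < e by rewrite lt_neqAle xe andbT; apply: contra xs => /eqP ->.
by move=> /lt_le_trans /(_ ey) /(lt_trans yb); rewrite ltxx.
Qed.

Lemma seq_min (s : seq M) P : (exists2 e, e \in s & P e) ->
  exists2 e, e \in s /\ P e & forall f, f \in s -> P f -> e <= f.
Proof.
elim: s => [[]//|e s IH] [f]; rewrite inE => fs Pf.
have [|nex] := pselect (exists2 e, e \in s & P e).
  move=> /IH[m [ms Pm] mmin]; have [Pe|nPe] := pselect (P e /\ e < m).
    exists e; rewrite ?inE ?eqxx; first by case: Pe.
    move=> g; rewrite inE => /predU1P[->//|gs] /(mmin _ gs); apply: le_trans.
    by case: Pe => _ /ltW.
  exists m; first by rewrite inE ms orbT.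
  move=> g; rewrite inE => /predU1P[->|]; last exact: mmin.
  by move=> Pe; rewrite leNgt; apply/negP => em; apply: nPe.
have Pe : P e by case/predU1P: fs => [<-//|fs]; case: nex; exists f.
exists e; first by rewrite inE eqxx.
by move=> g; rewrite inE => /predU1P[->//|gs Pg]; case: nex; exists g.
Qed.

Lemma seq_max (s : seq M) P : (exists2 e, e \in s & P e) ->
  exists2 e, e \in s /\ P e & forall f, f \in s -> P f -> f <= e.
Proof.
elim: s => [[]//|e s IH] [f]; rewrite inE => fs Pf.
have [|nex] := pselect (exists2 e, e \in s & P e).
  move=> /IH[m [ms Pm] mmax]; have [Pe|nPe] := pselect (P e /\ m < e).
    exists e; rewrite ?inE ?eqxx; first by case: Pe.
    move=> g; rewrite inE => /predU1P[->//|gs] /(mmax _ gs) /le_trans; apply.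
    by case: Pe => _ /ltW.
  exists m; first by rewrite inE ms orbT.
  move=> g; rewrite inE => /predU1P[->|]; last exact: mmax.
  by move=> Pe; rewrite leNgt; apply/negP => em; apply: nPe.
have Pe : P e by case/predU1P: fs => [<-//|fs]; case: nex; exists f.
exists e; first by rewrite inE eqxx.
by move=> g; rewrite inE => /predU1P[->//|gs Pg]; case: nex; exists g.
Qed.

Lemma finite_min P x : @dset _ _ S L P -> ~ fat P -> P x ->
  exists2 m, P m & forall y, y < m -> ~ P y.
Proof.
move=> dP /(not_fat_list dP)[s sP] Px.
have [|m [_ Pm] mm] := @seq_min s P; first by exists x => //; apply: sP.
by exists m => // y ym Py; have := mm y (sP _ Py) Py; rewrite leNgt ym.
Qed.

(** Definable completeness. The set [U] of upper bounds is closed upwards and changes only at switch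
    points; the least switch point after which [U] holds throughout is the supremum. *)
Lemma lub_exists P u : @dset _ _ S L P -> (exists x, P x) -> (forall x, P x -> x <= u) ->
  exists s, (forall x, P x -> x <= s) /\ (forall v, (forall x, P x -> x <= v) -> s <= v).
Proof.
move=> dP [l0 Pl0] Pu; pose U y := forall x, P x -> x <= y.
have Uup y z : U y -> y <= z -> U z by move=> Uy yz x /Uy xy; apply: le_trans yz.
have /switch_points[s sU] : @dset _ _ S L U by rewrite /U; dfn.
have [l ll0] := om_no_min S l0; have nUl : ~ U l by move=> /(_ _ Pl0); rewrite leNgt ll0.
have [|e [es Ue] emin] := @seq_min s (fun e => forall y, e < y -> U y).
  apply: contrapT => nex.
  have [w nUw ws] : exists2 w, ~ U w & forall e, e \in s -> e < w.
    elim: s nex {sU} => [|e s IH] nex; first by exists l.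
    have [|w nUw ws] := IH.
      by move=> [f fs Uf]; apply: nex; exists f; rewrite // inE fs orbT.
    have [v [ev nUv]] : exists v, e < v /\ ~ U v.
      apply: contrapT => nv; apply: nex; exists e; first exact: mem_head.
      by move=> y ey; apply: contrapT => nUy; apply: nv; exists y.
    exists (Order.max v w); first by rewrite /Order.max; case: ifP.
    move=> f; rewrite inE lt_max => /predU1P[->|/ws ->]; rewrite ?ev ?orbT //.
  have [z] := om_no_max S (Order.max w u); rewrite gt_max => /andP[wz uz].
  apply: nUw; apply/(sU w z wz); last by apply: (Uup u) => //; apply: ltW.
  by move=> f /ws fw wf; have := lt_le_trans fw wf; rewrite ltxx.
exists e; split.
  move=> x Px; rewrite leNgt; apply/negP => /(om_dense S)[z [/Ue/(_ _ Px) xz zx]].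
  by have := le_lt_trans xz zx; rewrite ltxx.
move=> v Uv; rewrite leNgt; apply/negP => ve.
have [/seq_max[f [fs fv] fmax]|nf] := pselect (exists2 f, f \in s & f <= v).
  have : e <= f.
    apply: emin => // y fy; have [vy|yv] := leP v y; first exact: Uup vy.
    apply/(sU y v yv) => // g gs yg /(fmax g gs) gf.
    by have := lt_le_trans fy (le_trans yg gf); rewrite ltxx.
  by move=> /le_trans /(_ fv); rewrite leNgt ve.
have lv : l < v by rewrite ltNge; apply/negP => /(Uup _ _ Uv).
by apply: nUl; apply/(sU l v lv) => // g gs _ gv; apply: nf; exists g.
Qed.

Lemma glb_exists P u : @dset _ _ S L P -> (exists x, P x) -> (forall x, P x -> u <= x) ->
  exists s, (forall x, P x -> s <= x) /\ (forall v, (forall x, P x -> v <= x) -> v <= s).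
Proof.
move=> dP [x0 Px0] uP; pose Q y := forall x, P x -> y <= x.
have [||s [Qs sQ]] := @lub_exists Q x0 _ _ (fun y Qy => Qy x0 Px0).
- by rewrite /Q; dfn.
- by exists u.
by exists s; split=> [x Px|v /Qs//]; apply: sQ => y; apply.
Qed.
End OneVariable.

Ltac dext ::= match goal with
 | |- @dset _ _ _ ?X (fun x => fat (@?R x)) => refine (dset_fat (X := X) (R := R) _)
 end.

(** * Exchanging two interval quantifiers *)

Section Fubini.
Context {d : Order.disp_t} {M : orderType d} {S : ominimal_structure M}.
Local Notation L := (line_isort (S := S)).
Local Notation LL := (prod_isort L L).
Local Notation "x < y" := (Order.lt x y).
Local Notation "x <= y" := (Order.le x y).

Lemma between2 (a b c : M) : a < b -> a < c -> exists x, [/\ a < x, x < b & x < c].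
Proof.
move=> ab ac; have [x [ax]] := om_dense S (x := a) (y := Order.min b c) ltac:(by rewrite lt_min ab).
by rewrite lt_min => /andP[xb xc]; exists x.
Qed.

Lemma between3 (a b c e : M) : a < b -> a < c -> a < e ->
  exists x, [/\ a < x, x < b, x < c & x < e].
Proof.
move=> ab ac ae; have [x [ax xb xc]] := between2 ab ac.
by have [y [ay yx ye]] := between2 ax ae; exists y; split=> //; apply: lt_trans yx _.
Qed.

(** If the values [v] that occur do not fill an interval, they are finitely many, and an interval of
    [x] is a finite union of the sets belonging to them. *)
Lemma fat_exists (R : M -> M -> Prop) : @dset _ _ S LL (fun p => R p.1 p.2) ->
  fat (fun x => exists v, R x v) ->
  (exists v, fat (fun x => R x v)) \/ fat (fun v => exists x, R x v).
Proof.
move=> dR fR; apply: contrapT => /not_orP[nv nf]; apply: nv.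
have [|s sR] := not_fat_list (S := S) _ nf; first by dfn.
have {nf sR} : fat (fun x => exists2 v, v \in s & R x v).
  by apply: fat_mono fR => x [v Rxv]; exists v => //; apply: sR; exists x.
elim: s => [/(fat_ne (S := S))[x []]//|v s IH] fs.
have /(fat_or (S := S)) [||/IH//] : fat (fun x => R x v \/ exists2 v, v \in s & R x v).
- by apply: fat_mono fs => x [w]; rewrite inE => /predU1P[->|ws] Rxw; [left|right; exists w].
- by dfn.
- by exists v.
Qed.

(* For fixed [b0], [h b := min {c > b0 | Z c b}] is nondecreasing and right
   locally constant, so it has no jumps near [b0] and is constant there, while
   [h b] must tend to [b0]. *)
Lemma no_nested_family (Z : M -> M -> Prop) (k0 k1 : M) :
  @dset _ _ S LL (fun p => Z p.1 p.2) -> k0 < k1 ->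
  (forall c b, Z c b -> c < b) ->
  (forall c b t, Z c b -> c < t -> t < b -> Z c t) ->
  (forall c b, Z c b -> exists2 b', b < b' & Z c b') ->
  (forall c, k0 < c -> c < k1 -> exists b, Z c b) ->
  (forall b, ~ fat (fun c => Z c b)) -> False.
Proof.
move=> dZ k01 Zlt Zdown Zopen Zinit Zfin; have [b0 [kb0 bk1]] := om_dense S k01.
pose Hm b c := [/\ b0 < c, Z c b & forall c', b0 < c' -> c' < c -> ~ Z c' b].
have dHm : @dset _ _ S LL (fun p => Hm p.1 p.2).
  apply: (eq_dset (P := fun p : LL => b0 < p.2 /\ Z p.2 p.1 /\
    forall c', b0 < c' -> c' < p.2 -> ~ Z c' p.1)); last by dfn.
  by move=> [b c]; split=> [[? []]|[? ? ?]].
have [e be [ex|nex]] := right_germ (S := S) (P := fun b => exists c, b0 < c /\ Z c b) b0 ltac:(by dfn);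
  last first.
  have [c [bc ck ce]] := between2 bk1 be.
  have [b Zcb] := Zinit c (lt_trans kb0 bc) ck.
  have [t [ct tb te]] := between2 (Zlt _ _ Zcb) ce.
  by apply: (nex t (lt_trans bc ct) te); exists c; split=> //; apply: Zdown Zcb ct tb.
have hex b : b0 < b -> b < e -> exists c, Hm b c.
  move=> bb /(ex _ bb)[c0 c0P].
  have [||c [b0c Zcb] cmin] := @finite_min _ _ S (fun c => b0 < c /\ Z c b) c0 _ _ c0P.
  - by dfn.
  - by move=> h; apply: (Zfin b); apply: fat_mono h => ? [].
  by exists c; split=> // c' b0c' c'c Zc'; apply: (cmin c').
have hmono b b' c c' : b < b' -> Hm b c -> Hm b' c' -> c <= c'.
  move=> bb' [bc Zcb cmin] [b0c' Zc'b' _]; rewrite leNgt; apply/negP => c'c.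
  apply: (cmin c') => //; apply: Zdown Zc'b' _ bb'.
  exact: lt_trans c'c (Zlt _ _ Zcb).
pose jump t := forall b b' c c', b0 < b -> b < t -> t < b' -> b' < e ->
  Hm b c -> Hm b' c' -> c < c'.
have [e' be' [jmp|njmp]] := right_germ (S := S) (P := jump) b0 ltac:(by rewrite /jump; dfn).
  have [b [b0b lbe lbe']] := between2 be be'.
  have [c hbc] := hex b b0b lbe; have [b0c Zcb _] := hbc.
  have [b1 bb1 Zcb1] := Zopen _ _ Zcb.
  have [b' [bb' b'b1 b'e b'e']] := between3 bb1 lbe lbe'.
  have [t [bt tb']] := om_dense S bb'.
  have [c' hb'c'] := hex b' (lt_trans b0b bb') b'e; have [_ _ c'min] := hb'c'.
  have := jmp t (lt_trans b0b bt) (lt_trans tb' b'e') b b' c c' b0b bt tb' b'e hbc hb'c'.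
  by move=> /(c'min _ b0c); apply; apply: Zdown Zcb1 _ b'b1; apply: lt_trans bb'; apply: Zlt.
have [b1 [b0b1 b1e b1e']] := between2 be be'.
have [c hb1c] := hex b1 b0b1 b1e; have [b0c _ _] := hb1c.
(* The level set of the value [c] of [h] at [b1]. Its infimum [s] lies above [b0], because [Z c b]
   forces [c < b], and [h] jumps at [s], against the choice of [e']. *)
pose Q b := [/\ b0 < b, b <= b1 & Hm b c].
have dQ : @dset _ _ S L Q.
  apply: (eq_dset (P := fun b : L => b0 < b /\ b <= b1 /\ Hm b c)); last by dfn.
  by move=> b; split=> [[? []]|[? ? ?]].
have [||s [Qs sQ]] := glb_exists (u := c) dQ.
- by exists b1; split.
- by move=> b [_ _ [_ Zcb _]]; apply: ltW; apply: Zlt Zcb.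
have cs : c <= s by apply: sQ => b [_ _ [_ Zcb _]]; apply: ltW; apply: Zlt Zcb.
have b0s := lt_le_trans b0c cs; have sb1 : s <= b1 by apply: Qs; split.
apply: (njmp s b0s (le_lt_trans sb1 b1e')) => b b' v v' b0b bs sb' b'e hbv hb'v'.
rewrite ltNge; apply/negP => v'v.
have [t [b0t tb1 htc] tb'] : exists2 t, Q t & t < b'.
  apply: contrapT => nt; have : b' <= s; last by rewrite leNgt sb'.
  by apply: sQ => t Qt; rewrite leNgt; apply/negP => tb'; apply: nt; exists t.
have st := Qs t (And3 b0t tb1 htc).
have vc := hmono _ _ _ _ (lt_le_trans bs st) hbv htc.
have cv' := hmono _ _ _ _ tb' htc hb'v'.
have ev : v = c by apply: le_anti; rewrite vc (le_trans cv').
rewrite {}ev in hbv; have : s <= b by apply: Qs; split=> //; apply: le_trans (ltW bs) sb1.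
by rewrite leNgt bs.
Qed.

(** Consider the supremum of [Phi x] as a function of [x]. If it is infinite for an interval of [x],
    any [p] works; if it is constant on an interval, take [p] just below that constant; if its
    values fill an interval, take [p] inside it and keep the [x] with a larger supremum. *)
Lemma fat_uniform (X : M -> Prop) (Phi : M -> M -> Prop) (C : M -> Prop) :
  @dset _ _ S L X -> @dset _ _ S LL (fun p => Phi p.1 p.2) -> fat X ->
  (forall x p q, Phi x p -> q < p -> Phi x q) ->
  (forall p q, C p -> p < q -> C q) -> (forall p, C p -> exists2 q, q < p & C q) ->
  (forall x, X x -> exists2 p, C p & Phi x p) ->
  exists2 p, C p & fat (fun x => X x /\ Phi x p).
Proof.
move=> dX dP fX Pdown Cup Copen XC.
have [x0 Xx0] := fat_ne (S := S) fX; have [p0 Cp0 _] := XC x0 Xx0.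
have : fat (fun x => (X x /\ forall p, Phi x p) \/ (X x /\ ~ forall p, Phi x p)).
  by apply: fat_mono fX => x Xx; have [|] := pselect (forall p, Phi x p); [left|right].
move=> /(fat_or (S := S)) [||fub]; first by dfn.
  by move=> h; exists p0 => //; apply: fat_mono h => x [].
pose lub x v := X x /\ (forall p, Phi x p -> p <= v) /\
  (forall w, (forall p, Phi x p -> p <= w) -> v <= w).
have dlub : @dset _ _ S LL (fun p => lub p.1 p.2) by rewrite /lub; dfn.
have lubP x v p : lub x v -> p < v -> Phi x p.
  move=> [_ [_ vmin]] pv; apply: contrapT => nP; have : v <= p; last by rewrite leNgt pv.
  by apply: vmin => q Pq; rewrite leNgt; apply/negP => /(Pdown _ _ _ Pq).
have {fub} : fat (fun x => exists v, lub x v).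
  apply: fat_mono fub => x [Xx /existsNP[u nPu]].
  have [|||v [vub vmin]] := @lub_exists _ _ S (Phi x) u.
  - by dfn.
  - by have [p _ Pp] := XC x Xx; exists p.
  - by move=> p Pp; rewrite leNgt; apply/negP => /(Pdown _ _ _ Pp).
  by exists v; split.
move=> /(fat_exists dlub) [[v fv]|[a [b [ab vs]]]].
  have [x lx] := fat_ne (S := S) fv; have [Xx [xv _]] := lx; have [p Cp Pp] := XC x Xx.
  have [q qp Cq] := Copen p Cp; exists q => //; apply: fat_mono fv => y ly.
  by split; [case: ly|apply: lubP ly _; apply: lt_le_trans qp (xv _ Pp)].
have [v0 [av0 v0b]] := om_dense S ab; have [x lx] := vs v0 av0 v0b.
have [Xx [xv _]] := lx; have [p1 Cp1 Pp1] := XC x Xx.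
have [p [vp pb]] := om_dense S v0b; exists p; first exact: Cup Cp1 (le_lt_trans (xv _ Pp1) vp).
pose R v x := lub x v /\ p < v.
have dR : @dset _ _ S LL (fun q => R q.1 q.2) by rewrite /R; dfn.
have /(fat_exists dR)[[y [a' [b' [ab' h]]]]|] : fat (fun v => exists x, R v x).
- exists p, b; split=> // v pv vb.
  by have [y ly] := vs v (lt_trans av0 (lt_trans vp pv)) vb; exists y.
- have [v [av vb]] := om_dense S ab'; have [w [vw wb]] := om_dense S vb.
  have [[_ [_ vmin]] _] := h w (lt_trans av vw) wb; have [[_ [vub _]] _] := h v av vb.
  by have := vmin v vub; rewrite leNgt vw.
- by apply: fat_mono => y [v [ly pv]]; split; [case: ly|apply: lubP ly pv].
Qed.

(** Suppose that no row contains an interval. No point starts an interval of the fibre for an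
    interval of [x], so by [fat_exists] the left ends of intervals of fibres fill an interval;
    attaching to each left end the first fibre in which it occurs produces a family excluded by
    [no_nested_family]. *)
Lemma fat_swap_one (A : M -> M -> Prop) : @dset _ _ S LL (fun p => A p.1 p.2) ->
  fat (fun x => fat (A x)) -> exists y, fat (fun x => A x y).
Proof.
move=> dA fA; apply: contrapT => /forallNP nfA.
(* A common lower bound [p1] for the fibres, so that their intervals have left ends. *)
have [p1 _ fB] : exists2 p, True & fat (fun x => fat (A x) /\ fat (fun y => A x y /\ p < y)).
  apply: (@fat_uniform (fun x => fat (A x)) (fun x p => fat (fun y => A x y /\ p < y))) => //.
  - by apply: dset_fat; dfn.
  - by apply: (dset_fat (R := fun (u : LL) y => A u.1 y /\ u.2 < y)); dfn.
  - by move=> x p q h qp; apply: fat_mono h => y [? /(lt_trans qp)].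
  - by move=> p _; have [q qp] := om_no_min S p; exists q.
  - by move=> x [u [v [uv h]]]; exists u => //; exists u, v; split=> // y uy yv; split=> //; apply: h.
pose B x y := A x y /\ p1 < y.
have dB : @dset _ _ S LL (fun q => B q.1 q.2) by rewrite /B; dfn.
pose X x := fat (B x).
have dX : @dset _ _ S L X by apply: dset_fat.
have {}fB : fat X by apply: fat_mono fB => x [].
have nfB y : ~ fat (fun x => B x y) by move=> h; apply: (nfA y); apply: fat_mono h => x [].
pose st x c := exists c', c < c' /\ forall t, c < t -> t < c' -> B x t.
have dst : @dset _ _ S LL (fun q => st q.1 q.2) by rewrite /st; dfn.
pose lst x c := st x c /\ ~ exists c', c' < c /\ forall t, c' < t -> t <= c -> B x t.
have dlst : @dset _ _ S LL (fun q => lst q.1 q.2) by rewrite /lst; dfn.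
have nst c : ~ fat (fun x => st x c).
  move=> fst.
  have [||||||p cp fp] := @fat_uniform (fun x => st x c)
      (fun x p => forall t, c < t -> t < p -> B x t) (fun p => c < p) _ _ fst => //.
  - by dfn.
  - by dfn.
  - by move=> x p q h qp t ct tq; apply: h ct (lt_trans tq qp).
  - by move=> p q; apply: lt_trans.
  - by move=> p /(om_dense S)[q [cq qp]]; exists q.
  - by move=> x [p [cp h]]; exists p.
  have [y [cy yp]] := om_dense S cp; apply: (nfB y).
  by apply: fat_mono fp => x [_]; apply.
have nlst x : ~ fat (lst x).
  move=> [a [b [ab h]]]; have [c [ac cb]] := om_dense S ab.
  have [[c' [cc' hc]] _] := h c ac cb; have [e [ce ec' eb]] := between2 cc' cb.
  have [_] := h e (lt_trans ac ce) eb; apply; exists c; split=> // t ct te.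
  exact: hc ct (le_lt_trans te ec').
have exl : fat (fun x => exists c, lst x c).
  apply: fat_mono fB => x /[dup] fx [u [v [uv h]]]; have [w [uw wv]] := om_dense S uv.
  pose Q z := z < w /\ forall t, z < t -> t < w -> B x t.
  have Qu : Q u by split=> // t ut tw; apply: h ut (lt_trans tw wv).
  have [||c [cQ Qc]] := @glb_exists _ _ S Q p1 _ (ex_intro _ u Qu).
  - by rewrite /Q; dfn.
  - move=> z [zw zB]; rewrite leNgt; apply/negP => zp.
    have [t [zt tp tw]] := between2 zp zw; have [_] := zB t zt tw.
    by rewrite ltNge (ltW tp).
  have cw : c < w by apply: le_lt_trans (cQ _ Qu) _.
  have cB t : c < t -> t < w -> B x t.
    move=> ct tw; have [z Qz zt] : exists2 z, Q z & z < t.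
      apply: contrapT => nz; have : t <= c; last by rewrite leNgt ct.
      by apply: Qc => z Qz; rewrite leNgt; apply/negP => zt; apply: nz; exists z.
    by case: Qz => _; apply.
  exists c; split; first by exists w; split.
  move=> [c' [c'c h']]; have : c <= c'; last by rewrite leNgt c'c.
  apply: cQ; split; first exact: lt_trans cw.
  by move=> t c't tw; have [tc|ct] := leP t c; [apply: h'|apply: cB].
have [[c fc]|[k0 [k1 [k01 kK]]]] := fat_exists dlst exl.
  by apply: (nst c); apply: fat_mono fc => x [].
(* [G c x] selects the least [x] whose fibre has an interval starting at [c], and [Z c b] says that
   this interval extends beyond [b]. *)
pose G c x := lst x c /\ forall x', x' < x -> ~ lst x' c.
have dG : @dset _ _ S LL (fun q => G q.1 q.2) by rewrite /G; dfn.
pose Z c b := exists x, G c x /\ c < b /\ exists b', b < b' /\ forall t, c < t -> t < b' -> B x t.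
apply: (@no_nested_family Z k0 k1) => //.
- by rewrite /Z; dfn.
- by move=> c b [x [_ []]].
- move=> c b t [x [Gx [cb [b' [bb' h]]]]] ct tb; exists x; split=> //; split=> //.
  by exists b'; split=> //; apply: lt_trans bb'.
- move=> c b [x [Gx [cb [b' [bb' h]]]]]; have [u [bu ub']] := om_dense S bb'.
  by exists u => //; exists x; split=> //; split; [apply: lt_trans bu|exists b'].
- move=> c k0c ck1; have [x0 lx0] := kK c k0c ck1.
  have [||x lx xmin] := @finite_min _ _ S (fun x => lst x c) x0 _ _ lx0.
  - by dfn.
  - by move=> h; apply: (nst c); apply: fat_mono h => x [].
  have [[c' [cc' h]] _] := lx; have [b [cb bc']] := om_dense S cc'.
  by exists b, x; split=> //; split=> //; exists c'.
- move=> b fb; pose R c x := G c x /\ B x b.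
  have [||[x fx]|fx] := @fat_exists R.
  - by rewrite /R; dfn.
  - apply: fat_mono fb => c [x [Gx [cb [b' [bb' h]]]]]; exists x; split=> //; exact: h.
  - by apply: (nlst x); apply: fat_mono fx => c [[]].
  - by apply: (nfB b); apply: fat_mono fx => x [c []].
Qed.

(** Delete the rows that contain an interval. If these rows did not fill an interval, the remaining
    set would still satisfy the hypothesis of [fat_swap_one] and so have a row containing an
    interval. *)
Lemma fat_swap (A : M -> M -> Prop) : @dset _ _ S LL (fun p => A p.1 p.2) ->
  fat (fun x => fat (A x)) -> fat (fun y => fat (fun x => A x y)).
Proof.
move=> dA fA; apply: contrapT => nf.
have dF : @dset _ _ S L (fun y => fat (fun x => A x y)).
  by apply: (dset_fat (R := fun y x => A x y)); dfn.
have [||y fy] := @fat_swap_one (fun x y => A x y /\ ~ fat (fun x' => A x' y)).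
- by dfn.
- apply: fat_mono fA => x fx.
  have : fat (fun y => fat (fun x' => A x' y) \/ (A x y /\ ~ fat (fun x' => A x' y))).
    by apply: fat_mono fx => y Axy; have [|] := pselect (fat (fun x' => A x' y)); [left|right].
  by move=> /(fat_or (S := S)) [//|/nf|].
- by have [x [_]] := fat_ne (S := S) fy; apply; apply: fat_mono fy => ? [].
Qed.
End Fubini.

(** * Dimension *)

(* [dq n k P] says that dim P >= k for P in M^n, by recursion on the last     *)
(* coordinate; its invariance under permuting coordinates rests on [fat_swap]. *)
Fixpoint dq (d : Order.disp_t) (M : orderType d) n (k : nat) : (('I_n -> M) -> Prop) -> Prop :=
  match n with
  | 0 => fun P => k = 0 /\ exists v, P v
  | n.+1 => fun P => dq k (fun y : 'I_n -> M => exists t, P (extp y t)) \/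
     exists2 k', k = k'.+1 & dq k' (fun y : 'I_n -> M => fat (fun t => P (extp y t)))
  end.

Section DimensionQuantifiers.
Context {d : Order.disp_t} {M : orderType d} {S : ominimal_structure M}.
Local Notation L := (line_isort (S := S)).

(** The properties that a quantifier for dimension at least [k] must have in order to be iterated
    along products and exchanged with others. *)
Record dquant (X : isort S) := DQuant {
  dqf :> nat -> (X -> Prop) -> Prop;
  dqf_mono : forall k P Q, (forall x, P x -> Q x) -> dqf k P -> dqf k Q;
  dqf_or : forall k P Q, dset P -> dset Q ->
    dqf k (fun x => P x \/ Q x) -> dqf k P \/ dqf k Q;
  dqf_def : forall k (Y : isort S) (R : Y -> X -> Prop),
    @dset _ _ S (prod_isort Y X) (fun p => R p.1 p.2) -> dset (fun y => dqf k (R y));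
  dqf_ne : forall k P, dqf k P -> exists x, P x;
  dqf_0 : forall P x, P x -> dqf 0 P;
  dqf_le : forall k P, dqf k.+1 P -> dqf k P
}.

Section Theory.
Variables (X : isort S) (D : dquant X).

Lemma dqf_leq j k (P : X -> Prop) : j <= k -> D k P -> D j P.
Proof.
move=> /subnK <-; elim: (k - j) => [//|i IH].
by rewrite addSn => /dqf_le.
Qed.

Lemma dqf_ord k n (P : 'I_n -> X -> Prop) : (forall i, dset (P i)) ->
  D k (fun x => exists i, P i x) -> exists i, D k (P i).
Proof.
elim: n P => [|n IH] P dP; first by move=> /dqf_ne[x [[]]].
move=> h; have : D k (fun x => P ord0 x \/ exists i, P (lift ord0 i) x).
  by apply: dqf_mono h => x [i]; case: (unliftP ord0 i) => [j|] ->; [right; exists j|left].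
move=> /dqf_or [//||D0|].
- suff : dset (fun x => ~ forall i, ~ P (lift ord0 i) x).
    apply: eq_dset => x; split=> [h'|[i Pi] /(_ i)//].
    by apply: contrapT => nex; apply: h' => i Pi; apply: nex; exists i.
  by apply/dset_not/dset_forall_fin => i; apply/dset_not/dP.
- by exists ord0.
- by move=> /IH [|i]; [by move=> i; apply: dP|exists (lift ord0 i)].
Qed.

(** A number [s] has finitely many splittings, so [dqf_or] selects one that holds on a set of the
    full dimension [k]. *)
Lemma dqf_sum k s (P : nat -> nat -> X -> Prop) : (forall a b, dset (P a b)) ->
  D k (fun x => exists a b, a + b = s /\ P a b x) <-> exists a b, a + b = s /\ D k (P a b).
Proof.
move=> dP; split; last first.
  by move=> [a [b [e h]]]; apply: dqf_mono h => x Px; exists a, b.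
move=> h; have [|i Di] := @dqf_ord k s.+1 (fun i => P i (s - i)) (fun i => dP _ _).
  apply: dqf_mono h => x [a [b [e h]]].
  have ltas : a < s.+1 by rewrite ltnS -e leq_addr.
  by exists (Ordinal ltas); rewrite /= -e addKn.
by exists i, (s - i); split=> //; rewrite subnKC // -ltnS.
Qed.
End Theory.

(** Dimension of a relation counted as base plus fibre; additivity will say that this does not
    depend on which factor is the base. *)
Definition tens (X Y : isort S) (D : nat -> (X -> Prop) -> Prop) (E : nat -> (Y -> Prop) -> Prop)
    k (R : X -> Y -> Prop) : Prop :=
  exists i j, i + j = k /\ D i (fun x => E j (R x)).

Lemma line_mono k (P Q : M -> Prop) : (forall x, P x -> Q x) ->
  (if k is k'.+1 then k' = 0 /\ fat P else exists x, P x) ->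
  (if k is k'.+1 then k' = 0 /\ fat Q else exists x, Q x).
Proof.
by case: k => [|k] PQ; [case=> x /PQ; exists x|case=> -> h; split=> //; apply: fat_mono h].
Qed.

Definition dline : dquant L.
Proof.
exists (fun k P => if k is k'.+1 then k' = 0 /\ fat P else exists x, P x).
- exact: line_mono.
- move=> [|k] P Q dP dQ; first by case=> x [Px|Qx]; [left|right]; exists x.
  by case=> -> /(fat_or dP)[]; [left|right].
- by move=> [|k] Y R dR /=; dfn.
- by move=> [|k] P; [|case=> _ /(fat_ne (S := S))].
- by move=> P x Px; exists x.
- by move=> [|k] P [k0 /(fat_ne (S := S)) h]; rewrite ?k0.
Defined.

Lemma dq_mono n k (P Q : ('I_n -> M) -> Prop) : (forall x, P x -> Q x) -> dq k P -> dq k Q.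
Proof.
elim: n k P Q => [|n IH] k P Q PQ /=; first by case=> -> [v /PQ]; split=> //; exists v.
case=> [h|[k' -> h]]; [left|right; exists k' => //]; apply: IH h => y.
  by move=> [t /PQ]; exists t.
by apply: fat_mono => t /PQ.
Qed.

Lemma dq_ne n k (P : ('I_n -> M) -> Prop) : dq k P -> exists v, P v.
Proof.
elim: n k P => [|n IH] k P /=; first by case.
by case=> [|[k' _]] /IH[y]; [case=> t|move=> /(fat_ne (S := S))[t]]; exists (extp y t).
Qed.

Lemma dqS n k (P : ('I_n.+1 -> M) -> Prop) :
  dq k P <-> tens (X := power_isort n) (@dq _ M n) dline k (fun y t => P (extp y t)).
Proof.
split=> [[h|[k' -> h]]|[i [j [<- ]]]] /=.
- by exists k, 0; rewrite addn0.
- exists k', 1; rewrite addn1; split=> //.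
  by apply: dq_mono h => y.
- case: j => [|j]; first by rewrite addn0; left.
  move=> h; right; exists i; last by apply: dq_mono h => y [].
  by have [y [-> _]] := dq_ne h; rewrite addn1.
Qed.

Lemma tens_mono (X Y : isort S) (D : dquant X) (E : dquant Y) k (R R' : X -> Y -> Prop) :
  (forall x y, R x y -> R' x y) -> tens D E k R -> tens D E k R'.
Proof.
move=> RR' [i [j [e h]]]; exists i, j; split=> //.
by apply: dqf_mono h => x; apply: dqf_mono => y; apply: RR'.
Qed.

Definition dpow n : dquant (power_isort n).
Proof.
exists (@dq _ M n).
- exact: dq_mono.
- elim: n => [|n IH] k P Q dP dQ.
    by move=> [-> [v [|]]]; [left|right]; split=> //; exists v.
  move=> [h|[k' -> h]].
    have /IH[||h'|h'] : dq k (fun y => (exists t, P (extp y t)) \/ exists t, Q (extp y t)).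
    + by apply: dq_mono h => y [t [Pt|Qt]]; [left|right]; exists t.
    + by dfn.
    + by dfn.
    + by left; left.
    + by right; left.
  have /IH[||h'|h'] : dq k' (fun y => fat (fun t => P (extp y t)) \/ fat (fun t => Q (extp y t))).
  + apply: dq_mono h => y; apply: (fat_or (S := S)).
    by apply: (dset_comp (f := fun t => extp y t : power_isort n.+1) dP); dfn.
  + by dfn.
  + by dfn.
  + by left; right; exists k'.
  + by right; right; exists k'.
- elim: n => [|n IH] k Y R dR /=.
    by dfn.
  have dR' : @dset _ _ S (prod_isort (prod_isort Y (power_isort n)) L)
      (fun p => R p.1.1 (extp p.1.2 p.2)).
    by dfn.
  apply: dset_or; first by apply: IH; dfn.
  case: k => [|k].
    apply: (@eq_dset _ _ S Y (fun=> False)); last exact: dset_prop.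
    by move=> y; split=> // -[].
  apply: (@eq_dset _ _ S Y (fun y => dq k (fun v => fat (fun t => R y (extp v t))))).
    by move=> y; split=> [h|[k' [->]]]; first by exists k.
  by apply: IH; dfn.
- by move=> k P; apply: dq_ne.
- elim: n => [|n IH] P v Pv; first by split=> //; exists v.
  left; apply: (IH _ (fun i => v (lift ord_max i))); exists (v ord_max).
  rewrite (_ : extp _ _ = v) //.
  by apply/funext => i; rewrite /extp; case: unliftP => [j|] ->.
- elim: n => [|n IH] k P; first by case.
  move=> [h|[k' [->] h]]; first by left; apply: IH.
  by left; apply: dq_mono h => y /(fat_ne (S := S)).
Defined.

Definition swaps (X Y : isort S) (D : nat -> (X -> Prop) -> Prop) (E : nat -> (Y -> Prop) -> Prop) :=
  forall R k, @dset _ _ S (prod_isort X Y) (fun p => R p.1 p.2) ->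
    tens D E k R <-> tens E D k (fun y x => R x y).

Lemma swaps_sym (X Y : isort S) D E : @swaps X Y D E -> swaps E D.
Proof.
move=> sw R k dR; symmetry; apply: sw.
by apply: (dset_comp (f := fun p : prod_isort X Y => (p.2, p.1)) dR); dfn.
Qed.

(** The plane is the only case with content: degrees (1,1) are [fat_swap], and degrees (1,0) are
    [fat_exists]. *)
Lemma swaps_line : swaps dline dline.
Proof.
suff h (R : M -> M -> Prop) k : @dset _ _ S (prod_isort L L) (fun p => R p.1 p.2) ->
    tens (X := L) (Y := L) dline dline k R -> tens (X := L) (Y := L) dline dline k (fun y x => R x y).
  by move=> R k dR; split; apply: h => //; apply: (dset_comp (f := fun p : prod_isort L L => (p.2, p.1)) dR); dfn.
move=> dR [[|i] [[|j] [<- /=]]].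
- by move=> [x [y Rxy]]; exists 0, 0; split=> //; exists y, x.
- move=> [x [-> fR]]; exists 1, 0; split=> //; split=> //.
  by apply: fat_mono fR => y; exists x.
- move=> [-> /(fat_exists dR)[[v fv]|fv]]; last by exists 1, 0.
  by exists 0, 1; split=> //; exists v.
- move=> [-> h]; have [x [-> _]] := fat_ne (S := S) h; exists 1, 1; split=> //; split=> //.
  have {}h : fat (fun x => fat (R x)) by apply: fat_mono h => ? [].
  by apply: fat_mono (fat_swap dR h) => y.
Qed.

(** Induction on the number of coordinates: split off the last one, move [D] past the others and
    then past it, and reassemble. At each stage [dqf_sum] redistributes the degrees. *)
Lemma swaps_dpow (X : isort S) (D : dquant X) n : swaps D dline -> swaps D (dpow n).
Proof.
move=> swD; elim: n => [|n IH] R k dR.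
  split=> [[i [j [<- h]]]|[i [j [<- [-> [v h]]]]]].
    have [x [-> _]] := dqf_ne h; exists 0, i; split; first by rewrite addnC.
    split=> //; have [x0 [_ [v _]]] := dqf_ne h; exists v; apply: dqf_mono h => y [_ [w]].
    by have -> : w = v by apply/funext => -[].
  exists j, 0; split; first by rewrite addnC.
  by apply: dqf_mono h => x Rxv; split=> //; exists v.
have dR' : @dset _ _ S (prod_isort (prod_isort X (power_isort n)) L)
      (fun p => R p.1.1 (extp p.1.2 p.2)) by dfn.
have dR1 b : @dset _ _ S (prod_isort X (power_isort n))
    (fun p => dline b (fun t => R p.1 (extp p.2 t))).
  by apply: (dqf_def dline b (Y := prod_isort X (power_isort n)) (R := fun p t => R p.1 (extp p.2 t))).
have dR2 i : @dset _ _ S (prod_isort (power_isort n) L)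
    (fun p => D i (fun x => R x (extp p.1 p.2))).
  by apply: (dqf_def D i (Y := prod_isort (power_isort n) L) (R := fun p x => R x (extp p.1 p.2))); dfn.
transitivity (exists b s, s + b = k /\ tens D (dpow n) s (fun x y => dline b (fun t => R x (extp y t)))).
  split.
    move=> [i [s [e h]]].
    have {}h : D i (fun x => exists a b, a + b = s /\ dpow n a (fun y => dline b (fun t => R x (extp y t)))).
      by apply: dqf_mono h => x /dqS.
    have [a [b [e' h']]] := (dqf_sum D i s (fun a b => dqf_def (dpow n) a (dR1 b))).1 h.
    by exists b, (i + a); split; [lia|exists i, a].
  move=> [b [s [e [i [a [e' h]]]]]]; exists i, (a + b); split; first by lia.
  by apply: dqf_mono h => x h; apply/dqS; exists a, b.
transitivity (exists b s, s + b = k /\ tens (dpow n) D s (fun y x => dline b (fun t => R x (extp y t)))).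
  by split=> -[b [s [e h]]]; exists b, s; split=> //; apply/IH.
transitivity (exists a s, a + s = k /\ dpow n a (fun y => tens D dline s (fun x t => R x (extp y t)))).
  have dT i j : @dset _ _ S (power_isort n) (fun y => D i (fun x => dline j (fun t => R x (extp y t)))).
    refine (dqf_def D i (Y := power_isort n) (R := fun y x => dline j (fun t => R x (extp y t))) _).
    by apply: (dset_comp (f := fun p : prod_isort (power_isort n) X => (p.2, p.1)) (dR1 j)); dfn.
  split.
    move=> [b [s [e [a [i [e' h]]]]]]; exists a, (i + b); split; first by lia.
    by apply: dqf_mono h => y h; exists i, b.
  move=> [a [s [e h]]]; have [i [b [e' h']]] := (dqf_sum (dpow n) a s dT).1 h.
  by exists b, (a + i); split; [lia|exists a, i].
transitivity (exists a s, a + s = k /\ dpow n a (fun y => tens dline D s (fun t x => R x (extp y t)))).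
  have dRy y : @dset _ _ S (prod_isort X L) (fun p => R p.1 (extp y p.2)).
    by apply: (dset_comp (f := fun p : prod_isort X L => (p.1, y, p.2)) dR'); dfn.
  by split=> -[a [s [e h]]]; exists a, s; split=> //; apply: dqf_mono h => y; apply: (swD _ _ (dRy y)).1
    || apply: (swD _ _ (dRy y)).2.
split.
  move=> [a [s [e h]]].
  have dT b i : @dset _ _ S (power_isort n) (fun y => dline b (fun t => D i (fun x => R x (extp y t)))).
    exact: (dqf_def dline b (Y := power_isort n)).
  have [b [i [e' h']]] := (dqf_sum (dpow n) a s dT).1 h.
  by exists (a + b), i; split; [lia|apply/dqS; exists a, b].
move=> [s [i [e /dqS[a [b [e' h]]]]]]; exists a, (b + i); split; first by lia.
by apply: dq_mono h => y h; exists b, i.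
Qed.

Lemma swaps_pow m n : swaps (dpow m) (dpow n).
Proof. exact/swaps_dpow/swaps_sym/swaps_dpow/swaps_line. Qed.

Lemma dmap_cat (X : isort S) N m n (e : N = m + n) (f : X -> ('I_m -> M)) (g : X -> ('I_n -> M)) :
  @dmap _ _ S X (power_isort m) f -> @dmap _ _ S X (power_isort n) g ->
  @dmap _ _ S X (power_isort N) (fun x i => catp (f x) (g x) (cast_ord e i)).
Proof.
move=> df dg; apply: dmap_fun => i; rewrite /catp.
by case: (split _) => j; apply: dmap_coord.
Qed.

(** The equation [e] keeps the length [N] free, so that the recursion of [dq] on the last coordinate
    can follow the induction on [n]. *)
Lemma dq_cat N m n (e : N = m + n) k (P : ('I_N -> M) -> Prop) : @dset _ _ S (power_isort N) P ->
  dq k P <-> tens (dpow m) (dpow n) k (fun x y => P (fun i => catp x y (cast_ord e i))).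
Proof.
elim: n N e k P => [|n IH] N e k P dP.
  have eN : N = m by rewrite e addn0.
  move/esym: eN => eN; case: N / eN e P dP => e P dP; have cat0 x y : (fun i => catp x y (cast_ord e i)) = x :> ('I_m -> M).
    apply/funext => i; have -> : cast_ord e i = lshift 0 i by exact: val_inj.
    by rewrite catp_l.
  split=> [h|[i [j [<- h]]]].
    exists k, 0; rewrite addn0; split=> //; apply: dq_mono h => x Px; split=> //.
    have [u _] := om_nonempty S; exists (fun=> u); by rewrite cat0.
  have [x [-> _]] := dq_ne h; rewrite addn0.
  by apply: dq_mono h => y [_ [z]]; rewrite cat0.
case: N e P dP => [|N] e P dP; first by lia.
have e' : N = m + n by lia.
have catS x y t : (fun i => catp x (extp y t) (cast_ord e i)) =
    extp (fun i => catp x y (cast_ord e' i)) t :> ('I_N.+1 -> M).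
  apply/funext => i; rewrite /extp; case: (unliftP ord_max i) => [j|] ->; last first.
    have -> : cast_ord e ord_max = rshift m ord_max by apply: val_inj; rewrite /= e'.
    by rewrite catp_r unlift_none.
  have vj : val (lift ord_max j) = j by rewrite /= /bump leqNgt ltn_ord.
  case: (splitP (cast_ord e' j)) => [a /= ja|b /= jb].
    have -> : cast_ord e (lift ord_max j) = lshift n.+1 a by apply: val_inj; apply: etrans vj ja.
    have -> : cast_ord e' j = lshift n a by exact: val_inj.
    by rewrite !catp_l.
  have -> : cast_ord e (lift ord_max j) = rshift m (lift ord_max b).
    by apply: val_inj; apply: etrans vj _; rewrite /= /bump leqNgt ltn_ord.
  have -> : cast_ord e' j = rshift m b by exact: val_inj.
  by rewrite !catp_r liftK.
split.
  move=> /dqS[s [b [es h]]].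
  have [|i [a [ea h']]] := (IH _ e' _ (fun z => dline b (fun t => P (extp z t))) _).1 h.
    by apply: dqf_def; dfn.
  exists i, (a + b); split; first by lia.
  apply: dq_mono h' => x h'; apply/dqS; exists a, b; split=> //.
  by apply: dq_mono h' => y; apply: line_mono => t; rewrite catS.
move=> [i [s [es h]]].
pose Q a b x := dq a (fun y => dline b (fun t => P (fun i => catp x (extp y t) (cast_ord e i)))).
have dQ a b : @dset _ _ S (power_isort m) (Q a b).
  apply: (dqf_def (dpow n) a (Y := power_isort m)
    (R := fun x y => dline b (fun t => P (fun i => catp x (extp y t) (cast_ord e i))))).
  apply: (dqf_def dline b (Y := prod_isort (power_isort m) (power_isort n))
    (R := fun p t => P (fun i => catp p.1 (extp p.2 t) (cast_ord e i)))).
  by apply: (dset_comp dP); apply: dmap_cat; dfn.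
have {}h : dpow m i (fun x => exists a b, a + b = s /\ Q a b x).
  by apply: dq_mono h => x /dqS.
have [a [b [ab {}h]]] := (dqf_sum (dpow m) i s dQ).1 h.
apply/dqS; exists (i + a), b; split; first by lia.
have dP' : @dset _ _ S (power_isort N) (fun z => dline b (fun t => P (extp z t))).
  by apply: dqf_def; dfn.
apply/(IH _ e' _ _ dP'); exists i, a; split=> //.
apply: dq_mono h => x; apply: dq_mono => y.
by apply: line_mono => t; rewrite catS.
Qed.
End DimensionQuantifiers.

(** * Dimension in interpretable sorts *)

Section SortDimension.
Context {d : Order.disp_t} {M : orderType d} {S : ominimal_structure M}.
Implicit Types X Y Z : isort S.

(* All fibres of the quotient map have dimension [e], so that dimensions of   *)
(* sets in the sort are dimensions of preimages shifted by [e].               *)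
Definition unif X e := (exists v, idom X v) /\ forall v, idom X v -> forall k,
  dq k (fun w => idom X w /\ iprj w = iprj v :> X) <-> k <= e.
Definition uniform X := exists e, unif X e.
Definition fdim X : nat := xget 0 [set e | unif X e].
Definition dge X k (P : X -> Prop) := dq (k + fdim X) (fun v => idom X v /\ P (iprj v)).

Lemma unif_fdim X : uniform X -> unif X (fdim X).
Proof. by move=> [e ue]; apply: (xgetPex 0 (P := [set e | unif X e])); exists e. Qed.

Lemma unif_eq X e : unif X e -> fdim X = e.
Proof.
move=> ue; have [[v dv] uf] := unif_fdim (ex_intro _ e ue); case: ue => _ ue.
apply/eqP; rewrite eqn_leq; apply/andP; split; first exact/(ue v dv)/(uf v dv).
exact/(uf v dv)/(ue v dv).
Qed.

Lemma dq_bound n k (P : ('I_n -> M) -> Prop) : dq k P -> k <= n.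
Proof.
elim: n k P => [|n IH] k P /=; first by case=> ->.
by case=> [/IH /leqW//|[k' -> /IH]].
Qed.

Lemma dq_leq n j k (P : ('I_n -> M) -> Prop) : j <= k -> dq k P -> dq j P.
Proof. exact: (dqf_leq (D := dpow (S := S) n)). Qed.

Lemma dge_mono X k (P Q : X -> Prop) : (forall x, P x -> Q x) -> dge k P -> dge k Q.
Proof. by move=> PQ; apply: dq_mono => v [dv /PQ]. Qed.

Lemma dge_bound X k (P : X -> Prop) : dge k P -> k + fdim X <= iar X.
Proof. exact: dq_bound. Qed.

Lemma dge_leq X j k (P : X -> Prop) : j <= k -> dge k P -> dge j P.
Proof. by move=> jk; apply: dq_leq; rewrite leq_add2r. Qed.

Lemma dge_ne X k (P : X -> Prop) : dge k P -> exists x, P x.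
Proof. by move=> /(dq_ne (S := S))[v [_ Pv]]; exists (iprj v). Qed.

Lemma dset_power X (P : X -> Prop) : dset P ->
  @dset _ _ S (power_isort (iar X)) (fun v => idom X v /\ P (iprj v)).
Proof. by apply: eq_defs => v; split=> // -[]. Qed.

Lemma dge_or X k (P Q : X -> Prop) : dset P -> dset Q ->
  dge k (fun x => P x \/ Q x) -> dge k P \/ dge k Q.
Proof.
move=> /dset_power dP /dset_power dQ h; have := @dqf_or _ _ _ _ (dpow (S := S) (iar X)) (k + fdim X) _ _ dP dQ; apply.
by apply: dq_mono h => v [? []]; [left|right].
Qed.

Lemma dset_dge X Y k (R : Y -> X -> Prop) :
  @dset _ _ S (prod_isort Y X) (fun p => R p.1 p.2) -> dset (fun y => dge k (R y)).
Proof.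
move=> dR; pose R' (y : Y) v := idom X v /\ R y (iprj v).
have := dqf_def (dpow (S := S) (iar X)) (k + fdim X) (R := R') _; apply.
by apply: eq_defs dR => z /=; split=> [[[? ?] ?]|[[? _] [? ?]]].
Qed.

Lemma dge_fibre X (P : X -> Prop) x : uniform X -> P x -> dge 0 P.
Proof.
move=> /unif_fdim[_ uX] Px; have [v dv vx] := iprj_surj x.
by apply: dq_mono ((uX v dv (fdim X)).2 (leqnn _)) => w [dw ->]; rewrite vx.
Qed.

Lemma dge_sub1 X k (P : X -> Prop) : uniform X -> (forall x y, P x -> P y -> x = y) ->
  dge k P -> k = 0.
Proof.
move=> /unif_fdim[_ uX] P1 dP; have [x Px] := dge_ne dP; have [v dv vx] := iprj_surj x.
suff : k + fdim X <= fdim X by lia.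
by apply/(uX v dv); apply: dq_mono dP => w [dw Pw]; split=> //; apply: P1; rewrite ?vx.
Qed.

Lemma dq_sub1 n k (P : ('I_n -> M) -> Prop) : (forall v w, P v -> P w -> v = w) ->
  dq k P -> k = 0.
Proof.
elim: n k P => [|n IH] k P P1 /=; first by case.
have inj y y' t t' : P (extp y t) -> P (extp y' t') -> y = y' /\ t = t'.
  move=> Py Py'; have e := P1 _ _ Py Py'; split.
    by apply/funext => i; have := congr1 (@^~ (lift ord_max i)) e; rewrite /extp !liftK.
  by have := congr1 (@^~ ord_max) e; rewrite /extp !unlift_none.
case=> [/IH|[k' _ /(dq_ne (S := S))[y [a [b [ab h]]]]]].
  by apply=> y y' [t Py] [t' Py']; have [] := inj _ _ _ _ Py Py'.
have [x [ax xb]] := om_dense S ab; have [x' [xx' x'b]] := om_dense S xb.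
have [_ e] := inj _ _ _ _ (h x ax xb) (h x' (lt_trans ax xx') x'b).
by move: xx'; rewrite e ltxx.
Qed.

Lemma inj_unif X : (exists v, idom X v) ->
  (forall v w, idom X v -> idom X w -> iprj v = iprj w :> X -> v = w) -> unif X 0.
Proof.
move=> neX inj; split=> // v dv k; split=> [h|].
  by rewrite (dq_sub1 _ h) // => w w' [dw e] [dw' e']; apply: inj; rewrite ?e.
by rewrite leqn0 => /eqP ->; apply: (dqf_0 (dpow (S := S) _)) (v) _.
Qed.

Lemma unif_line : unif (line_isort (S := S)) 0.
Proof.
apply: inj_unif; first by have [u _] := om_nonempty S; exists (fun=> u).
by move=> v w _ _ e; apply/funext => i; rewrite !ord1.
Qed.

Lemma unif_power n : unif (power_isort (S := S) n) 0.
Proof. by apply: inj_unif => //; have [u _] := om_nonempty S; exists (fun=> u). Qed.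

Lemma dge_power n k (P : power_isort (S := S) n -> Prop) : dge k P <-> dq k P.
Proof.
rewrite /dge (unif_eq (unif_power n)) addn0.
by split; apply: dq_mono => v //= [].
Qed.

Lemma dge_line k (P : line_isort (S := S) -> Prop) : dge k P <-> dline (S := S) k P.
Proof.
rewrite /dge (unif_eq unif_line) addn0 /=.
have e0 y t : extp y t (ord0 : 'I_1) = t :> M.
  by rewrite /extp (_ : ord0 = ord_max) ?unlift_none //; exact: val_inj.
split=> [[[-> [y [t [_ Pt]]]]|[k' -> [-> [y h]]]]|].
- by exists (extp y t ord0).
- by split=> //; apply: fat_mono h => t [_]; rewrite e0.
have [u _] := om_nonempty S.
case: k => [[x Px]|k [-> h]].
  by left; split=> //; exists (fun=> u), x; split=> //=; rewrite e0.
right; exists 0 => //; split=> //; exists (fun=> u).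
by apply: fat_mono h => t Pt; split=> //=; rewrite e0.
Qed.

Section Product.
Variables (X Y : isort S) (uX : uniform X) (uY : uniform Y).

Definition lift2 (R : X -> Y -> Prop) (v : 'I_(iar X) -> M) (w : 'I_(iar Y) -> M) :=
  (idom X v /\ idom Y w) /\ R (iprj v) (iprj w).

(** Representatives add [fdim X] and [fdim Y]. Backwards, a splitting that gives one factor less
    than its fibre dimension has to be rebalanced, since the fibres always supply that much. *)
Lemma tens_lift k (R : X -> Y -> Prop) :
  tens (dge (X := X)) (dge (X := Y)) k R <->
  tens (dpow (S := S) _) (dpow (S := S) _) (k + fdim X + fdim Y) (lift2 R).
Proof.
have [_ fX] := unif_fdim uX; have [_ fY] := unif_fdim uY; split.
  move=> [i [j [<- h]]]; exists (i + fdim X), (j + fdim Y); split; first by lia.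
  apply: dq_mono h => v [dv]; apply: dq_mono => w [dw Rvw] //.
move=> [i [j [e h]]]; have [lej|ltj] := leqP (fdim Y) j; last first.
  exists k, 0; rewrite addn0; split=> //; apply: dq_leq (_ : k + fdim X <= i) _; first by lia.
  apply: dq_mono h => v /(dq_ne (S := S))[w [[dv dw] Rvw]]; split=> //.
  by apply: dq_mono ((fY w dw (fdim Y)).2 _) => // w' [dw' ->].
have [lei|lti] := leqP (fdim X) i; last first.
  have [v h'] := dq_ne (S := S) h; have [w [[dv dw] Rvw]] := dq_ne (S := S) h'.
  exists 0, k; split=> //; apply: dq_mono ((fX v dv (fdim X)).2 _) => // v' [dv' ->].
  split=> //; apply: dq_leq (_ : k + fdim Y <= j) _; first by lia.
  by apply: dq_mono h' => w' [[_ dw'] R']; split.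
exists (i - fdim X), (j - fdim Y); split; first by lia.
rewrite /dge !subnK //; apply: dq_mono h => v h; have [w [[dv _] _]] := dq_ne (S := S) h.
by split=> //; apply: dq_mono h => w' [[_ dw'] R']; split.
Qed.

Lemma dset_lift (R : X -> Y -> Prop) : @dset _ _ S (prod_isort X Y) (fun p => R p.1 p.2) ->
  @dset _ _ S (prod_isort (power_isort (iar X)) (power_isort (iar Y))) (fun p => lift2 R p.1 p.2).
Proof. by apply: eq_defs => z; split=> // -[]. Qed.

Let dq_prod k (R : X -> Y -> Prop) : @dset _ _ S (prod_isort X Y) (fun p => R p.1 p.2) ->
  dq k (fun v => idom (prod_isort X Y) v /\ (fun p => R p.1 p.2) (iprj v : prod_isort X Y)) <->
  tens (dpow (S := S) _) (dpow (S := S) _) k (lift2 R).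
Proof.
move=> /dset_power dR; apply: iff_trans (dq_cat (erefl (iar X + iar Y)) k dR) _.
have cE v w : (fun i => catp v w (cast_ord (erefl (iar X + iar Y)) i)) = catp v w :> (_ -> M).
  by apply/funext => i; rewrite cast_ord_id.
split=> -[i [j [e h]]]; exists i, j; split=> //; apply: dq_mono h => v; apply: dq_mono => w;
  by rewrite cE /= catpl catpr.
Qed.

Lemma unif_prod : unif (prod_isort X Y) (fdim X + fdim Y).
Proof.
have [[v0 dv0] fX] := unif_fdim uX; have [[w0 dw0] fY] := unif_fdim uY; split.
  by exists (catp v0 w0); rewrite /= catpl catpr.
move=> v [dv dw] k.
have dR : @dset _ _ S (prod_isort X Y) (fun p => p = (iprj v : X * Y)) by dfn.
have := dq_prod k (R := fun x y => (x, y) = (iprj v : X * Y)) _.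
have -> : (fun p : X * Y => (p.1, p.2) = (iprj v : X * Y)) = (fun p => p = (iprj v : X * Y)).
  by apply/funext => -[].
move=> /(_ dR) h; apply: iff_trans h _; rewrite /lift2 /=; split.
  move=> [i [j [<- h]]]; apply: leq_add.
    apply/(fX _ dv); apply: dq_mono h => v' /(dq_ne (S := S))[w' [[dv' dw'] [-> _]]] //.
  have [v' h'] := dq_ne (S := S) h; apply/(fY _ dw); apply: dq_mono h' => w' [[dv' dw'] [_ ->]] //.
move=> lek; exists (minn k (fdim X)), (k - minn k (fdim X)); split; first by lia.
apply: dq_mono ((fX _ dv _).2 _); last by rewrite geq_minr.
move=> v' [dv' ->]; apply: dq_mono ((fY _ dw _).2 _); last by lia.
by move=> w' [dw' ->].
Qed.

Lemma uniform_prod : uniform (prod_isort X Y).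
Proof. by exists (fdim X + fdim Y); apply: unif_prod. Qed.

Lemma dge_prod k (R : X -> Y -> Prop) : @dset _ _ S (prod_isort X Y) (fun p => R p.1 p.2) ->
  @dge (prod_isort X Y) k (fun p => R p.1 p.2) <-> tens (dge (X := X)) (dge (X := Y)) k R.
Proof.
move=> dR; rewrite /dge (unif_eq unif_prod); apply: iff_trans (dq_prod _ dR) _.
by rewrite addnA; apply: iff_sym; apply: tens_lift.
Qed.
End Product.

Lemma dge_swap X Y k (R : X -> Y -> Prop) : uniform X -> uniform Y ->
  @dset _ _ S (prod_isort X Y) (fun p => R p.1 p.2) ->
  tens (dge (X := X)) (dge (X := Y)) k R -> tens (dge (X := Y)) (dge (X := X)) k (fun y x => R x y).
Proof.
move=> uX uY dR /(tens_lift uX uY) h; apply/(tens_lift uY uX).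
have := (swaps_pow _ (dset_lift dR)).1 h; rewrite addnAC.
by apply: tens_mono => w v [[? ?] ?].
Qed.

Section Relations.
Variables (X Y : isort S) (uX : uniform X) (uY : uniform Y) (R : X -> Y -> Prop).
Hypothesis dR : @dset _ _ S (prod_isort X Y) (fun p => R p.1 p.2).
Hypothesis funR : forall x y y', R x y -> R x y' -> y = y'.

(** Additivity for the fibres of a function: after exchanging the factors, the new fibres have at
    most one point and contribute dimension 0. *)
Lemma dge_fibres i j : dge j (fun y => dge i (fun x => R x y)) ->
  dge (i + j) (fun x => exists y, R x y).
Proof.
move=> h; have [||a [b [e h']]] := @dge_swap Y X (i + j) (fun y x => R x y) uY uX.
- by apply: (dset_comp (f := fun p : prod_isort Y X => (p.2, p.1)) dR); dfn.
- by exists j, i; rewrite addnC.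
have [x /(dge_sub1 uY)b0] := dge_ne h'; rewrite -e b0 ?addn0; last by move=> y y'; apply: funR.
by apply: dge_mono h' => x' /dge_ne.
Qed.

Lemma dge_fibres_inv k : dge k (fun x => exists y, R x y) ->
  exists i j, i + j = k /\ dge j (fun y => dge i (fun x => R x y)).
Proof.
move=> h; have [|j [i [e h']]] := @dge_swap X Y k R uX uY dR.
  exists k, 0; rewrite addn0; split=> //; apply: dge_mono h => x [y]; exact: dge_fibre.
by exists i, j; rewrite addnC.
Qed.

Lemma dge_image k : dge k (fun y => exists x, R x y) -> dge k (fun x => exists y, R x y).
Proof.
move=> h; rewrite -(add0n k); apply: dge_fibres.
by apply: dge_mono h => y [x]; exact: dge_fibre.
Qed.

End Relations.
End SortDimension.

(** * Boxes and frontiers *)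

Ltac dext ::= match goal with
 | |- @dset _ _ _ ?X (fun x => fat (@?R x)) => refine (dset_fat (X := X) (R := R) _)
 | |- @dset _ _ _ ?X (fun x => @dge _ _ _ _ ?k (@?R x)) => refine (dset_dge (Y := X) (R := R) k _)
 end.

Section Boxes.
Context {d : Order.disp_t} {M : orderType d} {S : ominimal_structure M}.
Local Notation L := (line_isort (S := S)).
Local Notation "x < y" := (Order.lt x y).
Local Notation "x <= y" := (Order.le x y).
Implicit Types X Y Z : isort S.

Definition box n (a b v : 'I_n -> M) := forall i, a i < v i /\ v i < b i.

Lemma dset_box X n (f g h : X -> ('I_n -> M)) :
  @dmap _ _ S X (power_isort n) f -> @dmap _ _ S X (power_isort n) g ->
  @dmap _ _ S X (power_isort n) h -> dset (fun x => box (f x) (g x) (h x)).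
Proof. by move=> df dg dh; apply: dset_forall_fin => i; dfn. Qed.

Lemma extp_eta n (v : 'I_n.+1 -> M) : extp (fun i => v (lift ord_max i)) (v ord_max) = v.
Proof. by apply/funext => i; rewrite /extp; case: unliftP => [j|] ->. Qed.

Lemma extp_lift n (v : 'I_n -> M) t i : extp v t (lift ord_max i) = v i.
Proof. by rewrite /extp liftK. Qed.

Lemma extp_max n (v : 'I_n -> M) t : extp v t ord_max = t.
Proof. by rewrite /extp unlift_none. Qed.

Lemma box_extp n (a b v : 'I_n -> M) s t x :
  box (extp a s) (extp b t) (extp v x) <-> box a b v /\ s < x /\ x < t.
Proof.
split=> [h|[h sxt] i]; last first.
  by case: (unliftP ord_max i) => [j|] ->; rewrite ?extp_lift ?extp_max //; apply: h.
by split=> [i|]; [have := h (lift ord_max i); rewrite !extp_lift|have := h ord_max; rewrite !extp_max].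
Qed.

Lemma box_ne n (a b : 'I_n -> M) : (forall i, a i < b i) -> exists v, box a b v.
Proof.
move=> ab; have /choice[v vP] : forall i, exists x, a i < x /\ x < b i.
  by move=> i; apply: (om_dense S (ab i)).
by exists v.
Qed.

Lemma dq_box n (a b : 'I_n -> M) : (forall i, a i < b i) -> dq n (box a b).
Proof.
elim: n a b => [|n IH] a b ab.
  by split=> //; exists a => -[].
right; exists n => //; apply: dq_mono (IH (fun i => a (lift ord_max i)) (fun i => b (lift ord_max i)) _) => // v bv.
exists (a ord_max), (b ord_max); split=> // t at' tb.
by rewrite -(extp_eta a) -(extp_eta b); apply/box_extp.
Qed.

(** Exchanging the quantifiers keeps the total [k + m], and the parameter sort supplies at most [m]
    of it, so some parameter leaves at least [k]. *)
Lemma generic_parameter X Y k m (R : X -> Y -> Prop) : uniform X -> uniform Y ->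
  iar Y <= m + fdim Y -> @dset _ _ S (prod_isort X Y) (fun p => R p.1 p.2) ->
  dge k (fun x => dge m (R x)) -> exists y, dge k (fun x => R x y).
Proof.
move=> uX uY mY dR h; have [|j [i [e h']]] := @dge_swap _ _ _ X Y (k + m) R uX uY dR.
  by exists k, m.
have [y hy] := dge_ne h'; exists y; apply: dge_leq hy.
by have := dge_bound h'; lia.
Qed.

Lemma uniform_line : uniform L. Proof. by exists 0; apply: unif_line. Qed.
Lemma uniform_power n : uniform (power_isort (S := S) n).
Proof. by exists 0; apply: unif_power. Qed.

Lemma dge_lineE (P : L -> Prop) : fat P -> dge 1 P.
Proof. by move=> fP; apply/dge_line. Qed.

Definition LL := prod_isort L L.
Lemma uniform_LL : uniform LL. Proof. exact: uniform_prod uniform_line uniform_line. Qed.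

Lemma dge_LL (R : M -> M -> Prop) : @dset _ _ S LL (fun p => R p.1 p.2) ->
  fat (fun x => fat (R x)) -> @dge _ _ S LL 2 (fun p => R p.1 p.2).
Proof.
move=> dR h; apply/(dge_prod uniform_line uniform_line) => //; exists 1, 1; split=> //.
by apply: dge_lineE; apply: fat_mono h => x; apply: dge_lineE.
Qed.

Lemma dge_nested (P : M -> M -> Prop) a b : @dset _ _ S LL (fun p => P p.1 p.2) -> a < b ->
  (forall c c', a < c -> c < c' -> c' < b -> P c c') -> @dge _ _ S LL 2 (fun p => P p.1 p.2).
Proof.
move=> dP ab h; apply: dge_LL => //; exists a, b; split=> // c ac cb.
by exists c, b; split=> // c' cc' c'b; apply: h.
Qed.

Lemma dge_around (P : M -> M -> Prop) a t b : @dset _ _ S LL (fun p => P p.1 p.2) ->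
  a < t -> t < b ->
  (forall c c', a < c -> c < t -> t < c' -> c' < b -> P c c') -> @dge _ _ S LL 2 (fun p => P p.1 p.2).
Proof.
move=> dP at' tb h; apply: dge_LL => //; exists a, t; split=> // c ac ct.
by exists t, b; split=> // c' tc' c'b; apply: h.
Qed.

(** The typical use of [generic_parameter]: the two ends of an interval, chosen from a
    two-dimensional set depending on [x], can be fixed without losing dimension in [x]. *)
Lemma generic_interval X k (R : X -> M -> M -> Prop) : uniform X ->
  @dset _ _ S (prod_isort (prod_isort X L) L) (fun p => R p.1.1 p.1.2 p.2) ->
  dge k (fun x => @dge _ _ S LL 2 (fun p => R x p.1 p.2)) ->
  exists c c', dge k (fun x => R x c c').
Proof.
move=> uX dR h.
have [//||//|[c c'] hc] := @generic_parameter X LL k 2 (fun x p => R x p.1 p.2) uX uniform_LL.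
- by dfn.
- by exists c, c'.
Qed.

(** The intervals in the last coordinate vary with the base point; [generic_interval] fixes one that
    serves an [n]-dimensional set of base points, and the induction applies to that set. *)
Lemma dq_has_box n (P : ('I_n -> M) -> Prop) : @dset _ _ S (power_isort n) P -> dq n P ->
  exists a b, (forall i, a i < b i) /\ forall v, box a b v -> P v.
Proof.
elim: n P => [|n IH] P dP /=.
  move=> [_ [v Pv]]; exists v, v; split=> [[]//|w _].
  by have -> : w = v by apply/funext => -[].
case=> [/dq_bound|[_ [<-] h]]; first by rewrite ltnn.
pose R (y : power_isort (S := S) n) c c' := c < c' /\ forall t, c < t -> t < c' -> P (extp y t).
have [||c [c' hc]] := @generic_interval (power_isort n) n R (uniform_power n).
- by rewrite /R; dfn.
- apply/dge_power; apply: dq_mono h => y [a [b [ab hab]]].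
  apply: (dge_nested (a := a) (b := b)) => //; first by rewrite /R; dfn.
  move=> c c' ac cc' c'b; split=> // t ct tc'.
  by apply: hab; [apply: lt_trans ct|apply: lt_trans c'b].
have cc' : c < c' by have [y []] := dge_ne hc.
have [|a [b [ab hab]]] := IH (fun y => R y c c') _ ((dge_power _ _).1 hc).
  by rewrite /R; dfn.
exists (extp a c), (extp b c'); split.
  by move=> i; case: (unliftP ord_max i) => [j|] ->; rewrite ?extp_lift ?extp_max.
move=> v; rewrite -(extp_eta v) => /box_extp[/hab[_ h'] [cv vc]]; exact: h'.
Qed.

(** [f] lists the coordinates at which the recursion of [dq] demanded an interval. *)
Lemma dq_projection n k (P : ('I_n -> M) -> Prop) : dq k P -> exists2 f : 'I_k -> 'I_n,
  injective f & dq k (fun y => exists v, P v /\ forall i, v (f i) = y i).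
Proof.
elim: n k P => [|n IH] k P /=.
  move=> [-> [v Pv]]; exists (fun i => i) => //; split=> //; exists v, v; by split.
case=> [/IH[f injf h]|[k' -> /IH[f injf h]]].
  exists (fun i => lift ord_max (f i)); first by move=> i j /lift_inj /injf.
  apply: dq_mono h => y [v [[t Pvt] vy]]; exists (extp v t); split=> // i.
  by rewrite extp_lift.
exists (fun i => if unlift ord_max i is Some j then lift ord_max (f j) else ord_max).
  move=> i j; case: (unliftP ord_max i) => [i'|] ->; case: (unliftP ord_max j) => [j'|] -> //.
  - by move=> /lift_inj /injf ->.
  - by move=> e; have := neq_lift ord_max (f i'); rewrite e eqxx.
  - by move=> e; have := neq_lift ord_max (f j'); rewrite -e eqxx.
right; exists k' => //; apply: dq_mono h => y [v [fv vy]].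
apply: fat_mono fv => t Pvt; exists (extp v t); split=> // i.
by case: (unliftP ord_max i) => [j|] ->; rewrite ?extp_lift ?extp_max.
Qed.

(** Connects [dq] with dimension as it occurs in the theorem: a box in a coordinate projection pulls
    back by [dge_image]; conversely [dq_projection] gives the projection and [dq_has_box] the
    box. *)
Lemma dim_geE n k (P : set ('I_n -> M)) : defs S n P -> dim_ge P k <-> dq k P.
Proof.
move=> dP; have {}dP : @dset _ _ S (power_isort n) P by apply: eq_defs dP => v; split=> // -[].
pose R f (v : power_isort (S := S) n) (y : power_isort (S := S) k) := P v /\ forall i, v (f i) = y i.
have dR f : @dset _ _ S (prod_isort (power_isort n) (power_isort k)) (fun p => R f p.1 p.2).
  by rewrite /R; dfn.
split=> [[f [injf [a [b [ab h]]]]]|/dq_projection[f injf h]].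
  have : dge k (fun y => exists v, R f v y).
    apply/dge_power; apply: dq_mono (dq_box ab) => y /h[x [Px xy]]; by exists x.
  move=> /(dge_image (uniform_power n) (uniform_power k) (dR f) _) h'.
  apply/(dge_power (S := S)); apply: dge_mono (h' _); first by move=> v [y []].
  by move=> v y y' [_ e] [_ e']; apply/funext => i; rewrite -e -e'.
exists f; split=> //; have [|a [b [ab hab]]] := dq_has_box _ h; first by dfn.
by exists a, b; split=> // y /hab[v [Pv vy]]; exists v.
Qed.
End Boxes.

Ltac dext ::= match goal with
 | |- @dset _ _ _ ?X (fun x => fat (@?R x)) => refine (dset_fat (X := X) (R := R) _)
 | |- @dset _ _ _ ?X (fun x => @dge _ _ _ _ ?k (@?R x)) => refine (dset_dge (Y := X) (R := R) k _)
 | |- @dset _ _ _ ?X (fun x => @box _ _ _ (@?f x) (@?g x) (@?h x)) => refine (dset_box (X := X) (f := f) (g := g) (h := h) _ _ _)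
 end.

Section Frontier.
Context {d : Order.disp_t} {M : orderType d} {S : ominimal_structure M}.
Local Notation L := (line_isort (S := S)).
Local Notation "x < y" := (Order.lt x y).
Local Notation "x <= y" := (Order.le x y).
Local Notation pw := (power_isort (S := S)).

Definition clo n (B : ('I_n -> M) -> Prop) v := forall a b, box a b v -> exists w, B w /\ box a b w.

Lemma dset_clo (X : isort S) n (R : X -> ('I_n -> M) -> Prop) (f : X -> ('I_n -> M)) :
  @dset _ _ S (prod_isort X (pw n)) (fun p => R p.1 p.2) -> @dmap _ _ S X (pw n) f ->
  dset (fun x => clo (R x) (f x)).
Proof.
by move=> dR df; rewrite /clo; dfn.
Qed.

(** The coordinate projections of a set of dimension less than 1 are finite, so in each coordinate
    there is a gap around that of [z]. *)
Lemma finite_isolated n (P : ('I_n -> M) -> Prop) z : @dset _ _ S (pw n) P ->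
  ~ dq 1 P -> ~ P z -> exists w w', box w w' z /\ forall v, box w w' v -> ~ P v.
Proof.
move=> dP nP nPz.
have /choice[g gP] : forall i, exists p, p.1 < z i /\ z i < p.2 /\
    forall v, P v -> p.1 < v i -> v i < p.2 -> v i = z i.
  move=> i; have nf : ~ fat (fun t => exists v, P v /\ v i = t).
    move=> ft; apply: nP; pose R (v : pw n) (t : L) := P v /\ v i = t.
    have dR : @dset _ _ S (prod_isort (pw n) L) (fun p => R p.1 p.2) by rewrite /R; dfn.
    have := dge_image (uniform_power n) uniform_line dR _ (dge_lineE ft).
    move=> h; apply/(dge_power (S := S)); apply: dge_mono (h _); first by move=> v [t []].
    by move=> v t t' [_ <-] [_ <-].
  have [|s sP] := not_fat_list (S := S) _ nf; first by apply: (dset_ex (Y := pw n)); dfn.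
  have [a az la] := left_gap (S := S) s (z i); have [b zb rb] := right_gap (S := S) s (z i).
  exists (a, b); split=> //; split=> //= v Pv av vb.
  have vs : v i \in s by apply: sP; exists v.
  have [vz|zv|//] := ltgtP (v i) (z i).
    by have := lt_trans av (la _ vs vz); rewrite ltxx.
  by have := lt_trans vb (rb _ vs zv); rewrite ltxx.
exists (fun i => (g i).1), (fun i => (g i).2); split=> [i|v bv Pv].
  by have [? []] := gP i.
apply: nPz; suff -> : z = v by [].
by apply/funext => i; have [_ [_ h]] := gP i; have [? ?] := bv i; rewrite h.
Qed.

Lemma dge_boxes n (z w w' : 'I_n -> M) : box w w' z ->
  @dge _ _ S (prod_isort (pw n) (pw n)) (n + n) (fun p => box w z p.1 /\ box z w' p.2).
Proof.
move=> bz; have dR : @dset _ _ S (prod_isort (pw n) (pw n))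
  (fun p => box w z p.1 /\ box z w' p.2) by dfn.
refine ((dge_prod (uniform_power n) (uniform_power n) (n + n)
  (R := fun a b => box w z a /\ box z w' b) dR).2 _).
exists n, n; split=> //; apply/dge_power; have wz : forall i, w i < z i by move=> i; case: (bz i).
apply: dq_mono (dq_box wz) => a wa; apply/dge_power.
have zw' : forall i, z i < w' i by move=> i; case: (bz i).
by apply: dq_mono (dq_box zw') => b.
Qed.

(* If the frontier had dimension dim B, generically over a coordinate         *)
(* projection a fixed box would meet the frontier but miss [B].               *)
Lemma frontier_dim n k (B : ('I_n -> M) -> Prop) : @dset _ _ S (pw n) B ->
  dq k (fun v => clo B v /\ ~ B v) -> dq k.+1 B.
Proof.
move=> dB hB; apply: contrapT => nB; have [f injf hf] := dq_projection hB.
pose pr (v : pw n) (y : pw k) := forall i, v (f i) = y i.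
have dpr : @dset _ _ S (prod_isort (pw n) (pw k)) (fun p => pr p.1 p.2).
  by rewrite /pr; apply: dset_forall_ord => i; dfn.
have prP v y y' : pr v y -> pr v y' -> y = y' by move=> e e'; apply/funext => i; rewrite -e -e'.
pose Fr v := clo B v /\ ~ B v.
have dFr : @dset _ _ S (pw n) Fr by apply: dset_and; [apply: dset_clo; dfn|dfn].
pose Y1 y := @dge _ _ S (pw n) 1 (fun v => B v /\ pr v y).
have dY1 : @dset _ _ S (pw k) Y1 by rewrite /Y1; dfn.
have hY : @dge _ _ S (pw k) k (fun y => Y1 y \/ ~ Y1 y /\ exists v, Fr v /\ pr v y).
  apply/dge_power; apply: dq_mono hf => y hy.
  by have [|] := pselect (Y1 y); [left|right].
have dY2 : @dset _ _ S (pw k) (fun y => ~ Y1 y /\ exists v, Fr v /\ pr v y).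
  by apply: dset_and; [dfn|apply: (dset_ex (Y := pw n)); dfn].
have {hY} [hY|hY] := dge_or dY1 dY2 hY.
  apply: nB; apply/(dge_power (S := S)).
  have dR : @dset _ _ S (prod_isort (pw n) (pw k)) (fun p => B p.1 /\ pr p.1 p.2) by dfn.
  apply: dge_mono (dge_fibres (uniform_power n) (uniform_power k) dR _ hY).
    by move=> v [y []].
  by move=> v y y' [_ vy] [_ vy']; apply: prP vy vy'.
pose R y (p : prod_isort (pw n) (pw n)) := (forall v, box p.1 p.2 v -> ~ (B v /\ pr v y)) /\
  exists z, (Fr z /\ pr z y) /\ box p.1 p.2 z.
have dR : @dset _ _ S (prod_isort (pw k) (prod_isort (pw n) (pw n))) (fun p => R p.1 p.2).
  by rewrite /R; dfn.
have [|//|[a b] /dge_power hab] := generic_parameter (m := n + n) (uniform_power k)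
    (uniform_prod (uniform_power n) (uniform_power n)) _ dR (k := k) _.
- exact: leq_addr.
- apply: dge_mono hY => y [nY1 [z [Frz zy]]].
  have [|||w [w' [bz hw]]] := @finite_isolated n (fun v => B v /\ pr v y) z.
  + by dfn.
  + by move=> h; apply: nY1; apply/dge_power.
  + by move=> [Bz _]; case: Frz.
  apply: dge_mono (dge_boxes bz) => -[a b] /= [wa zb]; split=> [v bv|].
    apply: hw => i; have [av vb] := bv i; have [wai _] := wa i; have [_ bw] := zb i.
    by split; [apply: lt_trans wai av|apply: lt_trans vb bw].
  exists z; split=> // i; have [_ ?] := wa i; have [? _] := zb i; by split.
have [|c [e [ce hce]]] := dq_has_box _ hab; first by rewrite /R; dfn.
have [y0 by0] := box_ne (S := S) ce; have [_ [z [[[cz _] zy0] bz]]] := hce y0 by0.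
(* The box [a], [b], cut down in the coordinates selected by [f] to the box [c], [e] over which
   [hce] holds. It still contains [z], so it meets [B], which [hce] forbids. *)
pose a' i := if [pick j | f j == i] is Some j then Order.max (a i) (c j) else a i.
pose b' i := if [pick j | f j == i] is Some j then Order.min (b i) (e j) else b i.
have bz' : box a' b' z.
  move=> i; have [az zb] := bz i; rewrite /a' /b'; case: pickP => [j /eqP ji|_] //.
  by have [? ?] := by0 j; rewrite gt_max lt_min az zb -ji zy0.
have [v [Bv bv]] := cz a' b' bz'.
have bva : box a b v.
  move=> i; have := bv i; rewrite /a' /b'; case: pickP => [j _|_] //.
  by rewrite gt_max lt_min => -[/andP[-> _] /andP[-> _]].
have bvc : box c e (fun j => v (f j)).
  move=> j; have := bv (f j); rewrite /a' /b'; case: pickP => [j' /eqP /injf ->|/(_ j)]; last by rewrite eqxx.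
  by rewrite gt_max lt_min => -[/andP[_ ->] /andP[_ ->]].
by have [/(_ v bva) nBv _] := hce _ bvc; apply: nBv.
Qed.
End Frontier.

(** * Definably connected components *)

Ltac dext ::= match goal with
 | |- @dset _ _ _ ?X (fun x => fat (@?R x)) => refine (dset_fat (X := X) (R := R) _)
 | |- @dset _ _ _ ?X (fun x => @dge _ _ _ _ ?k (@?R x)) => refine (dset_dge (Y := X) (R := R) k _)
 | |- @dset _ _ _ ?X (fun x => @box _ _ _ (@?f x) (@?g x) (@?h x)) => refine (dset_box (X := X) (f := f) (g := g) (h := h) _ _ _)
 | |- @dset _ _ _ ?X (fun x => @clo _ _ _ (@?R x) (@?f x)) => refine (dset_clo (X := X) (R := R) (f := f) _ _)
 end.

Section Connectedness.
Context {d : Order.disp_t} {M : orderType d} {S : ominimal_structure M}.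
Local Notation L := (line_isort (S := S)).
Local Notation "x < y" := (Order.lt x y).
Local Notation "x <= y" := (Order.le x y).
Local Notation pw := (power_isort (S := S)).

(* [U] is relatively clopen in [C]. *)
Definition locconst n (C U : ('I_n -> M) -> Prop) := forall x, C x ->
  exists a b, box a b x /\ forall y, C y -> box a b y -> (U y <-> U x).

(* [C] is definably connected; [fcov A]: finitely many such sets cover [A].   *)
Definition dcon n (C : ('I_n -> M) -> Prop) := @dset _ _ S (pw n) C /\
  forall U, @dset _ _ S (pw n) U -> locconst C U -> forall x y, C x -> C y -> U x -> U y.

Definition fcov n (A : ('I_n -> M) -> Prop) := exists N (C : 'I_N -> ('I_n -> M) -> Prop),
  [/\ forall i, dcon (C i), forall i x, C i x -> A x & forall x, A x -> exists i, C i x].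

Lemma fcov0 n (A : ('I_n -> M) -> Prop) : (forall x, ~ A x) -> fcov A.
Proof. by move=> A0; exists 0, (fun _ _ => False); split=> [[]//|[]//|x /A0]. Qed.

Lemma fcov_dcon n (A : ('I_n -> M) -> Prop) : dcon A -> fcov A.
Proof. by move=> cA; exists 1, (fun=> A); split=> // x Ax; exists ord0. Qed.

Lemma fcov_or n (A B C : ('I_n -> M) -> Prop) : fcov A -> fcov B ->
  (forall x, C x <-> A x \/ B x) -> fcov C.
Proof.
move=> [N [F [cF FA AF]]] [P [G [cG GB BG]]] CAB.
exists (N + P), (fun i => match split i with inl j => F j | inr j => G j end); split.
- by move=> i; case: split.
- by move=> i x; case: split => j h; apply/CAB; [left; apply: FA h|right; apply: GB h].
- move=> x /CAB[/AF[i Fi]|/BG[i Gi]].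
    by exists (lshift P i); rewrite (unsplitK (inl i)).
  by exists (rshift N i); rewrite (unsplitK (inr i)).
Qed.

Lemma fcov_bigor n N (A : 'I_N -> ('I_n -> M) -> Prop) C : (forall i, fcov (A i)) ->
  (forall x, C x <-> exists i, A i x) -> fcov C.
Proof.
elim: N A C => [|N IH] A C fA CA; first by apply: fcov0 => x /CA[[]].
apply: (fcov_or (fA ord0) (IH (fun i => A (lift ord0 i)) (fun x => exists i, A (lift ord0 i) x) _ _)) => //.
move=> x; split=> [/CA[i]|[A0|[i Ai]]]; last 2 first.
- by apply/CA; exists ord0.
- by apply/CA; exists (lift ord0 i).
by case: (unliftP ord0 i) => [j|] ->; [right; exists j|left].
Qed.

Lemma box_inter n (a b a' b' x : 'I_n -> M) : box a b x -> box a' b' x ->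
  exists c e, box c e x /\ forall y, box c e y -> box a b y /\ box a' b' y.
Proof.
move=> h h'; exists (fun i => Order.max (a i) (a' i)), (fun i => Order.min (b i) (b' i)).
split=> [i|y hy]; first by have [? ?] := h i; have [? ?] := h' i; rewrite gt_max lt_min; split; apply/andP.
by split=> i; have := hy i; rewrite gt_max lt_min => -[/andP[? ?] /andP[? ?]].
Qed.

Lemma clo_mono n (P Q : ('I_n -> M) -> Prop) x : (forall y, P y -> Q y) -> clo P x -> clo Q x.
Proof. by move=> PQ h a b /h[y [/PQ]]; exists y. Qed.

Lemma nclo n (P : ('I_n -> M) -> Prop) x : ~ clo P x ->
  exists a b, box a b x /\ forall y, box a b y -> ~ P y.
Proof.
move=> nP; apply: contrapT => h; apply: nP => a b bx; apply: contrapT => h'; apply: h.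
by exists a, b; split=> // y by_ Py; apply: h'; exists y.
Qed.

Lemma clo_or n (P Q : ('I_n -> M) -> Prop) x : clo (fun y => P y \/ Q y) x -> clo P x \/ clo Q x.
Proof.
move=> h; apply: contrapT => /not_orP[/nclo[a [b [bx nP]]] /nclo[a' [b' [bx' nQ]]]].
have [c [e [ce h']]] := box_inter bx bx'.
by have [y [[Py|Qy] /h'[? ?]]] := h c e ce; [apply: nP Py|apply: nQ Qy].
Qed.

Lemma locconst_clo n (C U : ('I_n -> M) -> Prop) :
  (forall x, C x -> U x -> ~ clo (fun y => C y /\ ~ U y) x) ->
  (forall x, C x -> ~ U x -> ~ clo (fun y => C y /\ U y) x) -> locconst C U.
Proof.
move=> h1 h2 x Cx; have [Ux|nUx] := pselect (U x).
  have [a [b [bx h]]] := nclo (h1 x Cx Ux); exists a, b; split=> // y Cy by_.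
  by split=> // _; apply: contrapT => nUy; apply: (h y).
have [a [b [bx h]]] := nclo (h2 x Cx nUx); exists a, b; split=> // y Cy by_.
by split=> // Uy; case: (h y).
Qed.

(** The supremum of the points up to which [U] holds must be [u], since local constancy carries [U]
    across any smaller value. *)
Lemma interval_connected (U : M -> Prop) s u : @dset _ _ S L U ->
  (forall t, s <= t -> t <= u -> exists c c', [/\ c < t, t < c' &
     forall z, s <= z -> z <= u -> c < z -> z < c' -> U z <-> U t]) ->
  s <= u -> U s -> U u.
Proof.
move=> dU loc su Us; pose Q t := t <= u /\ forall z, s <= z -> z <= t -> U z.
have Qs : Q s by split=> // z sz zs; have <- : s = z by apply: le_anti; rewrite sz.
have [|||v [vQ Qv]] := @lub_exists _ _ S Q u.
- by rewrite /Q; dfn.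
- by exists s.
- by move=> t [].
have sv : s <= v by apply: vQ.
have vu : v <= u by apply: Qv => t [].
have [c [c' [cv vc' h]]] := loc v sv vu.
have [t [Qt ct st]] : exists t, [/\ Q t, c < t & s <= t].
  have [cs|sc] := ltP c s; first by exists s.
  apply: contrapT => nt; have : v <= c; last by rewrite leNgt cv.
  apply: Qv => t Qt; rewrite leNgt; apply/negP => ct; apply: nt; exists t.
  by split=> //; apply: le_trans sc (ltW ct).
have tv : t <= v by apply: vQ.
have Uv : U v.
  case: Qt => tu /(_ t st (lexx t)); apply: (h t st tu ct _).1.
  exact: le_lt_trans vc'.
have Qlt z : s <= z -> z <= v -> U z.
  move=> sz zv; have [zt|tz] := leP z t; first by case: Qt => _; apply.
  by apply/(h z sz (le_trans zv vu) (lt_trans ct tz) (le_lt_trans zv vc')).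
move: vu; rewrite le_eqVlt => /predU1P[<-//|vu].
have [x [vx xc' xu]] := between2 (S := S) vc' vu.
have Qx : Q x.
  split=> [|z sz zx]; first exact: ltW.
  have [zv|vz] := leP z v; first exact: Qlt.
  apply/(h z sz (le_trans zx (ltW xu)) (lt_trans cv vz) (le_lt_trans zx xc')) => //.
by have := vQ x Qx; rewrite leNgt vx.
Qed.

Definition unc n (A : ('I_n -> M) -> M -> Prop) (z : 'I_n.+1 -> M) :=
  A (fun i => z (lift ord_max i)) (z ord_max).

Lemma uncE n (A : ('I_n -> M) -> M -> Prop) y t : unc A (extp y t) <-> A y t.
Proof.
rewrite /unc extp_max; have -> // : (fun i => extp y t (lift ord_max i)) = y.
by apply/funext => i; rewrite extp_lift.
Qed.

Lemma dset_unc (X : isort S) n (A : X -> ('I_n -> M) -> M -> Prop) (f : X -> ('I_n.+1 -> M)) :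
  @dset _ _ S (prod_isort (prod_isort X (pw n)) L) (fun p => A p.1.1 p.1.2 p.2) ->
  @dmap _ _ S X (pw n.+1) f -> dset (fun x => unc (A x) (f x)).
Proof.
move=> dA df; apply: (dset_comp (f := fun x => (x, fun i => f x (lift ord_max i), f x ord_max)) dA).
dfn; apply: dmap_fun => i; dfn.
Qed.

(* Semicontinuity fails only on a set of smaller dimension. *)
Lemma generic_persistence n e (B : ('I_n -> M) -> Prop) (Q : ('I_n -> M) -> M -> M -> Prop) :
  @dset _ _ S (pw n) B -> @dset _ _ S (prod_isort (prod_isort (pw n) L) L) (fun p => Q p.1.1 p.1.2 p.2) ->
  ~ dq e.+1 B ->
  ~ dq e (fun y => B y /\ @dge _ _ S (LL (S := S)) 2
      (fun p => Q y p.1 p.2 /\ clo (fun y' => B y' /\ ~ Q y' p.1 p.2) y)).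
Proof.
move=> dB dQ nB h; pose R y c c' := B y /\ Q y c c' /\ clo (fun y' => B y' /\ ~ Q y' c c') y.
have [||c [c' hc]] := @generic_interval _ _ S (pw n) e R (uniform_power n).
- by rewrite /R; dfn.
- apply/dge_power; apply: dq_mono h => y [By hy]; apply: dge_mono hy => p [Qy cl]; by split.
(* For the fixed pair [c], [c'], the points found lie in the frontier of the part of [B] where [Q]
   fails, so [frontier_dim] makes that part too large. *)
apply: nB; have dB' : @dset _ _ S (pw n) (fun y => B y /\ ~ Q y c c') by dfn.
apply: (dq_mono (P := fun y => B y /\ ~ Q y c c')); first by move=> y [].
apply: (frontier_dim dB'); move/dge_power: hc; apply: dq_mono => y [By [Qy cl]].
by split=> // -[].
Qed.

Definition convex (P : M -> Prop) := forall s t u, P s -> P u -> s < t -> t < u -> P t.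

(* Over [B], the fibre [A y] depends lower semicontinuously on [y] near [t].  *)
Definition lsc n (B : ('I_n -> M) -> Prop) (A : ('I_n -> M) -> M -> Prop) y t := forall c c',
  c < t -> t < c' -> ~ clo (fun y' => B y' /\ ~ exists t', c < t' /\ t' < c' /\ A y' t') y.

Lemma dset_lsc (X : isort S) n (B : X -> ('I_n -> M) -> Prop) (A : X -> ('I_n -> M) -> M -> Prop) f g :
  @dset _ _ S (prod_isort X (pw n)) (fun p => B p.1 p.2) ->
  @dset _ _ S (prod_isort (prod_isort X (pw n)) L) (fun p => A p.1.1 p.1.2 p.2) ->
  @dmap _ _ S X (pw n) f -> @dmap _ _ S X L g ->
  dset (fun x => lsc (B x) (A x) (f x) (g x)).
Proof. by move=> dB dA df dg; rewrite /lsc; dfn. Qed.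

(** An interval around [t] that witnesses the failure of [lsc] can be shrunk around [t]; the
    witnesses thus form a two-dimensional set and [generic_persistence] applies. *)
Lemma generic_lsc n e (B : ('I_n -> M) -> Prop) (A : ('I_n -> M) -> M -> Prop) :
  @dset _ _ S (pw n) B -> @dset _ _ S (prod_isort (pw n) L) (fun p => A p.1 p.2) ->
  ~ dq e.+1 B -> ~ dq e (fun y => B y /\ ~ forall t, A y t -> lsc B A y t).
Proof.
move=> dB dA nB; have := generic_persistence dB _ nB
  (Q := fun y c c' => exists t', c < t' /\ t' < c' /\ A y t') => h1 h2.
apply: h1; first by dfn.
apply: dq_mono h2 => y [By /existsNP[t nt]]; split=> //.
have {nt}[At /existsNP[c /existsNP[c' nc]]] : A y t /\ ~ lsc B A y t by apply/not_implyP.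
have {nc}[ct nc] : c < t /\ ~ (t < c' -> ~ clo (fun y' => B y' /\ ~ exists t', c < t' /\ t' < c' /\ A y' t') y)
  by apply/not_implyP.
have {nc}[tc' /contrapT cl] : t < c' /\ ~ ~ clo (fun y' => B y' /\ ~ exists t', c < t' /\ t' < c' /\ A y' t') y
  by apply/not_implyP.
apply: (dge_around (P := fun c c' => (exists t', c < t' /\ t' < c' /\ A y t') /\ clo (fun y' => B y' /\ ~ exists t', c < t' /\ t' < c' /\ A y' t') y) _ ct tc').
  by dfn.
move=> x x' cx xt tx' x'c'; split; first by exists t.
apply: clo_mono cl => y' [By' ny']; split=> // -[t' [xt' [t'x' At']]]; apply: ny'.
by exists t'; split; [apply: lt_trans cx xt'|split=> //; apply: lt_trans t'x' x'c'].
Qed.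

(** A relatively clopen [U] is constant on each fibre, by convexity. By lower semicontinuity its
    projection to [C] is locally constant, hence all of [C] or empty. *)
Lemma dcon_bundle n (C : ('I_n -> M) -> Prop) (A : ('I_n -> M) -> M -> Prop) : dcon C ->
  @dset _ _ S (prod_isort (pw n) L) (fun p => A p.1 p.2) ->
  (forall y, C y -> convex (A y)) -> (forall y, C y -> exists2 t, A y t & lsc C A y t) ->
  dcon (unc (fun y t => C y /\ A y t)).
Proof.
move=> [dC cC] dA convA lscA; split.
   by apply: (dset_unc (X := pw n.+1)
    (A := fun _ y t => C y /\ A y t) (f := fun z => z)); dfn.
move=> U dU lU.
have fib y s u : C y -> s <= u -> A y s -> A y u -> U (extp y s) <-> U (extp y u).
  move=> Cy su As Au.
  have As_u t : s <= t -> t <= u -> A y t.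
    rewrite le_eqVlt => /predU1P[<-//|st]; rewrite le_eqVlt => /predU1P[->//|tu].
    exact: (convA y Cy s t u).
  have loc t : s <= t -> t <= u -> exists c c', [/\ c < t, t < c' &
      forall z, s <= z -> z <= u -> c < z -> z < c' -> U (extp y z) <-> U (extp y t)].
    move=> st tu; have [|a [b [bt h]]] := lU (extp y t); first by apply/uncE; split=> //; apply: As_u.
    move: bt; rewrite -(extp_eta a) -(extp_eta b) => /box_extp[by_ [at' tb]].
    exists (a ord_max), (b ord_max); split=> // z sz zu az zb; apply: h.
      by apply/uncE; split=> //; apply: As_u.
    by rewrite -(extp_eta a) -(extp_eta b); apply/box_extp.
  split=> [Us|Uu].
    by have := @interval_connected (fun t => U (extp y t)) s u _ loc su Us; apply; dfn.
  apply: contrapT => nUs.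
  have := @interval_connected (fun t => ~ U (extp y t)) s u _ _ su nUs; apply=> //; first by dfn.
  move=> t st tu; have [c [c' [? ? h]]] := loc t st tu; exists c, c'; split=> // z sz zu cz zc'.
  by have := h z sz zu cz zc' => h'; split=> nU Uz; apply: nU; apply/h'.
have {}fib y s u : C y -> A y s -> A y u -> U (extp y s) -> U (extp y u).
  by move=> Cy As Au Us; have [su|/ltW us] := leP s u; [apply/(fib y s u)|apply/(fib y u s)].
have dV : @dset _ _ S (pw n) (fun y => exists t, A y t /\ U (extp y t)) by dfn.
have lV : locconst C (fun y => exists t, A y t /\ U (extp y t)).
  move=> y Cy; have [t At lt] := lscA y Cy.
  have [|a [b [bt h]]] := lU (extp y t); first by apply/uncE.
  move: bt; rewrite -(extp_eta a) -(extp_eta b) => /box_extp[by_ [at' tb]].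
  have [a' [b' [by' h']]] := nclo (lt _ _ at' tb).
  have [c [e [ce hce]]] := box_inter by_ by'; exists c, e; split=> // z Cz /hce[bz bz'].
  have [t' [at'' [t'b At']]] : exists t', a ord_max < t' /\ t' < b ord_max /\ A z t'.
    by apply: contrapT => nt; apply: (h' z).
  have e' : U (extp z t') <-> U (extp y t).
    apply: h; first exact/uncE.
    by rewrite -(extp_eta a) -(extp_eta b); apply/box_extp.
  split=> [[s [As Us]]|[s [As Us]]]; [exists t; split=> //|exists t'; split=> //].
    by apply/e'; apply: fib Us.
  by apply/e'; apply: fib Us.
move=> x x'; rewrite -(extp_eta x) -(extp_eta x') => /uncE[Cx Ax] /uncE[Cx' Ax'] Ux.
have [|t [At Ut]] := cC _ dV lV _ _ Cx Cx'; first by exists (x ord_max).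
exact: fib Ut.
Qed.

(** Finiteness of the number of components in [n] variables, as the induction hypothesis for [n.+1]
    variables. *)
Definition cc n := forall A : ('I_n -> M) -> Prop, @dset _ _ S (pw n) A -> fcov A.

Lemma lsc_sub n (B C : ('I_n -> M) -> Prop) A y t : (forall y, C y -> B y) -> lsc B A y t -> lsc C A y t.
Proof. by move=> CB lB c c' ct tc' cl; apply: (lB c c' ct tc'); apply: clo_mono cl => z [/CB]. Qed.

(** Induction on a bound [e] for the dimension of the base. By [generic_lsc] the fibres vary
    semicontinuously off a smaller set [D]; the rest of the base is cut into connected pieces, over
    which [dcon_bundle] applies. *)
Lemma fcov_convex n (A : ('I_n -> M) -> M -> Prop) : cc n ->
  @dset _ _ S (prod_isort (pw n) L) (fun p => A p.1 p.2) ->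
  (forall y, convex (A y)) -> fcov (unc A).
Proof.
move=> ccn dA convA; have : exists e, ~ dq e (fun y => exists t, A y t).
  by exists n.+1 => /dq_bound; rewrite ltnn.
move=> [e]; elim: e A dA convA => [|e IH] A dA convA nA.
  apply: fcov0 => z Az; apply: nA; apply: (dqf_0 (dpow (S := S) n)) (fun i => z (lift ord_max i)) _.
  by exists (z ord_max).
pose B y := exists t, A y t; have dB : @dset _ _ S (pw n) B by rewrite /B; dfn.
pose D y := B y /\ ~ forall t, A y t -> lsc B A y t.
have dlsc : @dset _ _ S (prod_isort (pw n) L) (fun p => lsc B A p.1 p.2).
  by apply: (dset_lsc (X := prod_isort (pw n) L) (B := fun _ => B) (A := fun _ => A)); dfn.
have dD : @dset _ _ S (pw n) D by rewrite /D; dfn.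
have nD : ~ dq e D by apply: generic_lsc.
have [|N [C [cC CB BC]]] := ccn (fun y => B y /\ ~ D y); first by dfn.
have f1 : fcov (unc (fun y t => D y /\ A y t)).
  apply: IH; first by dfn.
  - by move=> y s t u [Dy As] [_ Au] st tu; split=> //; apply: convA st tu.
  - by move=> h; apply: nD; apply: dq_mono h => y [t []].
have f2 : fcov (unc (fun y t => (B y /\ ~ D y) /\ A y t)).
  apply: (fcov_bigor (A := fun i => unc (fun y t => C i y /\ A y t))).
    move=> i; apply/fcov_dcon/dcon_bundle => // y Cy.
    have [[t At] nD'] := CB i y Cy; exists t => //.
    apply: (lsc_sub (B := B)); first by move=> z /CB[].
    by apply: contrapT => nl; apply: nD'; split; [exists t|move=> /(_ t At)].
  move=> z; split=> [[/BC[i Ci] Az]|[i [Ci Az]]]; first by exists i.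
  by split=> //; apply: CB Ci.
apply: (fcov_or f1 f2) => z; rewrite /unc; split=> [Az|[[]|[]]//].
have Bz : B (fun i => z (lift ord_max i)) by exists (z ord_max).
by have [Dz|nDz] := pselect (D (fun i => z (lift ord_max i))); [left|right].
Qed.
End Connectedness.

(** * Uniform bounds for finite fibres *)

Section UniformFiniteness.
Context {d : Order.disp_t} {M : orderType d} {S : ominimal_structure M}.
Local Notation L := (line_isort (S := S)).
Local Notation "x < y" := (Order.lt x y).
Local Notation "x <= y" := (Order.le x y).
Local Notation pw := (power_isort (S := S)).

(* [P] has at least [m] elements. *)
Fixpoint cge m (P : M -> Prop) : Prop :=
  if m is m'.+1 then exists t, P t /\ cge m' (fun u => P u /\ u < t) else True.

Lemma cge_mono m (P Q : M -> Prop) : (forall t, P t -> Q t) -> cge m P -> cge m Q.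
Proof.
elim: m P Q => //= m IH P Q PQ [t [/PQ Qt h]]; exists t; split=> //.
by apply: IH h => u [/PQ].
Qed.

Lemma dset_cge (X : isort S) m (R : X -> M -> Prop) :
  @dset _ _ S (prod_isort X L) (fun p => R p.1 p.2) -> dset (fun x => cge m (R x)).
Proof.
elim: m X R => [|m IH] X R dR /=; first exact: dset_prop.
apply: (dset_ex (Y := L)); apply: dset_and; first by dfn.
by apply: (IH (prod_isort X L) (fun p u => R p.1 u /\ u < p.2)); dfn.
Qed.

Lemma cge_leq m k (P : M -> Prop) : (k <= m)%N -> cge m P -> cge k P.
Proof.
elim: m k P => [|m IH] [|k] P //= km [t [Pt h]]; exists t; split=> //.
exact: IH h.
Qed.

Lemma cge_bottom m (P : M -> Prop) t : P t -> cge m (fun u => P u /\ t < u) -> cge m.+1 P.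
Proof.
elim: m P => [|m IH] P Pt /=; first by move=> _; exists t.
move=> [x [[Px tx] h]]; exists x; split=> //.
apply: (IH (fun u => P u /\ u < x)) => //; apply: cge_mono h.
by move=> u [[? ?] ?].
Qed.

Lemma finite_cge (P : M -> Prop) : @dset _ _ S L P -> ~ fat P -> exists N, ~ cge N P.
Proof.
move=> dP /(not_fat_list dP)[s sP]; exists (size s).+1.
have gen n : forall (s : seq M) P, (size s <= n)%N -> (forall x, P x -> x \in s) -> ~ cge n.+1 P.
  elim: n => [|n IH] {}s {dP sP}P les sP /= [t [Pt h]].
    by case: s les sP => // _ /(_ t Pt).
  have ts := sP t Pt; apply: (IH (rem t s) _ _ _ h) => [|u [Pu ut]].
    by rewrite size_rem // -subn1 leq_subLR add1n.
  have := sP u Pu; rewrite (perm_mem (perm_to_rem ts)) inE => /predU1P[uu|//].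
  by rewrite uu ltxx in ut.
exact: gen (leqnn _) sP.
Qed.
End UniformFiniteness.

Ltac dext2 := match goal with
 | |- @dset _ _ _ ?X (fun x => cge ?m (@?R x)) => refine (dset_cge (X := X) (R := R) m _)
 | |- @dset _ _ _ ?X (fun x => @lsc _ _ _ (@?B x) (@?A x) (@?f x) (@?g x)) =>
     refine (dset_lsc (X := X) (B := B) (A := A) (f := f) (g := g) _ _ _ _)
 | |- @dset _ _ _ ?X (fun x => fat (@?R x)) => refine (dset_fat (X := X) (R := R) _)
 | |- @dset _ _ _ ?X (fun x => @dge _ _ _ _ ?k (@?R x)) => refine (dset_dge (Y := X) (R := R) k _)
 | |- @dset _ _ _ ?X (fun x => @box _ _ _ (@?f x) (@?g x) (@?h x)) => refine (dset_box (X := X) (f := f) (g := g) (h := h) _ _ _)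
 | |- @dset _ _ _ ?X (fun x => @clo _ _ _ (@?R x) (@?f x)) => refine (dset_clo (X := X) (R := R) (f := f) _ _)
 end.
Ltac dext ::= dext2.

Section UniformFiniteness2.
Context {d : Order.disp_t} {M : orderType d} {S : ominimal_structure M}.
Local Notation L := (line_isort (S := S)).
Local Notation "x < y" := (Order.lt x y).
Local Notation "x <= y" := (Order.le x y).
Local Notation pw := (power_isort (S := S)).

Section Fibres.
Variables (n : nat) (F : ('I_n -> M) -> M -> Prop).
Hypothesis dF : @dset _ _ S (prod_isort (pw n) L) (fun p => F p.1 p.2).
Hypothesis finF : forall y, ~ fat (F y).
Variable B : ('I_n -> M) -> Prop.
Hypothesis dB : @dset _ _ S (pw n) B.

(** Some interval around [t] contains at most one point of every fibre over points of [B] near [y],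
    and no such point if [t] is not in [F y]. *)
Definition isol y t := exists c c', [/\ c < t, t < c' &
  ~ clo (fun y' => B y' /\ (cge 2 (fun u => F y' u /\ c < u /\ u < c') \/
     ~ F y t /\ cge 1 (fun u => F y' u /\ c < u /\ u < c'))) y].
Definition bounded_above y := exists c, ~ clo (fun y' => B y' /\ exists t, F y' t /\ c < t) y.
Definition bounded_below y := exists c, ~ clo (fun y' => B y' /\ exists t, F y' t /\ t < c) y.

(** Lower semicontinuity of the count. With a gap from [c] to the top point [t], semicontinuity
    keeps a point between [c] and [c0], and induction keeps the others below [c]. *)
Lemma persist_cge m c0 y : (forall t, F y t -> lsc B F y t) -> cge m (fun t => F y t /\ t < c0) ->
  ~ clo (fun y' => B y' /\ ~ cge m (fun t => F y' t /\ t < c0)) y.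
Proof.
move=> ly; elim: m c0 => [|m IH] c0 /=.
  by move=> _ cl; have [a ab] := choice (fun i => om_no_min S (y i));
     have [b bb] := choice (fun i => om_no_max S (y i)); have [|z [[_ nT] _]] := cl a b.
move=> [t [[Ft tc] h]].
have [|s sP] := not_fat_list (S := S) _ (@finF y); first by dfn.
have [c ct lc] := left_gap (S := S) s t.
have hc : cge m (fun u => F y u /\ u < c).
  by apply: cge_mono h => u [[Fu _] ut]; split=> //; apply: lc => //; apply: sP.
move=> cl; have := clo_or (P := fun y' => B y' /\ ~ cge m (fun u => F y' u /\ u < c))
  (Q := fun y' => B y' /\ ~ exists t', c < t' /\ t' < c0 /\ F y' t') (x := y).
case=> [|/(IH c hc)//|/(ly t Ft c c0 ct tc)//].
apply: clo_mono cl => z [Bz nz]; have [hz|] := pselect (cge m (fun u => F z u /\ u < c)); last by left.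
right; split=> // -[t' [ct' [t'c Ft']]]; apply: nz; exists t'; split=> //.
apply: cge_mono hz => u [Fu uc]; split; last exact: lt_trans ct'.
by split=> //; apply: lt_trans t'c; apply: lt_trans ct'.
Qed.

(** Upper semicontinuity of the count. Let [s0] be the infimum of the bounds below which nearby
    fibres can have [m.+1] points. Then such fibres have exactly one point near [s0], so [s0]
    belongs to [F y] by [isol], and induction treats the [m] points further down. *)
Lemma cluster_cge m s y : (forall t, isol y t) -> bounded_below y ->
  clo (fun y' => B y' /\ cge m (fun t => F y' t /\ t < s)) y -> cge m (fun t => F y t /\ t <= s).
Proof.
move=> iy [l hl]; elim: m s => [//|m IH] s Ts.
pose T s := clo (fun y' => B y' /\ cge m.+1 (fun t => F y' t /\ t < s)) y.
have Tup u v : u <= v -> T u -> T v.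
  move=> uv; apply: clo_mono => z [Bz hz]; split=> //; apply: cge_mono hz => t [Ft tu].
  by split=> //; apply: lt_le_trans uv.
have dT : @dset _ _ S L T.
  rewrite /T; apply: (dset_clo (X := L) (R := fun s y' => B y' /\ cge m.+1 (fun t => F y' t /\ t < s))
    (f := fun=> y)); last exact: dmap_const.
  apply: dset_and; first by dfn.
  by apply: (dset_cge m.+1 (X := prod_isort L (pw n)) (R := fun p t => F p.2 t /\ t < p.1)); dfn.
have [||s0 [sT Ts0]] := @glb_exists _ _ S T l dT; first by exists s.
  move=> u Tu; rewrite leNgt; apply/negP => ul; apply: hl; apply: clo_mono Tu => z [Bz [t [[Ft tu] _]]].
  by split=> //; exists t; split=> //; apply: lt_trans ul.
have [c [c' [cs0 s0c' ncl]]] := iy s0.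
have [s1 Ts1 [s1c' s1s]] : exists2 s1, T s1 & s1 < c' /\ s1 <= s.
  have [sc'|c's] := ltP s c'; first by exists s.
  apply: contrapT => ns1; have : c' <= s0; last by rewrite leNgt s0c'.
  apply: Ts0 => u Tu; rewrite leNgt; apply/negP => uc'; apply: ns1; exists u => //; split=> //.
  exact: le_trans (ltW uc') c's.
have [c2 [cc2 c2s0]] := om_dense S cs0.
have nTc2 : ~ T c2 by move=> /sT; rewrite leNgt c2s0.
pose bad y' := cge 2 (fun u => F y' u /\ c < u /\ u < c') \/
     ~ F y s0 /\ cge 1 (fun u => F y' u /\ c < u /\ u < c').
have good : clo (fun y' => B y' /\ (cge m.+1 (fun t => F y' t /\ t < s1) /\
    ~ cge m.+1 (fun t => F y' t /\ t < c2) /\ ~ bad y')) y.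
  have := clo_or (P := fun y' => B y' /\ cge m.+1 (fun t => F y' t /\ t < c2))
    (Q := fun y' => B y' /\ bad y' \/ (B y' /\ (cge m.+1 (fun t => F y' t /\ t < s1) /\
    ~ cge m.+1 (fun t => F y' t /\ t < c2) /\ ~ bad y'))) (x := y).
  case=> [|//|/clo_or[//|//]].
  apply: clo_mono Ts1 => z [Bz hz].
  have [h2|n2] := pselect (cge m.+1 (fun t => F z t /\ t < c2)); first by left.
  by have [bz|nbz] := pselect (bad z); [right; left|right; right].
have key z : B z /\ (cge m.+1 (fun t => F z t /\ t < s1) /\
    ~ cge m.+1 (fun t => F z t /\ t < c2) /\ ~ bad z) ->
    F y s0 /\ cge m (fun t => F z t /\ t < c2).
  move=> [Bz [[t [[Ft ts1] ht]] [n2 nb]]].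
  have c2t : c2 <= t.
    rewrite leNgt; apply/negP => tc2; apply: n2; exists t; split=> //.
    by apply: cge_mono ht => u [[Fu _] ut]; split=> //; split=> //; apply: lt_trans tc2.
  have ct := lt_le_trans cc2 c2t; have tc' := lt_trans ts1 s1c'.
  split; first by apply: contrapT => nFs; apply: nb; right; split=> //; exists t.
  apply: cge_mono ht => u [[Fu us1] ut]; split=> //; rewrite ltNge; apply/negP => c2u.
  apply: nb; left; exists t; split=> //; exists u; split=> //.
  by split=> //; split=> //; split; [apply: lt_le_trans c2u|apply: lt_trans tc'].
have [a ab] := choice (fun i => om_no_min S (y i)); have [b bb] := choice (fun i => om_no_max S (y i)).
have [|z [/key[Fs0 _] _]] := good a b; first by split.
have s0s : s0 <= s by apply: sT.
have := IH c2 (clo_mono _ good) => h.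
exists s0; split=> //; apply: cge_mono (h _) => [u [Fu uc2]|w hw].
  by split; [split=> //; apply: le_trans uc2 (le_trans (ltW c2s0) s0s)|apply: le_lt_trans c2s0].
by have [_ ?] := key w hw; case: hw.
Qed.

Lemma locconst_cge m C : (forall y, C y -> B y) ->
  (forall y, C y -> [/\ forall t, F y t -> lsc B F y t, forall t, isol y t, bounded_above y & bounded_below y]) ->
  locconst C (fun y => cge m (F y)).
Proof.
move=> CB good; apply: locconst_clo => y Cy hy cl; have [ly iy [u hu] by_] := good y Cy.
  have [c hc] : exists c, cge m (fun t => F y t /\ t < c).
    case: m hy {cl} => [|m] /=; first by exists u.
    move=> [t [Ft h]]; have [c tc] := om_no_max S t; exists c, t; split=> //.
    by apply: cge_mono h => v [Fv vt]; split=> //; split=> //; apply: lt_trans tc.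
  apply: (persist_cge ly hc); apply: clo_mono cl => z [/CB Bz nz]; split=> // h; apply: nz.
  by apply: cge_mono h => t [].
have [c uc] := om_no_max S u; apply: hy.
suff : cge m (fun t => F y t /\ t <= c) by apply: cge_mono => t [].
apply: cluster_cge => //.
have := clo_or (P := fun y' => B y' /\ exists t, F y' t /\ u < t)
  (Q := fun y' => B y' /\ cge m (fun t => F y' t /\ t < c)) (x := y).
case=> [|//|//]; apply: clo_mono cl => z [/CB Bz hz].
have [ez|nz] := pselect (exists t, F z t /\ u < t); [by left|right; split=> //].
apply: cge_mono hz => t Ft; split=> //; apply: le_lt_trans uc; rewrite leNgt; apply/negP => ut.
by apply: nz; exists t.
Qed.

(** Close to [t] the fibre has fewer than 2 points, or fewer than 1 if [t] is not in it. Failure of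
    [isol] is failure of persistence for one of these two bounds on all small intervals around
    [t]. *)
Lemma generic_isol e : ~ dq e.+1 B -> ~ dq e (fun y => B y /\ ~ forall t, isol y t).
Proof.
move=> nB h.
pose Q1 j y c c' := ~ cge j (fun u => F y u /\ c < u /\ u < c').
have dQ j : @dset _ _ S (prod_isort (prod_isort (pw n) L) L) (fun p => Q1 j p.1.1 p.1.2 p.2).
  by rewrite /Q1; dfn.
pose R j y := B y /\ @dge _ _ S (LL (S := S)) 2
      (fun p => Q1 j y p.1 p.2 /\ clo (fun y' => B y' /\ ~ Q1 j y' p.1 p.2) y).
have dR j : @dset _ _ S (pw n) (R j).
  by rewrite /R; have := dQ j; move: (Q1 j) => Q dQj; dfn.
have nR j : ~ dq e (R j) := generic_persistence dB (dQ j) nB.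
have : @dge _ _ S (pw n) e (fun y => R 2 y \/ R 1 y).
  apply/dge_power; apply: dq_mono h => y [By /existsNP[t nt]].
  have [|s sP] := not_fat_list (S := S) _ (@finF y); first by dfn.
  have [a at' la] := left_gap (S := S) s t; have [b tb rb] := right_gap (S := S) s t.
  have only u c c' : F y u -> a < c -> c' < b -> c < u -> u < c' -> u = t.
    move=> /sP us ac c'b cu uc'; have [ut|tu|//] := ltgtP u t.
      by have := lt_trans (lt_trans ac cu) (la u us ut); rewrite ltxx.
    by have := lt_trans (lt_trans uc' c'b) (rb u us tu); rewrite ltxx.
  have [Ft|nFt] := pselect (F y t); [left|right]; split=> //.
    apply: (dge_around (P := fun c c' => Q1 2 y c c' /\ clo (fun y' => B y' /\ ~ Q1 2 y' c c') y) _ at' tb).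
      by rewrite /Q1; dfn.
    move=> c c' ac ct tc' c'b; split.
      move=> [u [[Fu [cu uc']] [v [[[Fv [cv vc']] vu] _]]]].
      by move: vu; rewrite (only u c c') // (only v c c') // ltxx.
    apply: contrapT => ncl; apply: nt; exists c, c'; split=> //; apply: contra_not ncl => ncl.
    by apply: clo_mono ncl => z [Bz [h2|[]//]]; split=> //; apply.
  apply: (dge_around (P := fun c c' => Q1 1 y c c' /\ clo (fun y' => B y' /\ ~ Q1 1 y' c c') y) _ at' tb).
    by rewrite /Q1; dfn.
  move=> c c' ac ct tc' c'b; split.
    move=> [u [[Fu [cu uc']] _]]; apply: nFt; by rewrite -(only u c c').
  apply: contrapT => ncl; apply: nt; exists c, c'; split=> //; apply: contra_not ncl => ncl.
  apply: clo_mono ncl => z [Bz [h2|[_ h1]]]; split=> //; apply=> //.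
  exact: cge_leq h2.
by move=> /(dge_or (dR 2) (dR 1)) [] /dge_power; apply: nR.
Qed.

(** Fix one [c] outside [E y] for a set of [y] of dimension [e]; these [y] lie in the frontier of
    the part of [B] where [E] holds at [c]. *)
Lemma generic_bound e (E : ('I_n -> M) -> M -> Prop) :
  @dset _ _ S (prod_isort (pw n) L) (fun p => E p.1 p.2) ->
  (forall y, fat (fun c => ~ E y c)) -> ~ dq e.+1 B ->
  ~ dq e (fun y => B y /\ forall c, clo (fun y' => B y' /\ E y' c) y).
Proof.
move=> dE fE nB h; pose R y c := B y /\ ~ E y c /\ clo (fun y' => B y' /\ E y' c) y.
have dR : @dset _ _ S (prod_isort (pw n) L) (fun p => R p.1 p.2) by rewrite /R; dfn.
have [//||c hc] := generic_parameter (k := e) (m := 1) (uniform_power n) uniform_line _ dR _.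
  apply/dge_power; apply: dq_mono h => y [By cl]; apply: dge_lineE.
  by apply: fat_mono (fE y) => c nE; split.
apply: nB; have dBE : @dset _ _ S (pw n) (fun y => B y /\ E y c) by dfn.
apply: (dq_mono (P := fun y => B y /\ E y c)); first by move=> y [].
apply: (frontier_dim dBE); move/dge_power: hc; apply: dq_mono => y [By [nE cl]].
by split=> // -[].
Qed.

Lemma generic_bounded_above e : ~ dq e.+1 B -> ~ dq e (fun y => B y /\ ~ bounded_above y).
Proof.
move=> nB h; apply: (generic_bound (E := fun y c => exists t, F y t /\ c < t) _ _ nB).
- by dfn.
- move=> y; have [|s sP] := not_fat_list (S := S) _ (@finF y); first by dfn.
  have [u su] : exists u, forall t, t \in s -> t <= u.
    elim: {sP} s => [|t s [u IH]]; first by have [u _] := om_nonempty S; exists u.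
    exists (Order.max t u) => v; rewrite inE le_max => /predU1P[->|/IH ->]; rewrite ?lexx ?orbT //.
  have [v uv] := om_no_max S u; exists u, v; split=> // c uc _ [t [/sP/su tu ct]].
  by have := lt_le_trans (lt_trans uc ct) tu; rewrite ltxx.
- apply: dq_mono h => y [By nb]; split=> // c; apply: contrapT => ncl; apply: nb; by exists c.
Qed.

Lemma generic_bounded_below e : ~ dq e.+1 B -> ~ dq e (fun y => B y /\ ~ bounded_below y).
Proof.
move=> nB h; apply: (generic_bound (E := fun y c => exists t, F y t /\ t < c) _ _ nB).
- by dfn.
- move=> y; have [|s sP] := not_fat_list (S := S) _ (@finF y); first by dfn.
  have [u su] : exists u, forall t, t \in s -> u <= t.
    elim: {sP} s => [|t s [u IH]]; first by have [u _] := om_nonempty S; exists u.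
    exists (Order.min t u) => v; rewrite inE ge_min => /predU1P[->|/IH ->]; rewrite ?lexx ?orbT //.
  have [v vu] := om_no_min S u; exists v, u; split=> // c _ cu [t [/sP/su ut tc]].
  by have := le_lt_trans ut (lt_trans tc cu); rewrite ltxx.
- apply: dq_mono h => y [By nb]; split=> // c; apply: contrapT => ncl; apply: nb; by exists c.
Qed.
End Fibres.

(** Generically the count is locally constant ([locconst_cge]), hence bounded on each of finitely
    many connected pieces; the exceptional base points have smaller dimension and fall under the
    induction. *)
Lemma uniform_finiteness n (F : ('I_n -> M) -> M -> Prop) : cc (S := S) n ->
  @dset _ _ S (prod_isort (pw n) L) (fun p => F p.1 p.2) ->
  (forall y, ~ fat (F y)) -> exists N, forall y, ~ cge N (F y).
Proof.
move=> ccn dF finF; have : exists e, ~ dq e (fun y => exists t, F y t).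
  by exists n.+1 => /dq_bound; rewrite ltnn.
move=> [e]; elim: e F dF finF => [|e IH] F dF finF nF.
  exists 1 => y [t [Ft _]]; apply: nF; apply: (dqf_0 (dpow (S := S) n)) (y) _; by exists t.
pose B y := exists t, F y t; have dB : @dset _ _ S (pw n) B by rewrite /B; dfn.
pose G1 y := forall t, F y t -> lsc B F y t.
pose G2 y := forall t, isol F B y t.
have dG1 : @dset _ _ S (pw n) G1 by rewrite /G1; dfn.
have dG2 : @dset _ _ S (pw n) G2 by rewrite /G2 /isol; dfn.
have dG3 : @dset _ _ S (pw n) (bounded_above F B) by rewrite /bounded_above; dfn.
have dG4 : @dset _ _ S (pw n) (bounded_below F B) by rewrite /bounded_below; dfn.
pose G y := (G1 y /\ G2 y) /\ (bounded_above F B y /\ bounded_below F B y).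
have dG : @dset _ _ S (pw n) G by rewrite /G; dfn.
have nD : ~ dq e (fun y => B y /\ ~ G y).
  move=> h; have : @dge _ _ S (pw n) e (fun y => ((B y /\ ~ G1 y) \/ (B y /\ ~ G2 y)) \/
      ((B y /\ ~ bounded_above F B y) \/ (B y /\ ~ bounded_below F B y))).
    apply/dge_power; apply: dq_mono h => y [By].
    by move=> /not_andP[/not_andP[]|/not_andP[]] ?; [left; left|left; right|right; left|right; right].
  have dBG P : @dset _ _ S (pw n) P -> @dset _ _ S (pw n) (fun y => B y /\ ~ P y) by move=> dP; dfn.
  move=> /(dge_or (dset_or (dBG _ dG1) (dBG _ dG2)) (dset_or (dBG _ dG3) (dBG _ dG4))).
  case=> [/(dge_or (dBG _ dG1) (dBG _ dG2))[]|/(dge_or (dBG _ dG3) (dBG _ dG4))[]] /dge_power.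
  - exact: (generic_lsc dB dF nF).
  - exact: (generic_isol dF finF dB nF).
  - exact: (generic_bounded_above dF finF dB nF).
  - exact: (generic_bounded_below dF finF dB nF).
have [|||N1 hN1] := IH (fun y t => F y t /\ ~ G y).
- by dfn.
- by move=> y h; apply: (finF y); apply: fat_mono h => t [].
- by move=> h; apply: nD; apply: dq_mono h => y [t [Ft nG]]; split=> //; exists t.
have [|P [C [cC CB BC]]] := ccn (fun y => B y /\ G y); first by dfn.
have /choice[N2 hN2] : forall i, exists N, forall y, C i y -> ~ cge N (F y).
  move=> i; have [[y0 Cy0]|nC] := pselect (exists y, C i y); last first.
    by exists 0 => y Cy; case: nC; exists y.
  have [|N hN] := finite_cge (S := S) _ (@finF y0); first by dfn.
  exists N => y Cy hy; apply: hN; have [_ /(_ (fun y => cge N (F y)))] := cC i.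
  move=> /(_ _ _ y y0 Cy Cy0 hy); apply; first by dfn.
  apply: (locconst_cge dF finF dB).
    by move=> z /CB[].
  by move=> z /CB[_ [[? ?] [? ?]]].
(* The successor of [N1] ensures that a counterexample has a nonempty fibre, so that [y] lies in
   [B]. *)
exists (maxn N1.+1 (\max_i (N2 i)).+1) => y hy.
have [t [Ft _]] : cge 1 (F y) by apply: cge_leq hy; rewrite leq_max.
have By : B y by exists t.
have [Gy|nGy] := pselect (G y).
  have [i Ci] : exists i, C i y by apply: BC; split.
  apply: (hN2 i y Ci); apply: cge_leq hy.
  by rewrite leq_max [X in _ || X]leqW ?orbT //; apply: leq_bigmax.
apply: (hN1 y); have {hy} : cge N1 (F y) by apply: cge_leq hy; rewrite leq_max leqnSn.
by apply: cge_mono => u Fu; split.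
Qed.

(* To the right of [u], [P] alternates at least [m] times from true to false  *)
(* and then holds once more.                                                  *)
Fixpoint altf m (P : M -> Prop) u : Prop :=
  if m is m'.+1 then exists t v, [/\ u < t, t < v, P t, ~ P v & altf m' P v]
  else exists2 t, u < t & P t.

Lemma altf_ext m (P Q : M -> Prop) u : (forall x, u < x -> P x <-> Q x) -> altf m P u -> altf m Q u.
Proof.
elim: m u => [|m IH] u PQ /=; first by move=> [t ut /(PQ t ut) Qt]; exists t.
move=> [t [v [ut tv /(PQ t ut) Qt nPv h]]]; exists t, v; split=> //.
  by move/(PQ v (lt_trans ut tv)).
by apply: IH h => x vx; apply/PQ; apply: lt_trans vx; apply: lt_trans tv.
Qed.

Definition bdry (P : M -> Prop) t := forall c c', c < t -> t < c' ->
  exists z w, ((c < z /\ z < c') /\ (c < w /\ w < c')) /\ (P z /\ ~ P w).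

Lemma bdry_finite (P : M -> Prop) : @dset _ _ S L P -> ~ fat (bdry P).
Proof.
move=> dP [a [b [ab h]]]; have [c [ac cb]] := om_dense S ab.
have [e ce ge] := right_germ c dP; have [t [ct te tb]] := between2 (S := S) ce cb.
have [z [w [[[cz ze] [cw we]] [Pz nPw]]]] := h t (lt_trans ac ct) tb c e ct te.
by case: ge => g; [apply: nPw; apply: g|apply: (g z)].
Qed.

Lemma bdry_between (P : M -> Prop) t u : @dset _ _ S L P -> t < u -> P t -> ~ P u ->
  exists s, [/\ t <= s, s <= u & bdry P s].
Proof.
move=> dP tu Pt nPu; apply: contrapT => nb; apply: nPu.
apply: (interval_connected dP _ (ltW tu) Pt) => s ts su.
have /existsNP[c /existsNP[c' nc]] : ~ bdry P s by move=> bs; apply: nb; exists s.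
have {nc}[cs nc] := (not_implyP _ _).1 nc; have {nc}[sc' nc] := (not_implyP _ _).1 nc.
exists c, c'; split=> // z _ _ cz zc'; split=> [Pz|Ps]; apply: contrapT => nP; apply: nc.
  by exists z, s.
by exists s, z.
Qed.

(** Each change from true to false leaves a boundary point between [t] and [v], and the following
    ones lie beyond [v]. *)
Lemma altf_cge m (P : M -> Prop) u : @dset _ _ S L P -> altf m P u ->
  cge m (fun s => bdry P s /\ u < s).
Proof.
move=> dP; elim: m u => [//|m IH] u [t [v [ut tv Pt nPv /IH h]]].
have [s [ts sv bs]] := bdry_between dP tv Pt nPv.
have us := lt_le_trans ut ts; apply: (cge_bottom (t := s)) => //.
apply: cge_mono h => x [bx vx]; split; last exact: le_lt_trans vx.
by split=> //; apply: lt_trans us (le_lt_trans sv vx).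
Qed.

(** Boundary points of the fibres are uniformly finite in number, so the number of alternations is
    bounded by some [N]. Induction on [N] strips the lowest convex component from every fibre and
    covers it by [fcov_convex]. *)
Lemma cc_all n : cc (S := S) n.
Proof.
elim: n => [|n IH] A dA.
  apply/fcov_dcon; split=> // U _ _ x y _ _.
  by have -> : x = y by apply/funext => -[].
pose A1 y t := A (extp y t).
have dA1 : @dset _ _ S (prod_isort (pw n) L) (fun p => A1 p.1 p.2) by rewrite /A1; dfn.
have -> : A = unc A1 by apply/funext => z; rewrite /unc /A1 extp_eta.
have [||N hN] := @uniform_finiteness n (fun y t => bdry (A1 y) t) IH.
- by rewrite /bdry; dfn.
- by move=> y; apply: bdry_finite; dfn.
have hA1 y u : ~ altf N (A1 y) u.
  by move=> /altf_cge h; apply: (hN y); apply: cge_mono (h _) => [t []//|]; dfn.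
move: A1 dA1 hA1 {hN} => A1; elim: N A1 {A dA} => [|N IHN] A dA hN.
  apply: fcov0 => z Az; have [u uz] := om_no_min S (z ord_max).
  by apply: (hN (fun i => z (lift ord_max i)) u); exists (z ord_max).
(* The lowest convex component of each fibre. *)
pose A1 y t := A y t /\ forall s u, A y s -> s < u -> u < t -> A y u.
have f1 : fcov (S := S) (unc A1).
  apply: fcov_convex => //; first by rewrite /A1; dfn.
  move=> y s t u [As _] [Au h] st tu; split; first exact: h st tu.
  by move=> s' u' As' s'u' u't; apply: (h s') => //; apply: lt_trans tu.
have f2 : fcov (S := S) (unc (fun y t => A y t /\ ~ A1 y t)).
  apply: IHN; first by rewrite /A1; dfn.
  move=> y u0 h.
  pose A2 t := A y t /\ ~ A1 y t.
  have wit t : A2 t -> exists s v, [/\ A y s, s < v, v < t & ~ A y v].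
    move=> [At nA1]; apply: contrapT => nex; apply: nA1; split=> // s v As sv vt.
    by apply: contrapT => nAv; apply: nex; exists s, v.
  have after t x : A2 t -> t < x -> A2 x <-> A y x.
    move=> /wit[s [v [As sv vt nAv]]] tx; split=> [[]//|Ax]; split=> // -[_ /(_ s v As sv)].
    by move=> /(_ (lt_trans vt tx)).
  have [t [A2t ht]] : exists t, A2 t /\ (if N is N'.+1 then exists v, [/\ t < v, ~ A2 v & altf N' A2 v] else True).
    by case: (N) h => [|N'] /=; [case=> t _ A2t; exists t|case=> t [v [_ tv A2t nA2 hv]]; exists t; split=> //; exists v].
  have [s [v [As sv vt nAv]]] := wit t A2t; have [u us] := om_no_min S s.
  apply: (hN y u); exists s, v; split=> //.
  case: (N) ht => [_|N' [x [tx nA2x hx]]]; first by exists t => //; case: A2t.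
  exists t, x; split=> //; first by case: A2t.
    by move=> Ax; apply: nA2x; apply/(after t).
  by apply: altf_ext hx => z xz; apply: (after t) => //; apply: lt_trans xz.
apply: (fcov_or f1 f2) => z; rewrite /unc; split=> [Az|[[]|[]]//].
by have [|] := pselect (A1 (fun i => z (lift ord_max i)) (z ord_max)); [left|right].
Qed.
End UniformFiniteness2.

(** * Definable groups *)

Section GroupLaws.
Variables (T : Type) (L : group_law T).
Local Notation "x * y" := (gmul L x y).
Local Notation "x ^-1" := (ginv L x).
Local Notation "1" := (gone L).

Lemma gmulrV x : x * x^-1 = 1.
Proof.
rewrite -[x * _](gmul1 L) -[in LHS](gmulV L (x^-1)) -(gmulA L (x^-1^-1)).
by rewrite (gmulA L (x^-1)) gmulV gmul1 gmulV.
Qed.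
Lemma gmulr1 x : x * 1 = x. Proof. by rewrite -(gmulV L x) gmulA gmulrV gmul1. Qed.
Lemma gmulAr x y z : (x * y) * z = x * (y * z). Proof. by rewrite gmulA. Qed.
Lemma gmulKV x y : x^-1 * (x * y) = y. Proof. by rewrite gmulA gmulV gmul1. Qed.
Lemma gmulVK x y : x * (x^-1 * y) = y. Proof. by rewrite gmulA gmulrV gmul1. Qed.
Lemma ginvK x : x^-1^-1 = x. Proof. by rewrite -[LHS]gmulr1 -(gmulV L x) gmulKV. Qed.
Lemma ginv1 : 1^-1 = 1. Proof. by rewrite -[LHS]gmulr1 gmulV. Qed.
Lemma ginvM x y : (x * y)^-1 = y^-1 * x^-1.
Proof. by rewrite -[RHS](gmulKV (x * y)) gmulAr gmulVK gmulrV gmulr1. Qed.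
Lemma gmulI x y z : x * y = x * z -> y = z.
Proof. by move=> e; rewrite -(gmulKV x y) e gmulKV. Qed.
Lemma gmulIr x y z : y * x = z * x -> y = z.
Proof. by move=> e; rewrite -(gmulr1 y) -(gmulrV x) gmulA e gmulAr gmulrV gmulr1. Qed.
End GroupLaws.

#[global] Hint Rewrite gmul1 gmulr1 gmulV gmulrV gmulAr gmulKV gmulVK ginvK ginv1 ginvM : grp.
Ltac grp := rewrite /conj /comm; autorewrite with grp; try reflexivity.

(** The index of [K] in [H] is at least [N], witnessed by elements in distinct left cosets. *)
Definition separated (T : Type) (L : group_law T) (K H : set T) N := exists g : 'I_N -> T,
  (forall i, H (g i)) /\ forall i j, i <> j -> ~ K (gmul L (ginv L (g i)) (g j)).

Section DefinableGroup.
Context {d : Order.disp_t} {M : orderType d} {S : ominimal_structure M}.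
Variables (n : nat) (T : Type) (G : definable_group S n T).
Local Notation pw := (power_isort (S := S)).
Local Notation LG := (dg_law G).
Local Notation emb := (dg_emb G).
Local Notation "x * y" := (gmul LG x y).
Local Notation "x ^-1" := (ginv LG x).
Local Notation "1" := (gone LG).

Definition dg_prj (v : 'I_n -> M) : T :=
  if pselect (exists x, emb x = v) is left e then projT1 (cid e) else 1.

Lemma dg_embK x : dg_prj (emb x) = x.
Proof.
rewrite /dg_prj; case: pselect => [e|[]]; last by exists x.
exact: (dg_emb_inj (projT2 (cid e))).
Qed.

Lemma dg_prj_surj x : exists2 v, range emb v & dg_prj v = x.
Proof. by exists (emb x); [exists x|apply: dg_embK]. Qed.

Lemma dg_ker : defs S (n + n) [set z : 'I_(n + n) -> M |
  [/\ range emb (z \o lshift n), range emb (z \o @rshift n _) &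
      dg_prj (z \o lshift n) = dg_prj (z \o @rshift n _)]].
Proof.
have dr := dg_def_carrier G.
apply: eq_defs (defsI (defsI (defs_reindex (lshift n) dr) (defs_reindex (@rshift n _) dr))
  (iker_def (pw n))) => z /=; split.
  by move=> [[[x _ xz] [y _ yz]] [_ _ e]]; split; [exists x|exists y|rewrite e].
move=> [[x _ xz] [y _ yz] e]; split; first by split; [exists x|exists y].
by split=> //; rewrite -xz -yz; congr emb; move: e; rewrite -xz -yz !dg_embK.
Qed.

Definition dg_isort : isort S := ISort dg_prj_surj (dg_def_carrier G) dg_ker.

Lemma dg_dset (P : set T) : gdefinable G P <-> @dset _ _ S dg_isort P.
Proof.
split; apply: eq_defs => v; split.
- by move=> [x Px <-]; split; [exists x|rewrite /= dg_embK].
- by move=> [[x _ <-]] /=; rewrite dg_embK => Px; exists x.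
- by move=> [[x _ <-]] /=; rewrite dg_embK => Px; exists x.
- by move=> [x Px <-]; split; [exists x|rewrite /= dg_embK].
Qed.

Lemma dg_mul : @dmap _ _ S (prod_isort dg_isort dg_isort) dg_isort (fun p => p.1 * p.2).
Proof.
apply: eq_defs (dg_def_mul G) => z /=; split.
  move=> [a _ [b _ <-]]; rewrite !catpl !catpr /= !dg_embK.
  by split=> //; split; [split; [exists a|exists b]|exists (a * b)].
move=> [[[[a _ az] [b _ bz]] [c _ cz]]]; rewrite -az -bz -cz /= !dg_embK => e.
exists a => //; exists b => //; rewrite e -(catp_eta z).
congr catp; last by rewrite cz.
by rewrite az bz; apply: (catp_eta (fun i => z (lshift n i))).
Qed.

Lemma dg_unif : unif dg_isort 0.
Proof.
apply: inj_unif; first by exists (emb 1); exists 1.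
by move=> v w [x _ <-] [y _ <-] /=; rewrite !dg_embK => ->.
Qed.

Lemma dg_uniform : uniform dg_isort. Proof. by exists 0; apply: dg_unif. Qed.

Definition eimg (B : T -> Prop) v := exists y, B y /\ emb y = v.

Lemma dg_dge k (P : dg_isort -> Prop) : dge k P <-> dq k (eimg P).
Proof.
rewrite /dge (unif_eq dg_unif) addn0; split; apply: dq_mono => v.
  by move=> [[x _ <-]] /=; rewrite dg_embK => Px; exists x.
by move=> [x [Px <-]]; split; [exists x|rewrite /= dg_embK].
Qed.

Lemma dmap_emb : @dmap _ _ S dg_isort (pw n) emb.
Proof.
have dr := dg_def_carrier G.
apply: eq_defs (defsI (defs_reindex (lshift n) dr) (iker_def (pw n))) => z /=; split.
  by move=> [[x _ xz] [_ _ <-]]; rewrite -xz dg_embK; split=> //; split=> //; exists x.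
by move=> [[[x _ xz] _]]; rewrite -xz dg_embK => e; split; [exists x|split=> //; rewrite -xz].
Qed.

Lemma dset_eimg (X : isort S) (B : X -> T -> Prop) :
  @dset _ _ S (prod_isort X dg_isort) (fun p => B p.1 p.2) ->
  @dset _ _ S (prod_isort X (pw n)) (fun p => eimg (B p.1) p.2).
Proof.
move=> dB; rewrite /eimg; apply: (dset_ex (Y := dg_isort) (X := prod_isort X (pw n))
  (R := fun p y => B p.1 y /\ emb y = p.2)).
apply: dset_and; last first.
  apply: (dset_eq (Y := pw n)); last by dfn.
  by apply: (dmap_comp (f := fun p : prod_isort (prod_isort X (pw n)) dg_isort => p.2) dmap_emb); dfn.
by apply: (dset_comp (f := fun p : prod_isort (prod_isort X (pw n)) dg_isort => (p.1.1, p.2)) dB); dfn.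
Qed.

Lemma dset_eimg1 (B : T -> Prop) : @dset _ _ S dg_isort B -> @dset _ _ S (pw n) (eimg B).
Proof.
move=> dB; apply: (dset_comp (P := fun p => eimg ((fun _ : dg_isort => B) p.1) p.2)
  (f := fun v => (1, v)) (dset_eimg (X := dg_isort) _)).
  exact: dset_comp dB (dmap_snd _ _).
exact: dmap_pair (dmap_const _ _) (dmap_id _).
Qed.

Lemma dmap_mul (X : isort S) (f g : X -> T) : @dmap _ _ S X dg_isort f -> @dmap _ _ S X dg_isort g ->
  @dmap _ _ S X dg_isort (fun x => f x * g x).
Proof. move=> df dg; apply: (dmap_comp (Y := prod_isort dg_isort dg_isort) (f := fun x => (f x, g x)) dg_mul).
exact: dmap_pair. Qed.

Lemma dmap_inv (X : isort S) (f : X -> T) : @dmap _ _ S X dg_isort f ->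
  @dmap _ _ S X dg_isort (fun x => (f x)^-1).
Proof.
move=> df; apply: (dmap_comp (Y := dg_isort) (Z := dg_isort) (g := ginv LG) _ df).
apply: (eq_dset (X := prod_isort dg_isort dg_isort) (P := fun p => p.1 * p.2 = 1)).
  move=> [x y] /=; split=> [e|<-]; last exact: gmulrV.
  by rewrite -[y](gmulKV LG x) e gmulr1.
apply: (dset_eq (X := prod_isort dg_isort dg_isort) (Y := dg_isort)); last exact: dmap_const.
by apply: (dmap_mul (X := prod_isort dg_isort dg_isort)); [exact: dmap_fst|exact: dmap_snd].
Qed.
End DefinableGroup.
Arguments dg_isort : simpl never.

Ltac dgext := match goal with
 | |- @dmap _ _ _ ?X (dg_isort ?G) (fun x => gmul (dg_law ?G) (@?f x) (@?g x)) =>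
     refine (dmap_mul (X := X) (f := f) (g := g) _ _)
 | |- @dmap _ _ _ ?X (dg_isort ?G) (fun x => ginv (dg_law ?G) (@?f x)) => refine (dmap_inv (X := X) (f := f) _)
 | |- @dmap _ _ _ ?X _ (fun x => dg_emb ?G (@?f x)) => refine (dmap_comp (X := X) (Y := dg_isort G) (f := f) (dmap_emb G) _)
 | |- @dset _ _ _ ?X (fun x => clo (eimg ?G (@?B x)) (@?f x)) =>
     refine (dset_clo (X := X) (R := fun x => eimg G (B x)) (f := f) (dset_eimg (X := X) (B := B) _) _)
 end.
Ltac dext ::= first [dgext | dext2].

(** * Definable subgroups of full dimension have bounded index *)

Section BoundedIndex.
Context {d : Order.disp_t} {M : orderType d} {S : ominimal_structure M}.
Variables (n : nat) (T : Type) (G : definable_group S n T).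
Local Notation pw := (power_isort (S := S)).
Local Notation X := (dg_isort G).
Implicit Types (x y a b u w : X) (P Q B : X -> Prop).
Local Notation LG := (dg_law G).
Local Notation emb := (dg_emb G).
Local Notation "x * y" := (gmul LG x y).
Local Notation "x ^-1" := (ginv LG x).
Local Notation "1" := (gone LG).
Local Notation dgeT k P := (@dge _ _ S X k P).

Lemma dge_frontier k (B : X -> Prop) : @dset _ _ S X B ->
  dgeT k (fun x => clo (eimg G B) (emb x) /\ ~ B x) -> dgeT k.+1 B.
Proof.
move=> dB /dg_dge h; apply/dg_dge; apply: frontier_dim; first exact: dset_eimg1.
apply: dq_mono h => v [x [[cl nB] xv]]; subst v; split=> // -[y [By yx]].
by apply: nB; rewrite -(dg_emb_inj yx).
Qed.

Lemma dge_bij k (f g : X -> X) (P : X -> Prop) : cancel f g -> cancel g f ->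
  @dmap _ _ S X X f -> @dset _ _ S X P -> dgeT k P -> dgeT k (fun x => P (f x)).
Proof.
move=> fK gK df dP h; pose R (x y : X) := P y /\ f x = y.
have dR : @dset _ _ S (prod_isort X X) (fun p => R p.1 p.2) by rewrite /R; dfn.
apply: dge_mono (dge_image (dg_uniform G) (dg_uniform G) dR _ _).
- by move=> x [y [Py e]]; rewrite e.
- by move=> x y y' [_ <-] [_ <-].
- by apply: dge_mono h => y Py; exists (g y); rewrite /R gK.
Qed.

Variable H : X -> Prop.
Hypothesis dH : @dset _ _ S X H.
Hypothesis gH : is_subgroup LG H.
Variable e : nat.
Hypothesis He : dgeT e H.
Hypothesis nHe : ~ dgeT e.+1 H.

(** Continuity at [x] of left translation by [a] on [H], for the topology induced by [emb]. *)
Definition cont a x := forall c c', box c c' (emb (a * x)) ->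
  ~ clo (eimg G (fun y => H y /\ ~ box c c' (emb (a * y)))) (emb x).

Lemma dset_cont (Y : isort S) (f g : Y -> X) : @dmap _ _ S Y X f -> @dmap _ _ S Y X g ->
  dset (fun t : Y => cont (f t) (g t)).
Proof.
move=> df dg; rewrite /cont.
apply: (dset_all (Y := pw n)); apply: (dset_all (Y := pw n)); dfn.
Qed.

(** Otherwise one fixed box witnesses discontinuity on a set of dimension [e]. Its points lie in the
    frontier of the part of [H] that [a] moves outside the box, which is too small for that. *)
Lemma generic_cont a : ~ dgeT e (fun x => H x /\ ~ cont a x).
Proof.
move=> h; pose R x (p : prod_isort (pw n) (pw n)) := H x /\ box p.1 p.2 (emb (a * x)) /\
  clo (eimg G (fun y => H y /\ ~ box p.1 p.2 (emb (a * y)))) (emb x).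
have dR : @dset _ _ S (prod_isort X (prod_isort (pw n) (pw n))) (fun p => R p.1 p.2).
  by rewrite /R; dfn.
have [||[c c'] hc] := generic_parameter (k := e) (m := n + n) (dg_uniform G)
  (uniform_prod (uniform_power n) (uniform_power n)) _ dR _.
- exact: leq_addr.
- apply: dge_mono h => x [Hx /existsNP[c /existsNP[c' nc]]].
  have {nc}[bx /contrapT cl] := (not_implyP _ _).1 nc.
  apply: dge_mono (dge_boxes bx) => -[a' b'] /= [ca cb]; split=> //; split=> /=.
    by move=> i; have [_ ?] := ca i; have [? _] := cb i.
  apply: clo_mono cl => v [y [[Hy nb] yv]]; exists y; split=> //; split=> // b; apply: nb.
  move=> i; have [? ?] := b i; have [? _] := ca i; have [_ ?] := cb i.
  by split; apply: lt_trans; eassumption.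
apply: nHe; apply: (dge_mono (P := fun y => H y /\ ~ box c c' (emb (a * y)))); first by move=> y [].
apply: dge_frontier; first by dfn.
by apply: dge_mono hc => x [Hx [bx cl]]; split=> // -[].
Qed.

Lemma cont_comp a b x : H a -> cont a x -> cont b (a * x) -> cont (b * a) x.
Proof.
move=> Ha ca cb c c'; rewrite gmulAr => /cb /nclo[w [w' [bw hw]]].
have := ca w w' bw; apply: contra_not; apply: clo_mono => v [y [[Hy nb] yv]].
exists y; split=> //; split=> // bwy; apply: (hw _ bwy); exists (a * y); split=> //.
by rewrite gmulA; split=> //; apply: gH.2.1.
Qed.

(** Exchange [x] and [a]: of the total [e + e] the variable [a] takes at most [e], so some section
    in [x] has dimension [e]. *)
Lemma generic_fubini (P : X -> X -> Prop) : @dset _ _ S (prod_isort X X) (fun p => P p.1 p.2) ->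
  (forall a, ~ dgeT e (fun x => H x /\ P a x)) ->
  ~ dgeT e (fun x => H x /\ dgeT e (fun a => H a /\ P a x)).
Proof.
move=> dP nP h; pose R (x a : X) := (H x /\ H a) /\ P a x.
have [||i [j [ij h']]] := @dge_swap _ _ _ X X (e + e) R (dg_uniform G) (dg_uniform G).
- by rewrite /R; dfn.
- exists e, e; split=> //; apply: dge_mono h => x [Hx]; apply: dge_mono => a [Ha Pax] //.
have lei : i <= e.
  rewrite leqNgt; apply/negP => /(dge_leq (X := X)) => /(_ _ h') h2; apply: nHe.
  by apply: dge_mono h2 => a /dge_ne[x [[]]].
have [a ha] := dge_ne h'.
have lej : j <= e.
  rewrite leqNgt; apply/negP => /(dge_leq (X := X)) => /(_ _ ha) h2; apply: nHe.
  by apply: dge_mono h2 => x [[]].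
apply: (nP a); apply: (dge_leq (k := j)); first by lia.
by apply: dge_mono ha => x [[]].
Qed.

(** Translation by a generic [a] is continuous at [x], and so is the way back from [a * x]. *)
Definition regular x := H x /\ (~ dgeT e (fun a => H a /\ ~ cont a x) /\
   ~ dgeT e (fun a => H a /\ ~ cont (a^-1) (a * x))).

Lemma dset_regular : @dset _ _ S X regular.
Proof.
have dc := dset_cont.
have d1 : @dset _ _ S (prod_isort X X) (fun p => H p.2 /\ ~ cont p.2 p.1).
  by apply: dset_and; [dfn|apply: dset_not; apply: dset_cont; dfn].
have d2 : @dset _ _ S (prod_isort X X) (fun p => H p.2 /\ ~ cont (p.2^-1) (p.2 * p.1)).
  by apply: dset_and; [dfn|apply: dset_not; apply: dset_cont; dfn].
apply: dset_and => //; apply: dset_and; apply: dset_not.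
  exact: (dset_dge e (R := fun x a => H a /\ ~ cont a x)).
exact: (dset_dge e (R := fun x a => H a /\ ~ cont (a^-1) (a * x))).
Qed.

Lemma generic_regular : ~ dgeT e (fun x => H x /\ ~ regular x).
Proof.
have d1 : @dset _ _ S (prod_isort X X) (fun p => ~ cont p.1 p.2).
  by apply: dset_not; apply: dset_cont; dfn.
have d2 : @dset _ _ S (prod_isort X X) (fun p => ~ cont (p.1^-1) (p.1 * p.2)).
  by apply: dset_not; apply: dset_cont; dfn.
have n1 := generic_fubini d1 generic_cont.
have n2 : ~ dgeT e (fun x => H x /\ dgeT e (fun a => H a /\ (H a /\ ~ cont (a^-1) (a * x)))).
  apply: (generic_fubini (P := fun a x => H a /\ ~ cont (a^-1) (a * x))); first by dfn.
  move=> a h; have [_ [_ [Ha _]]] := dge_ne h.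
  apply: (generic_cont (a := a^-1)).
  have := @dge_bij e (fun x => a^-1 * x) (fun x => a * x) (fun x => H x /\ (H a /\ ~ cont (a^-1) (a * x))) _ _ _ _ h.
  move=> h'; apply: dge_mono (h' _ _ _ _) => [x [Hx [_]]|x|x||].
  - rewrite gmulVK; split=> //; rewrite -(gmulVK LG a x); exact: gH.2.1.
  - exact: gmulVK.
  - exact: gmulKV.
  - by dfn.
  - have dc := d2; apply: dset_and; first by dfn.
    apply: dset_and; first by dfn.
    by apply: (dset_comp (f := fun x : X => (a, x) : prod_isort X X) d2); dfn.
have dd1 : @dset _ _ S X (fun x => H x /\ dgeT e (fun a => H a /\ ~ cont a x)).
  apply: dset_and => //; apply: (dset_dge e (R := fun x a => H a /\ ~ cont a x)).
  by apply: dset_and; [dfn|apply: dset_not; apply: dset_cont; dfn].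
have dd2 : @dset _ _ S X (fun x => H x /\ dgeT e (fun a => H a /\ (H a /\ ~ cont (a^-1) (a * x)))).
  apply: dset_and => //; apply: (dset_dge e (R := fun x a => H a /\ (H a /\ ~ cont (a^-1) (a * x)))).
  by apply: dset_and; [dfn|apply: dset_and; [dfn|apply: dset_not; apply: dset_cont; dfn]].
move=> h; suff /(dge_or dd1 dd2)[//|//] : dgeT e (fun x =>
    (H x /\ dgeT e (fun a => H a /\ ~ cont a x)) \/
    (H x /\ dgeT e (fun a => H a /\ (H a /\ ~ cont (a^-1) (a * x))))).
apply: dge_mono h => x [Hx nr]; apply: contrapT => /not_orP[m1 m2]; apply: nr.
split=> //; split=> [h1|h1]; [apply: m1|apply: m2]; split=> //.
by apply: dge_mono h1 => a [].
Qed.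

Lemma dge_generic (P Q : X -> Prop) : @dset _ _ S X P -> @dset _ _ S X Q ->
  dgeT e P -> ~ dgeT e Q -> dgeT e (fun x => P x /\ ~ Q x).
Proof.
move=> dP dQ hP nQ; have : dgeT e (fun x => Q x \/ (P x /\ ~ Q x)).
  by apply: dge_mono hP => x Px; have [|] := pselect (Q x); [left|right].
by move=> /(dge_or dQ) []; dfn.
Qed.

(** Go through a generic point: translation by [w * u * x^-1] at [x], followed by [w^-1] at [w * u].
    Regularity of [x] and of [u] makes both continuous for generic [w]. *)
Lemma regular_cont x u : regular x -> regular u -> cont (u * x^-1) x.
Proof.
move=> [Hx [nx _]] [Hu [_ nu]]; have [gH1 [gHM gHV]] := gH.
have d1 : @dset _ _ S X (fun a => H a /\ ~ cont a x).
  by apply: dset_and; [dfn|apply: dset_not; apply: dset_cont; dfn].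
have d2 : @dset _ _ S X (fun w => H w /\ ~ cont (w^-1) (w * u)).
  by apply: dset_and; [dfn|apply: dset_not; apply: dset_cont; dfn].
have n1 : ~ dgeT e (fun w => H w /\ ~ cont (w * u * x^-1) x).
  move=> h; apply: nx.
  have := @dge_bij e (fun a => a * x * u^-1) (fun w => w * u * x^-1) (fun w => H w /\ ~ cont (w * u * x^-1) x) _ _ _ _ h.
  move=> h'; apply: dge_mono (h' _ _ _ _) => [a [Ha]|a|a||].
  - have -> : a * x * u^-1 * u * x^-1 = a by grp.
    split=> //; have -> : a = (a * x * u^-1) * (u * x^-1) by grp.
    by apply: (gHM) => //; apply: (gHM) => //; apply: (gHV).
  - by grp.
  - by grp.
  - by dfn.
  - by apply: dset_and; [dfn|apply: dset_not; apply: dset_cont; dfn].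
have d1' : @dset _ _ S X (fun w => H w /\ ~ cont (w * u * x^-1) x).
  by apply: dset_and; [dfn|apply: dset_not; apply: dset_cont; dfn].
have [w [[Hw m1] m2]] := dge_ne (dge_generic (dset_and dH (dset_not d1')) d2 (dge_generic dH d1' He n1) nu).
have -> : u * x^-1 = w^-1 * (w * u * x^-1) by grp.
apply: cont_comp.
- by apply: (gHM); [apply: (gHM)|apply: (gHV)].
- by apply: contrapT => nc; apply: m1.
- have -> : w * u * x^-1 * x = w * u by grp.
  by apply: contrapT => nc; apply: m2.
Qed.

(* Up to a set of smaller dimension, [H] consists of regular points, at which *)
(* the cosets of [K] are relatively open; hence each of the finitely many     *)
(* definably connected pieces of the regular set lies in one coset of [K].    *)
Lemma separated_bound : exists N, forall K : set X, @dset _ _ S X K -> is_subgroup LG K ->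
  K `<=` H -> dgeT e K -> ~ separated LG K H N.
Proof.
have dreg := dset_regular.
have [|N [C [cC CE EC]]] := cc_all (S := S) (n := n) (A := eimg G regular).
  exact: dset_eimg1.
exists N.+1 => K dK gK KH hK [g [Hg sepg]]; have [gK1 [gKM gKV]] := gK; have [gH1 [gHM gHV]] := gH.
have dnr : @dset _ _ S X (fun x => H x /\ ~ regular x) by dfn.
have reg (P : X -> Prop) : @dset _ _ S X P -> dgeT e P -> (forall x, P x -> H x) ->
    dgeT e (fun x => P x /\ regular x).
  move=> dP hP PH; apply: dge_mono (dge_generic dP dnr hP generic_regular) => x [Px nr].
  by split=> //; apply: contrapT => nrx; apply: nr; split=> //; apply: PH.
(* The frontier of the complement of [K] in [H] is small, so a generic point of [K] is interior to
   [K] relative to [H]. Continuity of translations carries this to every regular point. *)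
have [u [[Ku ru] iu]] : exists u, (K u /\ regular u) /\ ~ clo (eimg G (fun y => H y /\ ~ K y)) (emb u).
  have dcl : @dset _ _ S X (fun x => clo (eimg G (fun y => H y /\ ~ K y)) (emb x) /\ ~ (H x /\ ~ K x)) by dfn.
  have ncl : ~ dgeT e (fun x => clo (eimg G (fun y => H y /\ ~ K y)) (emb x) /\ ~ (H x /\ ~ K x)).
    move=> /dge_frontier h; apply: nHe; apply: dge_mono (h _) => [y []//|]; by dfn.
  have [u [[Ku ru] nu]] := dge_ne (dge_generic (dset_and dK dreg) dcl (reg K dK hK KH) ncl).
  by exists u; split=> // cl; apply: nu; split=> // -[].
have open x : regular x -> ~ clo (eimg G (fun y => H y /\ ~ K (x^-1 * y))) (emb x).
  move=> rx; have [w [w' [bw hw]]] := nclo iu.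
  have c := regular_cont rx ru; have := c w w'; rewrite (_ : u * x^-1 * x = u); last by grp.
  move=> /(_ bw); apply: contra_not; apply: clo_mono => v [y [[Hy nK] yv]]; exists y; split=> //.
  split=> // by_; apply: (hw _ by_); exists (u * x^-1 * y); split=> //; split.
    by apply: (gHM) => //; apply: (gHM); [apply: KH|apply: (gHV); case: rx].
  move=> Ku2; apply: nK; rewrite (_ : x^-1 * y = u^-1 * (u * x^-1 * y)); last by grp.
  by apply: (gKM) => //; apply: (gKV).
have /choice[x xP] : forall i, exists x, K ((g i)^-1 * x) /\ regular x.
  move=> i; have [|||x [Kx rx]] := dge_ne (reg (fun x => K ((g i)^-1 * x)) _ _ _).
  - by dfn.
  - apply: (@dge_bij e (fun x => (g i)^-1 * x) (fun x => g i * x)) => //; last by dfn.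
      by move=> y; apply: gmulVK.
    by move=> y; apply: gmulKV.
  - move=> y Ky; rewrite -(gmulVK LG (g i) y); apply: (gHM) => //; exact: KH.
  - by exists x.
have /choice[f fP] : forall i, exists j, C j (emb (x i)).
  by move=> i; apply: EC; exists (x i); split=> //; case: (xP i).
have [i [j [ij fij]]] : exists i j, i <> j /\ f i = f j.
  apply: contrapT => nex; have injf : injective f.
    by move=> i j e'; apply: contrapT => ne; apply: nex; exists i, j.
  by have := leq_card f injf; rewrite !card_ord ltnn.
pose U := eimg G (fun y => K ((g i)^-1 * y)).
have dU : @dset _ _ S (pw n) U.
  by apply: dset_eimg1; dfn.
have key z y : regular z -> H y -> K (z^-1 * y) -> K ((g i)^-1 * z) <-> K ((g i)^-1 * y).
  move=> rz Hy Kzy; split=> h.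
    by rewrite (_ : (g i)^-1 * y = ((g i)^-1 * z) * (z^-1 * y)); [apply: (gKM)|grp].
  have -> : (g i)^-1 * z = ((g i)^-1 * y) * (z^-1 * y)^-1 by grp.
  by apply: (gKM) => //; apply: (gKV).
have UE y : U (emb y) <-> K ((g i)^-1 * y).
  by split=> [[y' [Ky' e']]|Ky]; [rewrite -(dg_emb_inj e')|exists y].
have lU : locconst (C (f i)) U.
  move=> v /CE[z [rz zv]]; subst v; have [a [b [bz hz]]] := nclo (open z rz); exists a, b; split=> //.
  move=> v /CE[y [ry yv]] by_; subst v; rewrite !UE; apply: iff_sym; apply: key => //; first by case: ry.
  by apply: contrapT => nK; apply: (hz _ by_); exists y; split=> //; split=> //; case: ry.
have [_ /(_ U dU lU (emb (x i)) (emb (x j)) (fP i))] := cC (f i).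
rewrite fij => /(_ (fP j)); rewrite !UE => /(_ (xP i).1) Kij.
apply: (sepg i j ij); have -> : (g i)^-1 * g j = ((g i)^-1 * x j) * ((g j)^-1 * x j)^-1 by grp.
by apply: (gKM) => //; apply: (gKV); case: (xP j).
Qed.
End BoundedIndex.

(** * Groups on interpretable sorts *)

Section NumericalDimension.
Context {d : Order.disp_t} {M : orderType d} {S : ominimal_structure M}.
Implicit Types X Y : isort S.

(** Also 0 for the empty set, which is why inhabitants are asked for below. *)
Definition gd X (A : X -> Prop) : nat := \max_(k < (iar X).+1 | `[< dge k A >]) k.

Lemma gdP X (A : X -> Prop) k : uniform X -> (exists x, A x) -> dge k A <-> k <= gd A.
Proof.
move=> uX [x Ax]; split=> [hk|].
  have ltk : k < (iar X).+1 by rewrite ltnS; apply: leq_trans (dge_bound hk); rewrite leq_addr.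
  have := @leq_bigmax_cond _ (fun k : 'I_(iar X).+1 => `[< dge k A >]) (fun k => k : nat) (Ordinal ltk).
  by apply; apply/asboolP.
suff h : dge (gd A) A by move=> /dge_leq; apply.
rewrite /gd; elim/big_ind: _ => [|i j hi hj|i /asboolP//]; first exact: dge_fibre Ax.
by rewrite /maxn; case: ifP.
Qed.

Lemma gd_dge X (A : X -> Prop) : uniform X -> (exists x, A x) -> dge (gd A) A.
Proof. by move=> uX nA; apply/gdP. Qed.

Lemma gd_eq X (A B : X -> Prop) : (forall x, A x <-> B x) -> gd A = gd B.
Proof. by move=> AB; congr gd; apply/funext => x; apply/propext. Qed.

Lemma gd_sub X (A B : X -> Prop) : uniform X -> (exists x, A x) -> (forall x, A x -> B x) -> gd A <= gd B.
Proof.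
move=> uX nA AB; have [x Ax] := nA; apply/gdP => //; first by exists x; apply: AB.
by apply: dge_mono AB _; apply: gd_dge.
Qed.

Lemma gd_singleton X (A : X -> Prop) : uniform X -> (forall x y, A x -> A y -> x = y) -> gd A = 0.
Proof.
move=> uX A1; have [[x Ax]|nA] := pselect (exists x, A x).
  by apply: (dge_sub1 uX A1); apply: gd_dge => //; exists x.
apply/eqP; rewrite -leqn0; apply/bigmax_leqP => k /asboolP /dge_ne h; case: nA; exact: h.
Qed.

Section Fibrations.
Variables (X Y : isort S) (uX : uniform X) (uY : uniform Y) (f : X -> Y) (A : X -> Prop).
Hypotheses (df : dmap f) (dA : dset A).
Let R x y := A x /\ f x = y.
Let dR : @dset _ _ S (prod_isort X Y) (fun p => R p.1 p.2). Proof. by rewrite /R; dfn. Qed.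
Let fR x y y' : R x y -> R x y' -> y = y'. Proof. by move=> [_ <-] [_ <-]. Qed.

Definition fimg y := exists x, A x /\ f x = y.

Lemma gd_fib_le r : (exists x, A x) -> (forall x, A x -> gd (fun z => A z /\ f z = f x) <= r) ->
  gd A <= gd fimg + r.
Proof.
move=> nA hr; have hA : dge (gd A) (fun x => exists y, R x y).
  by apply: dge_mono (gd_dge uX nA) => x Ax; exists (f x).
have [i [j [<- h]]] := dge_fibres_inv uX uY dR hA; rewrite addnC leq_add //.
  have [y /dge_ne[x [Ax xy]]] := dge_ne h; apply/gdP => //; first by exists y, x.
  by apply: dge_mono h => z /dge_ne[t]; exists t.
have [y hy] := dge_ne h; have [x [Ax xy]] := dge_ne hy; apply: leq_trans (hr x Ax).
by apply/gdP => //; [exists x|rewrite xy].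
Qed.

Lemma gd_fib_ge r : (exists x, A x) -> (forall x, A x -> r <= gd (fun z => A z /\ f z = f x)) ->
  gd fimg + r <= gd A.
Proof.
move=> nA hr; have [x0 Ax0] := nA; apply/gdP => //.
have := dge_fibres uX uY dR fR (i := r) (j := gd fimg); rewrite addnC => h.
apply: dge_mono (h _); first by move=> x [y []].
have : dge (gd fimg) fimg by apply: gd_dge => //; exists (f x0), x0.
apply: dge_mono => y [x [Ax xy]]; subst y.
by apply/gdP => //; [exists x|apply: hr].
Qed.

Lemma gd_fib r : (exists x, A x) -> (forall x, A x -> gd (fun z => A z /\ f z = f x) = r) ->
  gd A = gd fimg + r.
Proof.
move=> nA hr; apply/eqP; rewrite eqn_leq gd_fib_le ?gd_fib_ge // => x Ax; by rewrite hr.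
Qed.

Lemma gd_inj : (forall x x', A x -> A x' -> f x = f x' -> x = x') -> (exists x, A x) -> gd fimg = gd A.
Proof.
move=> inj nA; rewrite (gd_fib (r := 0)) ?addn0 // => x Ax.
by apply: gd_singleton => // y z [Ay ey] [Az ez]; apply: inj => //; rewrite ey.
Qed.
End Fibrations.

Lemma gd_prod X Y (A : X -> Prop) (B : Y -> Prop) : uniform X -> uniform Y -> dset A -> dset B ->
  (exists x, A x) -> (exists y, B y) ->
  @gd (prod_isort X Y) (fun p => A p.1 /\ B p.2) = gd A + gd B.
Proof.
move=> uX uY dA dB [x Ax] [y By].
have dAB : @dset _ _ S (prod_isort X Y) (fun p => A p.1 /\ B p.2) by dfn.
rewrite (gd_fib (uniform_prod uX uY) uX (f := fst) (dmap_fst _ _) dAB (r := gd B)).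
- congr (_ + _); apply: gd_eq => x'; split=> [[[x1 y1] [[Ax1 _] <-]]//|Ax'].
  by exists (x', y).
- by exists (x, y).
move=> [x1 y1] [Ax1 By1].
have dp : @dmap _ _ S Y (prod_isort X Y) (fun y => (x1, y)) by dfn.
rewrite -(gd_inj uY (uniform_prod uX uY) dp dB).
- apply: gd_eq => -[x2 y2] /=; split=> [[[_ By2] ->]|[y3 [By3 [e1 e2]]]]; first by exists y2.
  by subst.
- by move=> ? ? _ _ [].
- by exists y.
Qed.

Lemma dge_bigor X k N (A : 'I_N -> X -> Prop) : (forall i, dset (A i)) ->
  dge k (fun x => exists i, A i x) -> exists i, dge k (A i).
Proof.
elim: N A => [|N IH] A dA; first by move=> /dge_ne[x [[]]].
have dA' : dset (fun x => exists i, A (lift ord0 i) x).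
  suff : dset (fun x => ~ forall i, ~ A (lift ord0 i) x).
    apply: eq_dset => x; split=> [h|[i Ai] /(_ i)//].
    by apply: contrapT => nex; apply: h => i Ai; apply: nex; exists i.
  by apply/dset_not/dset_forall_fin => i; apply/dset_not/dA.
move=> h; have : dge k (fun x => A ord0 x \/ exists i, A (lift ord0 i) x).
  by apply: dge_mono h => x [i]; case: (unliftP ord0 i) => [j|] ->; [right; exists j|left].
move=> /(dge_or (dA ord0) dA') [h0|/IH[//|i hi]]; first by exists ord0.
by exists (lift ord0 i).
Qed.
End NumericalDimension.

(* [isep] bounds the index in [H] of its definable subgroups of full          *)
(* dimension. It is kept as a field because it passes to subgroups and        *)
(* quotients, where it replaces the descending chain condition.               *)
Record igroup (d : Order.disp_t) (M : orderType d) (S : ominimal_structure M) := IGroup {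
  ig :> isort S;
  ilaw : group_law ig;
  imul : @dmap _ _ S (prod_isort ig ig) ig (fun p => gmul ilaw p.1 p.2);
  iunif : uniform ig;
  isep : forall H : set ig, dset H -> is_subgroup ilaw H -> exists N, forall K : set ig, dset K ->
    is_subgroup ilaw K -> K `<=` H -> gd K = gd H -> ~ separated ilaw K H N
}.

Section IGroupDefinability.
Context {d : Order.disp_t} {M : orderType d} {S : ominimal_structure M}.
Variable G : igroup S.

Lemma dmap_gmul (X : isort S) (f g : X -> G) : dmap f -> dmap g ->
  dmap (fun x => gmul (ilaw G) (f x) (g x)).
Proof.
move=> df dg; exact: (dmap_comp (f := fun x => (f x, g x)) (imul G) (dmap_pair df dg)).
Qed.

Lemma dmap_ginv (X : isort S) (f : X -> G) : dmap f -> dmap (fun x => ginv (ilaw G) (f x)).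
Proof.
move=> df; refine (dmap_comp (f := f) _ df).
apply: (eq_dset (X := prod_isort G G) (P := fun p => gmul (ilaw G) p.1 p.2 = gone (ilaw G))).
  move=> [x y] /=; split=> [e|<-]; last exact: gmulrV.
  by rewrite -[y](gmulKV (ilaw G) x) e gmulr1.
by apply: dset_eq; [exact: imul|exact: dmap_const].
Qed.
End IGroupDefinability.

Ltac gext := match goal with
 | |- @dset _ _ _ ?X (setI ?A ?B) => refine (@dset_and _ _ _ X A B _ _)
 | |- @dmap _ _ _ ?X _ (fun x => gmul (ilaw ?G) (@?f x) (@?g x)) =>
     refine (dmap_gmul (X := X) (f := f) (g := g) _ _)
 | |- @dmap _ _ _ ?X _ (fun x => ginv (ilaw ?G) (@?f x)) => refine (dmap_ginv (X := X) (f := f) _)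
 end.
Ltac dext ::= first [gext | dgext | dext2].

(** * Normalizers, commutators and products in abstract groups *)

Section AbstractGroups.
Variables (T : Type) (L : group_law T).
Local Notation "x * y" := (gmul L x y).
Local Notation "x ^-1" := (ginv L x).
Local Notation "1" := (gone L).
Local Notation sg := (is_subgroup L).
Implicit Types (A B H K R : set T) (x y g h : T).

(** The normalizer ([normE]) as a pointwise equivalence, which is visibly definable and suits
    rewriting. *)
Definition norm R g := forall y, R (g * y * g^-1) <-> R y.

Lemma conjsE R g y : conjs L R g y <-> R (g * y * g^-1).
Proof.
split=> [[x Rx <-]|Ry]; first by rewrite (_ : _ * _ = x) //; grp.
by exists (g * y * g^-1) => //; grp.
Qed.

Lemma set_ext A B : (forall x, A x <-> B x) -> A = B.
Proof. by move=> AB; apply/funext => x; apply/propext. Qed.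

Lemma normE R g : normalizer L R g <-> norm R g.
Proof.
split=> [e y|nR]; first by rewrite -conjsE e.
by apply: set_ext => y; rewrite conjsE.
Qed.

Lemma conjs_mul R g h : conjs L (conjs L R g) h = conjs L R (g * h).
Proof. by apply: set_ext => y; rewrite !conjsE; grp. Qed.

Lemma conjs_one R : conjs L R 1 = R.
Proof. by apply: set_ext => y; rewrite conjsE; grp. Qed.

Lemma norm_conjs R g : norm R g <-> conjs L R g = R.
Proof. by rewrite -normE. Qed.

Lemma norm_conjsE R x y : norm (conjs L R x) y <-> norm R (x * y * x^-1).
Proof.
split=> n z.
  have := n (x^-1 * z * x); rewrite !conjsE.
  by rewrite (_ : x * (x^-1 * z * x) * x^-1 = z) => [<-|]; grp.
have := n (x * z * x^-1); rewrite !conjsE => <-.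
by rewrite (_ : x * (y * z * y^-1) * x^-1 = x * y * x^-1 * (x * z * x^-1) * (x * y * x^-1)^-1) //; grp.
Qed.

Lemma sg_norm R : sg (norm R).
Proof.
split; [|split]; first by move=> y; grp.
  by move=> x y nx ny z; rewrite -(ny z) -(nx (y * z * y^-1)); grp.
by move=> x nx z; rewrite -(nx (x^-1 * z * x^-1^-1)); grp.
Qed.

Lemma sg_T : sg setT. Proof. by []. Qed.
Lemma sg_1 : sg [set 1].
Proof. by split=> //; split=> [x y -> ->|x ->] /=; grp. Qed.

Lemma sg_I A B : sg A -> sg B -> sg (A `&` B).
Proof.
move=> [A1 [AM AV]] [B1 [BM BV]]; split=> //; split=> [x y [? ?] [? ?]|x [? ?]].
  by split; [apply: AM|apply: BM].
by split; [apply: AV|apply: BV].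
Qed.

Lemma sg_conjs R g : sg R -> sg (conjs L R g).
Proof.
move=> [R1 [RM RV]]; split; [|split].
- by apply/conjsE; grp.
- move=> x y /conjsE Rx /conjsE Ry; apply/conjsE.
  by rewrite (_ : _ * _ = (g * x * g^-1) * (g * y * g^-1)); [apply: RM|grp].
- move=> x /conjsE Rx; apply/conjsE.
  by rewrite (_ : _ * _ = (g * x * g^-1)^-1); [apply: RV|grp].
Qed.

Lemma norm_self R g : sg R -> R g -> norm R g.
Proof.
move=> [R1 [RM RV]] Rg y; split=> [h|Ry]; last by apply: (RM) => //; [apply: RM|apply: RV].
rewrite (_ : y = g^-1 * (g * y * g^-1) * g); last by grp.
by apply: (RM) => //; apply: RM => //; apply: RV.
Qed.

Lemma sg_gen A : sg (gen L A).
Proof.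
split; [by move=> H [? ?]|split].
  by move=> x y hx hy H gH AH; apply: gH.2.1; [apply: hx|apply: hy].
by move=> x hx H gH AH; apply: gH.2.2; apply: hx.
Qed.

Lemma sub_gen A : A `<=` gen L A. Proof. by move=> x Ax H _; apply. Qed.

Lemma gen_sub A H : sg H -> A `<=` H -> gen L A `<=` H.
Proof. by move=> gH AH x; apply. Qed.

Lemma commg_sub A B H : sg H -> (forall x y, A x -> B y -> H (comm L x y)) -> commg L A B `<=` H.
Proof. by move=> gH h; apply: gen_sub => // _ [x Ax [y By <-]]; apply: h. Qed.

Lemma commg_in A B x y : A x -> B y -> commg L A B (comm L x y).
Proof. by move=> Ax By; apply: sub_gen; exists x => //; exists y. Qed.

Lemma commg_mono A B A' B' : A `<=` A' -> B `<=` B' -> commg L A B `<=` commg L A' B'.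
Proof.
move=> AA' BB'; apply: commg_sub; first exact: sg_gen.
by move=> x y /AA' Ax /BB' By; apply: commg_in.
Qed.

Lemma sg_lcs H i : sg H -> sg (lcs L H i).
Proof. by case: i => [//|i] _; apply: sg_gen. Qed.

Lemma sg_derived H i : sg H -> sg (derived L H i).
Proof. by case: i => [//|i] _; apply: sg_gen. Qed.

Lemma comm_in H x y : sg H -> H x -> H y -> H (comm L x y).
Proof.
move=> [H1 [HM HV]] Hx Hy; rewrite /comm.
by apply: (HM) => //; apply: (HM) => //; apply: (HM); apply: (HV).
Qed.

Lemma lcs_sub H i : sg H -> lcs L H i `<=` H.
Proof.
move=> gH; elim: i => [//|i IH] /=; apply: commg_sub => // x y /IH Hx Hy; exact: comm_in.
Qed.

Lemma lcs_mono H K i : H `<=` K -> lcs L H i `<=` lcs L K i.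
Proof. by move=> HK; elim: i => [//|i IH]; apply: commg_mono. Qed.

Lemma derived_mono H K i : H `<=` K -> derived L H i `<=` derived L K i.
Proof. by move=> HK; elim: i => [//|i IH]; apply: commg_mono. Qed.

Lemma norm_commg A B g : norm A g -> norm B g -> norm (commg L A B) g.
Proof.
have sub h : norm A h -> norm B h -> commg L A B `<=` conjs L (commg L A B) h.
  move=> nA nB; apply: commg_sub; first exact/sg_conjs/sg_gen.
  move=> x y Ax By; apply/conjsE.
  have -> : h * comm L x y * h^-1 = comm L (h * x * h^-1) (h * y * h^-1) by grp.
  by apply: commg_in; [apply/nA|apply/nB].
move=> nA nB y; split=> [h|/(sub g nA nB)/conjsE//].
have /(sub _ ((sg_norm A).2.2 _ nA) ((sg_norm B).2.2 _ nB))/conjsE := h.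
by rewrite (_ : _ * _ = y) //; grp.
Qed.

Lemma norm_derived H g i : norm H g -> norm (derived L H i) g.
Proof. by move=> nH; elim: i => [//|i IH]; apply: norm_commg. Qed.

Definition prodg A B : set T := fun z => exists a b, A a /\ B b /\ z = a * b.

Lemma sg_prodg A B : sg A -> sg B -> (forall b, B b -> norm A b) -> sg (prodg A B).
Proof.
move=> [A1 [AM AV]] [B1 [BM BV]] nA; split; [|split].
- by exists 1, 1; split=> //; split=> //; grp.
- move=> _ _ [a [b [Aa [Bb ->]]]] [a' [b' [Aa' [Bb' ->]]]].
  exists (a * (b * a' * b^-1)), (b * b'); split; [|split].
  + by apply: (AM) => //; apply/(nA b Bb).
  + exact: BM.
  + by grp.
- move=> _ [a [b [Aa [Bb ->]]]]; exists (b^-1 * a^-1 * b^-1^-1), b^-1; split; [|split].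
  + by apply/(nA _ (BV _ Bb)); apply: AV.
  + exact: BV.
  + by grp.
Qed.

Lemma prodg_l A B : sg B -> A `<=` prodg A B.
Proof. by move=> [B1 _] a Aa; exists a, 1; split=> //; split=> //; grp. Qed.
Lemma prodg_r A B : sg A -> B `<=` prodg A B.
Proof. by move=> [A1 _] b Bb; exists 1, b; split=> //; split=> //; grp. Qed.

Lemma prodg_sub A B H : sg H -> A `<=` H -> B `<=` H -> prodg A B `<=` H.
Proof. by move=> [_ [HM _]] AH BH _ [a [b [/AH Ha [/BH Hb ->]]]]; apply: HM. Qed.

End AbstractGroups.

Section Morphisms.
Variables (T T' : Type) (L : group_law T) (L' : group_law T') (f : T -> T').
Hypothesis fM : forall x y, f (gmul L x y) = gmul L' (f x) (f y).

Lemma hom1 : f (gone L) = gone L'.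
Proof. by apply: (@gmulI _ L' (f (gone L))); rewrite -fM gmul1 gmulr1. Qed.
Lemma homV x : f (ginv L x) = ginv L' (f x).
Proof. by apply: (@gmulI _ L' (f x)); rewrite -fM !gmulrV hom1. Qed.
Lemma hom_comm x y : f (comm L x y) = comm L' (f x) (f y).
Proof. by rewrite /comm !fM !homV. Qed.
Lemma sg_img (A : set T) : is_subgroup L A -> is_subgroup L' (f @` A).
Proof.
move=> [A1 [AM AV]]; split; [|split].
- by exists (gone L) => //; apply: hom1.
- by move=> _ _ [x Ax <-] [y Ay <-]; exists (gmul L x y); [apply: AM|apply: fM].
- by move=> _ [x Ax <-]; exists (ginv L x); [apply: AV|apply: homV].
Qed.

Lemma sg_preim (B : set T') : is_subgroup L' B -> is_subgroup L (fun x => B (f x)).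
Proof.
move=> [B1 [BM BV]]; split; [|split]; first by rewrite hom1.
  by move=> x y Bx By; rewrite fM; apply: BM.
by move=> x Bx; rewrite homV; apply: BV.
Qed.

Lemma commg_img (A B : set T) : commg L' (f @` A) (f @` B) = f @` commg L A B.
Proof.
rewrite eqEsubset; split.
  apply: commg_sub; first exact/sg_img/sg_gen.
  move=> _ _ [x Ax <-] [y By <-]; exists (comm L x y); last exact: hom_comm.
  exact: commg_in.
move=> _ [z hz <-]; have : commg L A B `<=` (fun x => commg L' (f @` A) (f @` B) (f x)).
  apply: commg_sub; first exact/sg_preim/sg_gen.
  by move=> x y Ax By; rewrite hom_comm; apply: commg_in; [exists x|exists y].
by apply.
Qed.

Lemma lcs_img (A : set T) i : lcs L' (f @` A) i = f @` lcs L A i.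
Proof. by elim: i => [//|i IH] /=; rewrite IH commg_img. Qed.

Lemma derived_img (A : set T) i : derived L' (f @` A) i = f @` derived L A i.
Proof. by elim: i => [//|i IH] /=; rewrite IH commg_img. Qed.
End Morphisms.

(** * Index, connectedness and hulls of subgroups *)

Section SubgroupDimension.
Context {d : Order.disp_t} {M : orderType d} {S : ominimal_structure M}.
Variable G : igroup S.
Local Notation L := (ilaw G).
Local Notation "x * y" := (gmul L x y).
Local Notation "x ^-1" := (ginv L x).
Local Notation "1" := (gone L).
Local Notation sg := (is_subgroup L).
Implicit Types (A B H K R : set G) (x y g h : G).
Let uG := iunif G.

Lemma sg_ne H : sg H -> exists x, H x. Proof. by case=> H1 _; exists 1. Qed.

Lemma dset_conjs R g : dset R -> dset (conjs L R g).
Proof.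
move=> dR; apply: (eq_dset (P := fun y => R (g * y * g^-1))); last by dfn.
by move=> y; rewrite conjsE.
Qed.

Lemma dset_norm R : dset R -> dset (norm L R).
Proof. by move=> dR; rewrite /norm; dfn. Qed.

Lemma dset_prodg A B : dset A -> dset B -> dset (prodg L A B).
Proof. by move=> dA dB; rewrite /prodg; dfn. Qed.

Lemma gd_bij (f f' : G -> G) A : dmap f -> cancel f f' -> cancel f' f -> dset A -> (exists x, A x) ->
  gd (fun y => A (f' y)) = gd A.
Proof.
move=> df fK f'K dA nA; rewrite -(gd_inj uG uG df dA _ nA); last by move=> x y _ _; apply: (can_inj fK).
apply: gd_eq => y; split=> [Ay|[x [Ax <-]]]; last by rewrite fK.
by exists (f' y).
Qed.

Lemma gd_conjs R g : dset R -> (exists x, R x) -> gd (conjs L R g) = gd R.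
Proof.
move=> dR nR; rewrite -(@gd_bij (fun x => g^-1 * x * g) (fun y => g * y * g^-1) R) //.
- by apply: gd_eq => y; rewrite conjsE.
- by dfn.
- by move=> x; grp.
- by move=> x; grp.
Qed.

Lemma gd_lcoset R g : dset R -> (exists x, R x) -> gd (fun x => R (g^-1 * x)) = gd R.
Proof.
move=> dR nR; apply: (@gd_bij (fun x => g * x)) => //; first by dfn.
  by move=> x; grp.
by move=> x; grp.
Qed.

Lemma gd_rcoset R g : dset R -> (exists x, R x) -> gd (fun x => R (x * g^-1)) = gd R.
Proof.
move=> dR nR; apply: (@gd_bij (fun x => x * g)) => //; first by dfn.
  by move=> x; grp.
by move=> x; grp.
Qed.

(** If finitely many cosets of [K] cover [H], one of them has the dimension of [H]. Conversely
    [isep] bounds the separated families, and a maximal one represents all cosets. *)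
Lemma finite_index_gd K H : dset K -> dset H -> sg K -> sg H -> K `<=` H ->
  finite_index L K H <-> gd K = gd H.
Proof.
move=> dK dH gK gH KH; split=> [[_ [_ [N [g HK]]]]|e].
  apply/eqP; rewrite eqn_leq gd_sub //=; last exact: sg_ne.
  have dKi i : dset (fun x => K ((g i)^-1 * x)) by dfn.
  have [|i hi] := dge_bigor (k := gd H) dKi.
    by apply: dge_mono (gd_dge uG (sg_ne gH)) => x /HK.
  have ne : exists x, K ((g i)^-1 * x) by apply: dge_ne hi.
  by rewrite -(gd_lcoset (g i) dK (sg_ne gK)); apply/gdP.
split=> //; split=> //; have [N hN] := isep dH gH; have {hN}nsep := hN K dK gK KH e.
have [m [sm nsm]] : exists m, separated L K H m /\ ~ separated L K H m.+1.
  elim: N nsep => [|N IH] nsep; first by case: nsep; exists (fun=> 1); split=> [[]|[]].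
  by have [sN|/IH//] := pselect (separated L K H N); exists N.
case: sm => g [Hg sg']; exists m, g => x Hx; apply: contrapT => nx; apply: nsm.
have [K1 [KM KV]] := gK.
exists (fun i => if unlift ord_max i is Some j then g j else x); split.
  by move=> i; case: unliftP.
move=> i j; case: (unliftP ord_max i) => [i'|] ->; case: (unliftP ord_max j) => [j'|] -> // ne.
- by apply: sg' => e'; apply: ne; rewrite e'.
- by move=> Kx; apply: nx; exists i'.
- move=> Kx; apply: nx; exists j'; rewrite (_ : _ * _ = (x^-1 * g j')^-1); last by grp.
  exact: KV.
Qed.

(** The coset of [g ord0] splits: [g ord0 * x] lies in the same coset of [K] but in another one of
    [K']. *)
Lemma separated_proper K K' H m x : sg K -> sg K' -> K' `<=` K -> K `<=` H -> sg H ->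
  K x -> ~ K' x -> 0 < m -> separated L K H m -> separated L K' H m.+1.
Proof.
move=> [K1 [KM KV]] gK' K'K KH [H1 [HM HV]] Kx nK'x; case: m => // m _ [g [Hg sg']].
exists (fun i => if unlift ord_max i is Some j then g j else g ord0 * x); split.
  move=> i; case: unliftP => [j _|_] //; apply: HM => //; exact: KH.
move=> i j; case: (unliftP ord_max i) => [i'|] ->; case: (unliftP ord_max j) => [j'|] -> // ne.
- by move=> /K'K; apply: sg' => e'; apply: ne; rewrite e'.
- move=> K'h; have [e|ne'] := eqVneq i' ord0.
    by apply: nK'x; move: K'h; rewrite e (_ : _ * _ = x) //; grp.
  apply: (sg' i' ord0); first exact/eqP.
  rewrite (_ : _ * _ = ((g i')^-1 * (g ord0 * x)) * x^-1); last by grp.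
  by apply: (KM); [apply: K'K|apply: KV].
- move=> K'h; have [e|ne'] := eqVneq j' ord0.
    apply: nK'x; move: K'h; rewrite e (_ : _ * _ = x^-1); last by grp.
    by move=> /gK'.2.2; rewrite ginvK.
  apply: (sg' ord0 j'); first by apply/eqP; rewrite eq_sym.
  rewrite (_ : _ * _ = x * ((g ord0 * x)^-1 * g j')); last by grp.
  by apply: (KM) => //; apply: K'K.
Qed.

(* A family closed under intersection has a least element: minimize the       *)
(* dimension, then maximize the number of cosets.                             *)
Lemma least_subgroup (Pi : set G -> Prop) K0 : Pi K0 ->
  (forall K, Pi K -> dset K /\ sg K) -> (forall K K', Pi K -> Pi K' -> Pi (K `&` K')) ->
  exists2 D, Pi D & forall K, Pi K -> D `<=` K.
Proof.
move=> P0 Psg PI.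
have [H PH Hmin] : exists2 H, Pi H & forall K, Pi K -> gd H <= gd K.
  have : exists m K, Pi K /\ gd K < m by exists (gd K0).+1, K0.
  move=> [m]; elim: m => [|m IH] [K [PK lt]] //.
  have [[K' [PK' lt']]|nK] := pselect (exists K', Pi K' /\ gd K' < gd K).
    by apply: IH; exists K'; split=> //; apply: leq_trans lt' _.
  by exists K => // K' PK'; rewrite leqNgt; apply/negP => h; apply: nK; exists K'.
have [dH gH] := Psg H PH; have [N hN] := isep dH gH.
pose good K := Pi K /\ K `<=` H.
have gdgood K : good K -> gd K = gd H.
  move=> [PK KH]; have [dK gK] := Psg K PK; apply/eqP; rewrite eqn_leq Hmin // andbT.
  by apply: gd_sub => //; apply: sg_ne.
have sep_le K k m : k <= m -> separated L K H m -> separated L K H k.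
  move=> km [g [Hg sg']]; exists (fun i => g (widen_ord km i)); split=> // i j ne.
  by apply: sg' => e; apply: ne; apply: val_inj; have := congr1 val e.
have sep_lt m : (exists2 K, good K & separated L K H m) -> m <= N.
  move=> [K gK' sK]; have [PK KH] := gK'; have [dK gK] := Psg K PK.
  by rewrite leqNgt; apply/negP => /ltnW h; apply: (hN K) => //; [apply: gdgood|apply: sep_le sK].
have ex1 : exists m, `[< exists2 K, good K & separated L K H m.+1 >].
  exists 0; apply/asboolP; exists H; first by split.
  exists (fun=> 1); split=> [_|i j]; first by case: gH.
  by rewrite !ord1.
have [|m /asboolP[K gdK sK] mmax] := @ex_maxnP _ N ex1.
  by move=> m /asboolP /sep_lt /ltnW.
have [PK KH] := gdK; have [dK gK] := Psg K PK.
exists K => // K' PK' x Kx; apply: contrapT => nK'x.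
have gd' : good (K `&` K') by split; [apply: PI|move=> y [/KH]].
have : m.+1 <= m; last by rewrite ltnn.
apply: mmax; apply/asboolP; exists (K `&` K'); first exact: gd'.
apply: (separated_proper gK _ _ KH gH Kx) sK => //; first by case: (Psg _ gd'.1).
by case.
Qed.

(** Definable connectedness with finite index replaced by equality of dimensions, which
    [finite_index_gd] justifies. *)
Definition conn H := [/\ dset H, sg H & forall K, dset K -> sg K -> K `<=` H -> gd K = gd H -> K = H].

(** Finitely many cosets of [K] cover [K']; one of them meets [K'] in full dimension, and a
    translate of this part lies in the intersection. *)
Lemma gd_inter K K' H : dset K -> dset K' -> dset H -> sg K -> sg K' -> sg H ->
  K `<=` H -> K' `<=` H -> gd K = gd H -> gd (K `&` K') = gd K'.
Proof.
move=> dK dK' dH gK gK' gH KH K'H e.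
have [_ [_ [N [g hg]]]] := (finite_index_gd dK dH gK gH KH).2 e.
apply/eqP; rewrite eqn_leq gd_sub //=; last 2 first.
- by apply: sg_ne; apply: sg_I.
- by move=> x [].
have dKi i : dset (fun x => K ((g i)^-1 * x) /\ K' x) by dfn.
have [|i hi] := dge_bigor (k := gd K') dKi.
  by apply: dge_mono (gd_dge uG (sg_ne gK')) => x K'x; have [i Ki] := hg x (K'H _ K'x); exists i.
have [y [Ky K'y]] := dge_ne hi.
have dKK : dset (K `&` K') by dfn.
rewrite -(gd_lcoset y dKK); last by apply: sg_ne; apply: sg_I.
apply/gdP => //; first by exists y; rewrite gmulV; split; [case: gK|case: gK'].
apply: dge_mono hi => x [Kx K'x]; split.
  rewrite (_ : _ * _ = ((g i)^-1 * y)^-1 * ((g i)^-1 * x)); last by grp.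
  by apply: gK.2.1 => //; apply: gK.2.2.
by apply: gK'.2.1 => //; apply: gK'.2.2.
Qed.

Lemma component_exists H : dset H -> sg H -> exists K, [/\ conn K, K `<=` H, gd K = gd H &
  forall K', dset K' -> sg K' -> K' `<=` H -> gd K' = gd H -> K `<=` K'].
Proof.
move=> dH gH; pose Pi K := [/\ dset K, sg K, K `<=` H & gd K = gd H].
have [|||K [dK gK KH eK] Kmin] := @least_subgroup Pi H.
- by split.
- by move=> K [].
- move=> K K' [dK gK KH eK] [dK' gK' K'H eK']; split.
  + by dfn.
  + exact: sg_I.
  + by move=> x [/KH].
  + by rewrite (gd_inter dK dK' dH).
exists K; split=> //; last by move=> K' *; apply: Kmin.
split=> // K' dK' gK' K'K e; rewrite eqEsubset; split=> //; apply: Kmin; split=> //.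
  by move=> x /K'K /KH.
by rewrite e.
Qed.

Lemma conn_min K H K' : conn K -> K `<=` H -> gd K = gd H -> dset H -> sg H ->
  dset K' -> sg K' -> K' `<=` H -> gd K' = gd H -> K `<=` K'.
Proof.
move=> [dK gK cK] KH eK dH gH dK' gK' K'H eK'.
have <- : K' `&` K = K; last by move=> x [].
apply: cK; first by dfn.
- exact: sg_I.
- by move=> x [].
- by rewrite (gd_inter dK' dK dH).
Qed.

Lemma hull_exists (X : set G) : exists D, [/\ dset D, sg D, X `<=` D &
  forall K, dset K -> sg K -> X `<=` K -> D `<=` K].
Proof.
pose Pi K := [/\ dset K, sg K & X `<=` K].
have [|||D [dD gD XD] Dmin] := @least_subgroup Pi setT.
- by split=> //; apply: dset_prop.
- by move=> K [].
- move=> K K' [dK gK XK] [dK' gK' XK']; split; first by dfn.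
  + exact: sg_I.
  + by move=> x Xx; split; [apply: XK|apply: XK'].
by exists D; split=> // K *; apply: Dmin.
Qed.

Definition hull X := projT1 (cid (hull_exists X)).
Lemma hullP X : [/\ dset (hull X), sg (hull X), X `<=` hull X &
  forall K, dset K -> sg K -> X `<=` K -> hull X `<=` K].
Proof. exact: projT2 (cid (hull_exists X)). Qed.

Lemma norm_sub R g : conjs L R g `<=` R -> conjs L R g^-1 `<=` R -> norm L R g.
Proof.
move=> h1 h2 y; split=> [Ry|Ry]; first by apply: h1; apply/conjsE.
by apply: h2; apply/conjsE; rewrite ginvK (_ : _ * _ = y) //; grp.
Qed.

Lemma norm_inv R g : norm L R g -> norm L R g^-1.
Proof. exact: (sg_norm L R).2.2. Qed.

Lemma norm_hull X g : norm L X g -> norm L (hull X) g.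
Proof.
have [dD gD XD Dmin] := hullP X.
have sub h : norm L X h -> conjs L (hull X) h `<=` hull X.
  move=> nX y /conjsE Dy.
  have : hull X `<=` conjs L (hull X) h^-1.
    apply: Dmin; [exact: dset_conjs|exact: sg_conjs|].
    by move=> x Xx; apply/conjsE; apply: XD; apply/(norm_inv nX).
  by move=> /(_ _ Dy) /conjsE; rewrite (_ : _ * _ = y) //; grp.
by move=> nX; apply: norm_sub; apply: sub => //; apply: norm_inv.
Qed.

(** For [a] in [A], the [b] that normalize [D] and satisfy [[a, b]] in [D] form a definable subgroup
    containing [B], hence its hull; then the roles are exchanged. The normalizing condition absorbs
    the conjugations in the commutator identities. *)
Lemma hull_commg (A B : set G) : sg A -> sg B -> commg L (hull A) (hull B) `<=` hull (commg L A B).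
Proof.
move=> gA gB; have [dA gdA AA Amin] := hullP A; have [dB gdB BB Bmin] := hullP B.
have [dD gD CD _] := hullP (commg L A B); set D := hull (commg L A B) in dD gD CD *.
have nA : hull A `<=` norm L D.
  apply: Amin; [exact: dset_norm|exact: sg_norm|move=> a Aa].
  apply: norm_hull; have nrm h : A h -> conjs L (commg L A B) h `<=` commg L A B.
    move=> Ah y /conjsE; rewrite -[X in _ -> _ _ _ X](_ : h^-1 * (h * y * h^-1) * h = y); last by grp.
    move: (h * y * h^-1) => z hz; suff : commg L A B `<=` conjs L (commg L A B) h^-1.
      by move=> /(_ _ hz) /conjsE; rewrite ginvK.
    apply: commg_sub; first exact/sg_conjs/sg_gen.
    move=> x b Ax Bb; apply/conjsE; rewrite ginvK.
    rewrite (_ : _ * _ = comm L (x * h) b * (comm L h b)^-1); last by grp.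
    have [_ [CM CV]] := sg_gen L [set comm L x y | x in A & y in B].
    by apply: CM; [apply: commg_in => //; apply: gA.2.1|apply: CV; apply: commg_in].
  by apply: norm_sub; apply: nrm => //; apply: gA.2.2.
have nB : hull B `<=` norm L D.
  apply: Bmin; [exact: dset_norm|exact: sg_norm|move=> a Ba].
  apply: norm_hull; have nrm h : B h -> conjs L (commg L A B) h `<=` commg L A B.
    move=> Bh y /conjsE; rewrite -[X in _ -> _ _ _ X](_ : h^-1 * (h * y * h^-1) * h = y); last by grp.
    move: (h * y * h^-1) => z hz; suff : commg L A B `<=` conjs L (commg L A B) h^-1.
      by move=> /(_ _ hz) /conjsE; rewrite ginvK.
    apply: commg_sub; first exact/sg_conjs/sg_gen.
    move=> x b Ax Bb; apply/conjsE; rewrite ginvK.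
    rewrite (_ : _ * _ = (comm L x h)^-1 * comm L x (b * h)); last by grp.
    have [_ [CM CV]] := sg_gen L [set comm L x y | x in A & y in B].
    by apply: CM; [apply: CV; apply: commg_in|apply: commg_in => //; apply: gB.2.1].
  by apply: norm_sub; apply: nrm => //; apply: gB.2.2.
have [D1 [DM DV]] := gD.
have step1 a : A a -> hull B `<=` (fun b => norm L D b /\ D (comm L a b)).
  move=> Aa; apply: Bmin; first by have := dset_norm dD => dn; rewrite /comm; dfn.
  - have [N1 [NM NV]] := sg_norm L D; split; [|split].
    + by split=> //; rewrite (_ : comm L a 1 = 1) //; grp.
    + move=> x y [nx Dx] [ny Dy]; split; first exact: NM.
      rewrite (_ : comm L a (x * y) = comm L a y * (y^-1 * comm L a x * y^-1^-1)); last by grp.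
      by apply: (DM) => //; apply/(NV _ ny).
    + move=> x [nx Dx]; split; first exact: NV.
      rewrite (_ : comm L a x^-1 = x * (comm L a x)^-1 * x^-1); last by grp.
      by apply/nx; apply: DV.
  - by move=> b Bb; split; [apply/nB/BB|apply: CD; apply: commg_in].
have step2 b : hull B b -> hull A `<=` (fun a => norm L D a /\ D (comm L a b)).
  move=> Bb; apply: Amin; first by have := dset_norm dD => dn; rewrite /comm; dfn.
  - have [N1 [NM NV]] := sg_norm L D; split; [|split].
    + by split=> //; rewrite (_ : comm L 1 b = 1) //; grp.
    + move=> x y [nx Dx] [ny Dy]; split; first exact: NM.
      rewrite (_ : comm L (x * y) b = (y^-1 * comm L x b * y^-1^-1) * comm L y b); last by grp.
      by apply: (DM) => //; apply/(NV _ ny).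
    + move=> x [nx Dx]; split; first exact: NV.
      rewrite (_ : comm L x^-1 b = x * (comm L x b)^-1 * x^-1); last by grp.
      by apply/nx; apply: DV.
  - by move=> a Aa; split; [apply/nA/AA|case: (step1 a Aa b Bb)].
by apply: commg_sub => // x y Ax By; case: (step2 y By x Ax).
Qed.

Lemma hull_lcs (R : set G) i : sg R -> lcs L (hull R) i `<=` hull (lcs L R i).
Proof.
move=> gR; elim: i => [//|i IH] /=; have h := hull_commg (sg_lcs i gR) gR.
by apply: subset_trans h; apply: commg_mono.
Qed.

Lemma hull_definable D : dset D -> sg D -> hull D = D.
Proof.
by move=> dD gD; have [_ _ DD Dmin] := hullP D; rewrite eqEsubset; split=> //; apply: Dmin.
Qed.

(** The fibre of multiplication over [a * b] consists of the pairs [a * c], [c^-1 * b] with [c] in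
    the intersection. *)
Lemma gd_prodg A B : dset A -> dset B -> sg A -> sg B ->
  gd (prodg L A B) + gd (A `&` B) = gd A + gd B.
Proof.
move=> dA dB gA gB; have [A1 [AM AV]] := gA; have [B1 [BM BV]] := gB.
rewrite -(gd_prod uG uG dA dB (sg_ne gA) (sg_ne gB)).
have uGG := uniform_prod uG uG.
have dAB : @dset _ _ S (prod_isort G G) (fun p => A p.1 /\ B p.2) by dfn.
have dAiB : dset (A `&` B) by dfn.
rewrite (gd_fib uGG uG (f := fun p => p.1 * p.2) (imul G) dAB (r := gd (A `&` B))).
- congr (_ + _); apply: gd_eq => z; split.
    by move=> [a [b [Aa [Bb ->]]]]; exists (a, b).
  by move=> [[a b] [[Aa Bb] <-]]; exists a, b.
- by exists (1, 1).
move=> [a b] [Aa Bb] /=.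
have df : @dmap _ _ S G (prod_isort G G) (fun c => (a * c, c^-1 * b)) by dfn.
rewrite -(gd_inj uG uGG df dAiB); last by exists 1.
  apply: gd_eq => -[x y] /=; split.
    move=> [[Ax By] /= e]; have ay : a^-1 * x = b * y^-1.
      by rewrite -(gmulKV L a b) -e; grp.
    exists (a^-1 * x); split; last by congr pair; [grp|rewrite ay; grp].
    by split; [apply: (AM) => //; apply: (AV)|rewrite ay; apply: (BM) => //; apply: (BV)].
  move=> [c [[Ac Bc] [<- <-]]]; split; last by grp.
  by split; [apply: (AM)|apply: (BM) => //; apply: (BV)].
by move=> c c' _ _ [e _]; apply: gmulI e.
Qed.
End SubgroupDimension.

(** * Definable subgroups and quotients *)

Section Subgroup.
Context {d : Order.disp_t} {M : orderType d} {S : ominimal_structure M}.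
Variables (G : igroup S) (H : set G).
Hypotheses (dH : dset H) (gH : is_subgroup (ilaw G) H).
Local Notation L := (ilaw G).

Definition sub_type := {x : G | H x}.
Let val (u : sub_type) : G := proj1_sig u.

Lemma sub_val_inj (u v : sub_type) : val u = val v -> u = v.
Proof. by case: u v => x hx [y hy] /= e; subst y; congr exist; apply: Prop_irrelevance. Qed.

Definition sub_law : group_law sub_type.
Proof.
pose one : sub_type := exist _ (gone L) gH.1.
pose mul (u v : sub_type) : sub_type :=
  exist _ (gmul L (val u) (val v)) (gH.2.1 _ _ (proj2_sig u) (proj2_sig v)).
pose inv (u : sub_type) : sub_type := exist _ (ginv L (val u)) (gH.2.2 _ (proj2_sig u)).
exists mul inv one.
- by move=> x y z; apply: sub_val_inj; apply: gmulA.
- by move=> x; apply: sub_val_inj; apply: gmul1.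
- by move=> x; apply: sub_val_inj; apply: gmulV.
Defined.

Definition sub_dom v := idom G v /\ H (iprj v).
Definition sub_prj (v : 'I_(iar G) -> M) : sub_type :=
  if pselect (H (iprj v)) is left h then exist _ (iprj v) h else gone sub_law.

Lemma sub_prjE v : sub_dom v -> val (sub_prj v) = iprj v.
Proof. by move=> [_ Hv]; rewrite /sub_prj; case: pselect. Qed.

Lemma sub_prj_surj u : exists2 v, sub_dom v & sub_prj v = u.
Proof.
have [v dv vu] := iprj_surj (val u); have Hv : H (iprj v) by rewrite vu; case: (u).
by exists v; [split|apply: sub_val_inj; rewrite sub_prjE].
Qed.

Lemma sub_ker : defs S (iar G + iar G) [set z : 'I_(iar G + iar G) -> M |
  [/\ sub_dom (z \o lshift _), sub_dom (z \o @rshift _ _) &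
      sub_prj (z \o lshift _) = sub_prj (z \o @rshift _ _)]].
Proof.
apply: eq_defs (defsI (iker_def G) (defsI (defs_reindex (lshift _) dH) (defs_reindex (@rshift _ _) dH))) => z /=.
split=> [[[d1 d2 e] [[_ h1] [_ h2]]]|[[d1 h1] [d2 h2] e]].
  by split=> //; apply: sub_val_inj; rewrite !sub_prjE.
by split=> //; split=> //; rewrite -!sub_prjE // e.
Qed.

Definition sub_isort : isort S := ISort sub_prj_surj dH sub_ker.

Lemma dmap_val : @dmap _ _ S sub_isort G val.
Proof.
apply: eq_defs (defsI (iker_def G) (defs_reindex (lshift _) dH)) => z /=.
split=> [[[d1 d2 e] [_ h1]]|[[d1 d2]]]; first by rewrite sub_prjE.
by rewrite sub_prjE // => e; case: d1.
Qed.

Definition simg (P : sub_isort -> Prop) : set G := fun x => exists u : sub_isort, val u = x /\ P u.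

Lemma simgE P u : simg P (val u) <-> P u.
Proof. by split=> [[v [/sub_val_inj ->]]//|Pu]; exists u. Qed.

Lemma dset_simg (P : sub_isort -> Prop) : dset P <-> dset (simg P).
Proof.
have dv := dmap_val; split=> [dP|dP]; first by rewrite /simg; dfn.
by apply: (eq_dset (X := sub_isort) (P := fun u => simg P (val u))) (dset_comp (X := sub_isort) (f := val) dP dv) => u; apply: simgE.
Qed.

Let raw_eq P : (fun v => idom sub_isort v /\ P (iprj v)) = (fun v : 'I_(iar G) -> M => idom G v /\ simg P (iprj v)).
Proof.
apply/funext => v; apply/propext; split=> [[[dv Hv] Pv]|[dv [u [uv Pu]]]].
  by split=> //; exists (sub_prj v); rewrite sub_prjE.
have sv : sub_dom v by split=> //; rewrite -uv; case: (u).
by split=> //=; rewrite (_ : sub_prj v = u) //; apply: sub_val_inj; rewrite sub_prjE.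
Qed.

Lemma sub_unif : unif sub_isort (fdim G).
Proof.
have [ne uG] := unif_fdim (iunif G); split.
  by have [v dv _] := sub_prj_surj (gone sub_law); exists v.
move=> v [dv Hv] k; rewrite -(uG v dv k); split; apply: dq_mono => w.
  by move=> [dw e]; split; [case: dw|have := congr1 val e; rewrite /= !sub_prjE].
move=> [dw e]; have sw : sub_dom w by split=> //; rewrite e.
by split=> //; apply: sub_val_inj; rewrite !sub_prjE.
Qed.

Lemma sub_uniform : uniform sub_isort. Proof. by exists (fdim G); apply: sub_unif. Qed.

Lemma dge_simg k P : @dge _ _ S sub_isort k P = dge k (simg P).
Proof. by rewrite /dge (unif_eq sub_unif) raw_eq. Qed.

Lemma gd_simg P : @gd _ _ S sub_isort P = gd (simg P).
Proof. by apply: eq_bigl => k; rewrite dge_simg. Qed.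

Lemma simg_image P : simg P = val @` P.
Proof. by apply: set_ext => x; split=> [[u [ux Pu]]|[u Pu ux]]; exists u. Qed.

Lemma sg_simg (K : set sub_isort) : is_subgroup sub_law K <-> is_subgroup L (simg K).
Proof.
rewrite simg_image; split=> [|[K1 [KM KV]]]; first exact: sg_img.
rewrite -simg_image in K1 KM KV.
split; [|split]; first by apply/simgE.
- by move=> x y /simgE Kx /simgE Ky; apply/simgE; apply: (KM _ _ Kx Ky).
- by move=> x /simgE Kx; apply/simgE; apply: (KV _ Kx).
Qed.

Lemma sub_mul : @dmap _ _ S (prod_isort sub_isort sub_isort) sub_isort (fun p => gmul sub_law p.1 p.2).
Proof.
have dv := dmap_val.
apply: (eq_dset (X := prod_isort (prod_isort sub_isort sub_isort) sub_isort)
  (P := fun p => gmul L (val p.1.1) (val p.1.2) = val p.2)).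
  by move=> [[x y] z] /=; split=> [e|<-//]; apply: sub_val_inj.
by dfn.
Qed.

Lemma simg_sub (K K' : set sub_isort) : K `<=` K' -> simg K `<=` simg K'.
Proof. by move=> KK' _ [u [<- /KK' Ku]]; exists u. Qed.

Lemma sub_sep (K' : set sub_isort) : dset K' -> is_subgroup sub_law K' -> exists N, forall K : set sub_isort, dset K ->
    is_subgroup sub_law K -> K `<=` K' -> gd K = gd K' -> ~ separated sub_law K K' N.
Proof.
move=> /dset_simg dK' /sg_simg gK'; have [N hN] := isep dK' gK'.
exists N => K /dset_simg dK /sg_simg gK KK' e [g [Kg sg]].
apply: (hN _ dK gK (simg_sub KK')); first by rewrite -!gd_simg.
exists (fun i => val (g i)); split=> [i|i j ne]; first exact/simgE.
by move=> h; apply: (sg i j ne); apply/simgE.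
Qed.

Definition sub_igroup : igroup S := IGroup sub_mul sub_uniform sub_sep.
End Subgroup.

Section Quotient.
Context {d : Order.disp_t} {M : orderType d} {S : ominimal_structure M}.
Variables (G : igroup S) (A : set G).
Hypotheses (dA : dset A) (gA : is_subgroup (ilaw G) A) (nA : forall g, norm (ilaw G) A g).
Local Notation L := (ilaw G).
Local Notation "x * y" := (gmul L x y).
Local Notation "x ^-1" := (ginv L x).
Local Notation "1" := (gone L).

Definition coset x : set G := fun y => A (x^-1 * y).
Definition quo_type := {X : set G | exists x, X = coset x}.
Definition qpi (x : G) : quo_type := exist _ (coset x) (ex_intro _ x erefl).

Lemma qpi_surj q : exists x, qpi x = q.
Proof.
case: q => X [x e]; exists x; subst X; congr exist; exact: Prop_irrelevance.
Qed.

Lemma qpiE x y : qpi x = qpi y <-> A (x^-1 * y).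
Proof.
have [A1 [AM AV]] := gA; split=> [e|Axy].
  have -> : A (x^-1 * y) = coset x y by [].
  by rewrite (congr1 (@proj1_sig _ _) e : coset x = coset y) /coset gmulV.
suff e : coset x = coset y by apply: eq_sig_hprop => //= ? ? ?; apply: Prop_irrelevance.
apply: set_ext => z; rewrite /coset; split=> h.
  by rewrite (_ : _ * _ = (x^-1 * y)^-1 * (x^-1 * z)); [apply: (AM) => //; apply: AV|grp].
by rewrite (_ : _ * _ = (x^-1 * y) * (y^-1 * z)); [apply: AM|grp].
Qed.

Definition qrep q : G := projT1 (cid (qpi_surj q)).
Lemma qrepK q : qpi (qrep q) = q. Proof. exact: projT2 (cid (qpi_surj q)). Qed.

Lemma qmul_wd x y x' y' : qpi x = qpi x' -> qpi y = qpi y' -> qpi (x * y) = qpi (x' * y').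
Proof.
move=> /qpiE h /qpiE h'; apply/qpiE.
rewrite (_ : _ * _ = (y^-1 * (x^-1 * x') * y^-1^-1) * (y^-1 * y')); last by grp.
by apply: gA.2.1 => //; apply/nA.
Qed.

Definition quo_law : group_law quo_type.
Proof.
exists (fun p q => qpi (qrep p * qrep q)) (fun p => qpi (qrep p)^-1) (qpi 1).
- move=> x y z; rewrite (qmul_wd (y' := qrep y * qrep z) erefl); last by rewrite qrepK.
  by rewrite [in RHS](qmul_wd (x' := qrep x * qrep y) (y' := qrep z)) ?qrepK // gmulA.
- by move=> x; rewrite (qmul_wd (x' := 1) (y' := qrep x)) ?qrepK // gmul1 qrepK.
- by move=> x; rewrite (qmul_wd (x' := (qrep x)^-1) (y' := qrep x)) ?qrepK // gmulV.
Defined.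

Lemma qpiM x y : qpi (x * y) = gmul quo_law (qpi x) (qpi y).
Proof. by rewrite /=; apply: qmul_wd; rewrite qrepK. Qed.

Lemma qpiV x : qpi x^-1 = ginv quo_law (qpi x).
Proof. exact: (homV (L := L) (L' := quo_law) (f := qpi) qpiM). Qed.

Definition quo_prj (v : 'I_(iar G) -> M) : quo_type := qpi (iprj v).

Lemma quo_prj_surj q : exists2 v, idom G v & quo_prj v = q.
Proof.
have [x <-] := qpi_surj q; have [v dv vx] := iprj_surj x.
by exists v => //; rewrite /quo_prj vx.
Qed.

Lemma quo_ker : defs S (iar G + iar G) [set z : 'I_(iar G + iar G) -> M |
  [/\ idom G (z \o lshift _), idom G (z \o @rshift _ _) &
      quo_prj (z \o lshift _) = quo_prj (z \o @rshift _ _)]].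
Proof.
have dR : @dset _ _ S (prod_isort G G) (fun p => A (p.1^-1 * p.2)) by dfn.
apply: eq_defs dR => z /=; split=> [[[d1 d2] h]|[d1 d2 /qpiE h]] //.
by split=> //; apply/qpiE.
Qed.

(** The quotient keeps the representatives of [G] and coarsens the equivalence, so a set and its
    preimage are given by the same formula and [dset_pre] holds by conversion. *)
Definition quo_isort : isort S := ISort quo_prj_surj (idom_def G) quo_ker.

Lemma quo_mul : @dmap _ _ S (prod_isort quo_isort quo_isort) quo_isort (fun p => gmul quo_law p.1 p.2).
Proof.
have dR : @dset _ _ S (prod_isort (prod_isort G G) G) (fun p => A ((p.1.1 * p.1.2)^-1 * p.2)) by dfn.
apply: eq_defs dR => z; split=> -[dz h]; split=> //.
  by rewrite -[LHS]qpiM; apply/qpiE.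
by move: h; rewrite -[LHS]qpiM => /qpiE.
Qed.

Lemma gd_coset x : gd (coset x) = gd A.
Proof. by apply: gd_lcoset => //; exists 1; case: gA. Qed.

(** A fibre of the new projection consists of the old representatives of a whole coset of [A], which
    adds [gd A]. *)
Lemma quo_unif : unif quo_isort (fdim G + gd A).
Proof.
have [ne uG] := unif_fdim (iunif G); split=> // v dv k.
pose x : G := @iprj _ _ S G v; have neC : exists y, coset x y by exists x; rewrite /coset gmulV; case: gA.
have E j : dq (j + fdim G) (fun w : 'I_(iar G) -> M => idom G w /\ qpi (iprj w) = qpi x) <-> j <= gd A.
  rewrite -(gd_coset x) -(gdP _ (iunif G) neC) /dge.
  by split; apply: dq_mono => w [dw h]; split=> //; [apply/qpiE; rewrite h|apply/esym/qpiE].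
have [lek|ltk] := leqP (fdim G) k.
  by rewrite -{1}(subnK lek) E; split; lia.
split=> _; first by lia.
exact: (dq_leq (ltnW ltk) ((E 0).2 (leq0n _))).
Qed.

Lemma quo_uniform : uniform quo_isort. Proof. by exists (fdim G + gd A); apply: quo_unif. Qed.

Definition qpre (P : set quo_isort) : set G := fun x => P (qpi x).

Lemma dset_pre P : dset P <-> dset (qpre P).
Proof. by []. Qed.

Lemma dge_pre k P : @dge _ _ S quo_isort k P <-> dge (k + gd A) (qpre P).
Proof. by rewrite /dge (unif_eq quo_unif) addnA addnAC. Qed.

Lemma gd_pre P : (exists q, P q) -> gd (qpre P) = @gd _ _ S quo_isort P + gd A.
Proof.
move=> [q Pq]; have neP : exists x, qpre P x by exists (qrep q); rewrite /qpre qrepK.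
have nq : exists q, P q by exists q.
have lea : gd A <= gd (qpre P).
  rewrite -(gd_coset (qrep q)); apply: gd_sub; first exact: iunif.
    by exists (qrep q); rewrite /coset gmulV; case: gA.
  by move=> x /qpiE e; rewrite /qpre -e qrepK.
have h k : k <= gd P <-> k + gd A <= gd (qpre P).
  by rewrite -(gdP k quo_uniform nq) -(gdP _ (iunif G) neP); apply: dge_pre.
have h1 := (h (gd P)).1 (leqnn _).
have h2 : gd (qpre P) - gd A <= gd P by apply/h; rewrite subnK.
by lia.
Qed.

Lemma sg_pre (K : set quo_isort) : is_subgroup quo_law K <-> is_subgroup L (qpre K).
Proof.
split=> [gK|[K1 [KM KV]]]; first exact: (sg_preim (L := L) (L' := quo_law) (f := qpi) qpiM) gK.
split; [exact: K1|split].
- by move=> p q; rewrite -(qrepK p) -(qrepK q) -qpiM; apply: KM.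
- by move=> p; rewrite -(qrepK p) -qpiV; apply: KV.
Qed.

Lemma pre_inj (P Q : set quo_isort) : (forall x, qpre P x <-> qpre Q x) -> P = Q.
Proof. by move=> PQ; apply: set_ext => q; rewrite -(qrepK q); apply: PQ. Qed.

Lemma quo_sep (K' : set quo_isort) : dset K' -> is_subgroup quo_law K' -> exists N, forall K : set quo_isort, dset K ->
    is_subgroup quo_law K -> K `<=` K' -> gd K = gd K' -> ~ separated quo_law K K' N.
Proof.
move=> dK' gK'; have [N hN] := isep (i := G) (H := qpre K') dK' ((sg_pre K').1 gK').
exists N => K dK gK KK' e [g [Kg sg]]; apply: (hN (qpre K) dK ((sg_pre K).1 gK)).
- by move=> x; apply: KK'.
- rewrite !gd_pre ?e //; [by exists (gone quo_law); case: gK'|by exists (gone quo_law); case: gK].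
exists (fun i => qrep (g i)); split=> [i|i j ne]; first by rewrite /qpre qrepK.
by rewrite /qpre qpiM qpiV !qrepK; apply: sg.
Qed.

Definition quo_igroup : igroup S := IGroup quo_mul quo_uniform quo_sep.
End Quotient.

(** * Carter subgroups *)

Section CarterDefinitions.
Context {d : Order.disp_t} {M : orderType d} {S : ominimal_structure M}.
Variable G : igroup S.
Local Notation L := (ilaw G).
Local Notation "x * y" := (gmul L x y).
Local Notation "x ^-1" := (ginv L x).
Local Notation "1" := (gone L).
Local Notation sg := (is_subgroup L).
Implicit Types (A B D E H K P Q R : set G) (x y g h : G).

(* [A] is a normal subgroup throughout: [nilm], [carter] and [carter_theory]  *)
(* speak about [R / A] and [H / A] in terms of preimages.                     *)
Definition nilm A R := exists c, lcs L R c `<=` A.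
(** [x] lies in the conjugate of [P] by [g] exactly when [g * x * g^-1] is in [P]; each such
    conjugate must be [P] itself. *)
Definition uniq_conj H P : set G :=
  fun x => P x /\ forall g, H g -> P (g * x * g^-1) -> norm L P g.
Definition gclos H B : set G := fun y => exists g, H g /\ B (g * y * g^-1).
Definition small D E := ~ dge (gd E) D.
Definition generic H P :=
  small (P `\` uniq_conj H P) P /\ small (H `\` gclos H (uniq_conj H P)) H.
(** The last clause is finite index in the normalizer, in terms of dimension. *)
Definition carter H A R := [/\ conn R, A `<=` R, R `<=` H, nilm A R &
  gd (H `&` norm L R) = gd R].
(** The statement proved by induction. Genericity and conjugacy are included because the Frattini
    arguments and the lifting steps use them for smaller groups. *)
Definition carter_theory H A := exists P, [/\ [/\ conn P, A `<=` P, P `<=` H & nilm A P],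
  forall g, H g -> norm L P g -> P g, generic H P &
  forall R, carter H A R -> exists h, H h /\ forall y, R y <-> P (h * y * h^-1)].
End CarterDefinitions.

(** * Transfer from subgroups and quotients to the group *)

Section Transport.
Context {d : Order.disp_t} {M : orderType d} {S : ominimal_structure M}.
Variable G : igroup S.
Local Notation L := (ilaw G).
Local Notation "x * y" := (gmul L x y).
Local Notation "x ^-1" := (ginv L x).
Local Notation "1" := (gone L).
Local Notation sg := (is_subgroup L).
Implicit Types (A B D E H K P Q R : set G) (x y g h : G).

Section FromSubgroup.
Variables (H : set G) (dH : dset H) (gH : sg H).
Let X := sub_igroup dH gH.
Local Notation LX := (ilaw X).
Local Notation val := (@proj1_sig G H).
Local Notation simg := (@simg _ _ _ G H dH gH).

Let valM (u v : X) : val (gmul LX u v) = val u * val v. Proof. by []. Qed.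
Let valV (u : X) : val (ginv LX u) = (val u)^-1. Proof. by []. Qed.
Let valH (u : X) : H (val u). Proof. by case: u. Qed.
Let lift_el x : H x -> exists u : X, val u = x. Proof. by move=> Hx; exists (exist _ x Hx). Qed.
Let sE (P : set X) u : simg P (val u) <-> P u. Proof. exact: simgE. Qed.

Definition spre K : set X := fun u => K (val u).
Lemma simg_spre K : K `<=` H -> simg (spre K) = K.
Proof.
move=> KH; apply: set_ext => x; split=> [[u [<-]]//|Kx].
by have [u ux] := lift_el (KH _ Kx); exists u; rewrite /spre ux.
Qed.
Lemma simg_in (P : set X) : simg P `<=` H.
Proof. by move=> _ [u [<- _]]. Qed.

Lemma conn_simg (P : set X) : conn P <-> conn (simg P).
Proof.
split=> -[dP gP cP].
  split; [exact/dset_simg|exact/sg_simg|move=> K dK gK KP e].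
  have KH : K `<=` H by move=> x /KP /simg_in.
  rewrite -(simg_spre KH); congr simg; apply: cP.
  - by apply/dset_simg; rewrite simg_spre.
  - by apply/sg_simg; rewrite simg_spre.
  - by move=> u /KP /sE.
  - by rewrite gd_simg simg_spre // e -gd_simg.
split; [exact/dset_simg|exact/sg_simg|move=> K dK gK KP e].
apply: set_ext => u; rewrite -!sE (cP (simg K)) //.
- exact/dset_simg.
- exact/sg_simg.
- exact: simg_sub.
- by rewrite -!gd_simg.
Qed.

Lemma simg_lcs (P : set X) c : lcs L (simg P) c = simg (lcs LX P c).
Proof. by rewrite !simg_image; apply: (lcs_img (L := LX) (L' := L) (f := val) valM). Qed.

Lemma simg_derived (P : set X) c : derived L (simg P) c = simg (derived LX P c).
Proof. by rewrite !simg_image; apply: (derived_img (L := LX) (L' := L) (f := val) valM). Qed.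

Lemma nilm_simg (P : set X) : nilm [set gone LX] P <-> nilm [set 1] (simg P).
Proof.
split=> -[c hc]; exists c; first by rewrite simg_lcs => x [u [<- /hc ->]].
move=> u /sE; rewrite -simg_lcs => /hc h; exact: (@sub_val_inj _ _ _ G H u (gone LX) h).
Qed.

Lemma norm_simg (P : set X) (u : X) : norm LX P u <-> norm L (simg P) (val u).
Proof.
split=> [n y|n y]; last by have := n (val y); rewrite -valV -!valM !sE.
split=> h; have Hy : H y.
- rewrite (_ : y = (val u)^-1 * (val u * y * (val u)^-1) * val u); last by grp.
  have /= Hu := valH u; have /= := simg_in h => hz.
  by apply: gH.2.1 => //; apply: gH.2.1 => //; apply: gH.2.2.
- by have [v yv] := lift_el Hy; move: h; rewrite -yv -valV -!valM !sE => /n.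
- exact: simg_in h.
by have [v yv] := lift_el Hy; move: h; rewrite -yv -valV -!valM !sE => /n.
Qed.

Lemma uniq_simg (P : set X) : simg (uniq_conj setT P) = uniq_conj H (simg P).
Proof.
apply: set_ext => x; split.
  move=> [u [<- [Pu hu]]]; split=> [|g Hg]; first exact/sE.
  have [v <-] := lift_el Hg; rewrite -valV -!valM sE => h; exact/norm_simg/hu.
move=> [Px hx]; have [u ux] := lift_el (simg_in Px); subst x.
apply/sE; split=> [|v _ h]; first exact/sE.
by apply/norm_simg/hx => //; rewrite -valV -!valM sE.
Qed.

Lemma gclos_simg (B : set X) : simg (gclos setT B) = gclos H (simg B).
Proof.
apply: set_ext => x; split.
  by move=> [u [<- [v [_ Bv]]]]; exists (val v); split=> //; rewrite -valV -!valM sE.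
move=> [g [Hg Bx]]; have [v gv] := lift_el Hg; subst g.
have Hx : H x.
  rewrite (_ : x = (val v)^-1 * (val v * x * (val v)^-1) * val v); last by grp.
  have /= Hu := valH v; have /= := simg_in Bx => hz.
  by apply: gH.2.1 => //; apply: gH.2.1 => //; apply: gH.2.2.
have [u ux] := lift_el Hx; subst x; apply/sE; exists v; split=> //.
by move: Bx; rewrite -valV -!valM sE.
Qed.

Lemma simgT : simg setT = H.
Proof. by rewrite -[RHS]simg_spre //; congr simg; apply: set_ext => u; split=> // _; apply: valH. Qed.

Lemma simgD (P Q : set X) : simg (P `\` Q) = simg P `\` simg Q.
Proof.
apply: set_ext => x; split; first by move=> [u [<- [Pu nQ]]]; split; rewrite sE.
by move=> [Px nQx]; have [u ux] := lift_el (simg_in Px); subst x; move: Px nQx; rewrite !sE => *; split.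
Qed.

Lemma simgI (P Q : set X) : simg (P `&` Q) = simg P `&` simg Q.
Proof.
apply: set_ext => x; split; first by move=> [u [<- [Pu nQ]]]; split; rewrite sE.
by move=> [Px Qx]; have [u ux] := lift_el (simg_in Px); subst x; move: Px Qx; rewrite !sE => *; split.
Qed.

Lemma small_simg (P Q : set X) : small P Q <-> small (simg P) (simg Q).
Proof. by rewrite /small dge_simg gd_simg. Qed.

Lemma conn_sub : conn H -> conn (setT : set X).
Proof. by move=> cH; apply/conn_simg; rewrite simgT. Qed.

Lemma solv_sub c : derived L setT c `<=` [set 1] -> derived LX setT c `<=` [set gone LX].
Proof.
move=> hc u /sE; rewrite -simg_derived simgT => h.
apply: (@sub_val_inj _ _ _ G H u (gone LX)).
by apply: hc; apply: derived_mono h.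
Qed.

Lemma gd_sub_type : gd (setT : set X) = gd H.
Proof. by rewrite gd_simg simgT. Qed.

Lemma carter_theory_sub : carter_theory (setT : set X) [set gone LX] -> carter_theory H [set 1].
Proof.
move=> [P [[cP _ _ nP] sP [gP1 gP2] conjP]]; exists (simg P).
have gP : is_subgroup LX P by case: cP.
split; first split.
- exact/conn_simg.
- by move=> _ ->; apply/(sE P (gone LX)); case: gP.
- exact: simg_in.
- exact/nilm_simg.
- by move=> g Hg; have [u <-] := lift_el Hg; move=> /norm_simg /sP h; apply/sE/h.
- by split; [rewrite -uniq_simg -simgD; apply/small_simg|
    rewrite -uniq_simg -gclos_simg -[X in X `\` _]simgT -simgD -[X in small _ X]simgT; apply/small_simg].
move=> R [cR R1 RH nR eR].
have [|h [_ hP]] := conjP (spre R).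
  split=> //.
  - by apply/conn_simg; rewrite simg_spre.
  - by move=> _ ->; apply: R1.
  - by apply/nilm_simg; rewrite simg_spre.
  rewrite !gd_simg (simg_spre RH) -eR simgI simgT; congr gd; apply: set_ext => x.
  split=> -[Hx h]; split=> //; have [u ux] := lift_el Hx; subst x.
    by move: h; rewrite sE norm_simg simg_spre.
  by rewrite sE norm_simg simg_spre.
exists (val h); split; first exact: valH.
move=> y; split=> [Ry|Py].
  by have [u ux] := lift_el (RH _ Ry); subst y; rewrite -valV -!valM sE -hP.
have Hy : H y.
  rewrite (_ : y = (val h)^-1 * (val h * y * (val h)^-1) * val h); last by grp.
  have /= Hu := valH h; have /= := simg_in Py => hz.
  by apply: gH.2.1 => //; apply: gH.2.1 => //; apply: gH.2.2.
have [u ux] := lift_el Hy; subst y.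
by have := (hP u).2; apply; move: Py; rewrite -valV -!valM sE.
Qed.
End FromSubgroup.

Section FromQuotient.
Variables (A : set G) (dA : dset A) (gA : sg A) (nA : forall g, norm L A g).
Let X := quo_igroup dA gA nA.
Local Notation LX := (ilaw X).
Local Notation qpi := (@qpi _ _ _ G A).
Local Notation pre := (@qpre _ _ _ G A dA gA).

Let piM (x y : G) : qpi (x * y) = gmul LX (qpi x) (qpi y).
Proof. exact: (qpiM gA nA). Qed.
Let piV (x : G) : qpi (x^-1) = ginv LX (qpi x).
Proof. exact: (qpiV gA nA). Qed.
Let surj (q : X) : exists x, qpi x = q. Proof. exact: qpi_surj. Qed.

Lemma dmap_qpi : @dmap _ _ S G (quo_isort dA gA) qpi.
Proof. exact: (dset_eq (dmap_fst _ _) (dmap_snd _ _) : @dset _ _ S (prod_isort (quo_isort dA gA) (quo_isort dA gA)) (fun p => p.1 = p.2)). Qed.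

Definition qimg K : set X := fun q => K (qrep q).
Lemma pre_qimg K : sg K -> A `<=` K -> pre (qimg K) = K.
Proof.
move=> [K1 [KM KV]] AK; apply: set_ext => x; rewrite /qpre /qimg.
have /(qpiE gA)/AK h : qpi (qrep (qpi x)) = qpi x by apply: qrepK.
split=> h'; first by rewrite (_ : x = qrep (qpi x) * ((qrep (qpi x))^-1 * x)); [apply: KM|grp].
rewrite (_ : qrep (qpi x) = x * ((qrep (qpi x))^-1 * x)^-1); last by grp.
by apply: (KM) => //; apply: KV.
Qed.

Lemma pre_in (P : set X) : is_subgroup LX P -> A `<=` pre P.
Proof.
move=> [P1 _] a Aa; rewrite /qpre (_ : qpi a = gone LX) //; apply/esym/(qpiE gA).
by rewrite (_ : _ * a = a) //; grp.
Qed.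

Let sg_ne' (P : set X) : is_subgroup LX P -> exists q, P q.
Proof. by case=> P1 _; exists (gone LX). Qed.

Lemma conn_of_pre (P : set X) : conn (pre P) -> conn P.
Proof.
move=> [dP gP cP]; have {}gP : is_subgroup LX P by apply/(sg_pre nA).
split=> // K dK gK KP e; apply: (@pre_inj _ _ _ G A dA gA) => x.
rewrite (cP (pre K)) //; first exact/(sg_pre nA).
  by move=> y; apply: KP.
by rewrite (gd_pre (sg_ne' gK)) (gd_pre (sg_ne' gP)) e.
Qed.

(** A full-dimensional subgroup of the preimage meets [A] in full dimension; as [A] is connected, it
    contains [A] and so comes from the quotient. *)
Lemma conn_pre (P : set X) : conn A -> conn P <-> conn (pre P).
Proof.
move=> [_ _ cA]; split=> [[dP gP cP]|]; last exact: conn_of_pre.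
split; [exact: dP|exact/(sg_pre nA)|move=> K dK gK KP e].
have AP := pre_in gP.
have AK : A `<=` K.
  have <- : K `&` A = A; last by move=> x [].
  apply: cA; first by dfn.
  - exact: sg_I.
  - by move=> x [].
  by apply: (gd_inter (H := pre P)) => //; apply/(sg_pre nA).
rewrite -(pre_qimg gK AK); congr pre; apply: cP.
- by apply/dset_pre; rewrite pre_qimg.
- by apply/(sg_pre nA); rewrite pre_qimg.
- by move=> q Kq; rewrite -(qrepK q); apply: KP.
- apply/eqP; rewrite -(eqn_add2r (gd A)); apply/eqP.
  have neK : exists q, qimg K q.
    by apply: sg_ne'; apply/(sg_pre nA); rewrite pre_qimg.
  by rewrite -(gd_pre neK) -(gd_pre (sg_ne' gP)) pre_qimg.
Qed.

Let img_pre (P : set X) : qpi @` pre P = P.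
Proof.
apply: set_ext => q; split=> [[x Px <-]//|Pq].
by have [x xq] := surj q; exists x => //; rewrite /qpre xq.
Qed.

Lemma nilm_pre (P : set X) : nilm [set gone LX] P <-> nilm A (pre P).
Proof.
have e1 x : qpi x = gone LX <-> A x.
  split=> [/esym/(qpiE gA)|Ax]; last apply/esym/(qpiE gA).
    by rewrite (_ : _ * x = x) //; grp.
  by rewrite (_ : _ * x = x) //; grp.
have E c : lcs LX P c = qpi @` lcs L (pre P) c.
  by rewrite -{1}(img_pre P); apply: (lcs_img (L := L) (L' := LX) (f := qpi) piM).
split=> -[c hc]; exists c; last by rewrite E => _ [x /hc /e1 h <-].
by move=> x hx; apply/e1; apply: hc; rewrite E; exists x.
Qed.

Lemma norm_pre (P : set X) g : norm LX P (qpi g) <-> norm L (pre P) g.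
Proof.
split=> [n y|n q]; first by rewrite /qpre !piM piV.
by have [x <-] := surj q; rewrite -piV -!piM; apply: n.
Qed.

Lemma uniq_pre (P : set X) : pre (uniq_conj setT P) = uniq_conj setT (pre P).
Proof.
apply: set_ext => x; split=> -[Px h]; split=> //.
  by move=> g _; rewrite {1}/qpre !piM piV => hg; apply/norm_pre/h.
move=> q _; have [g <-] := surj q; rewrite -piV -!piM => hg; exact/norm_pre/h.
Qed.

Lemma gclos_pre (B : set X) : pre (gclos setT B) = gclos setT (pre B).
Proof.
apply: set_ext => x; split=> -[g [_ h]].
  by have [y gy] := surj g; exists y; split=> //; rewrite /qpre !piM piV gy.
by exists (qpi g); split=> //; rewrite -piV -!piM.
Qed.

Lemma small_pre (P Q : set X) : (exists q, Q q) -> small P Q <-> small (pre P) (pre Q).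
Proof.
by move=> nQ; rewrite /small (gd_pre nQ) (dge_pre).
Qed.

Lemma conn_quo : conn (setT : set G) -> conn (setT : set X).
Proof. by move=> cG; apply: conn_of_pre. Qed.

Lemma solv_quo c : derived L setT c `<=` [set 1] -> derived LX setT c `<=` [set gone LX].
Proof.
rewrite -(img_pre setT) (derived_img (L := L) (L' := LX) (f := qpi) piM) => hc _ [x /hc -> <-].
by [].
Qed.

Lemma gd_quo_type : gd (setT : set X) + gd A = gd (setT : set G).
Proof. by rewrite -(gd_pre) //; exists (gone LX). Qed.

(** Normalizers and conjugates commute with preimages because the projection is onto, and all
    dimensions shift by [gd A]. Connectedness of [A] enters through [conn_pre]. *)
Lemma carter_theory_quo : conn A -> carter_theory (setT : set X) [set gone LX] ->
  carter_theory (setT : set G) A.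
Proof.
move=> cA [P [[cP _ _ nP] sP [gP1 gP2] conjP]]; exists (pre P).
have gP : is_subgroup LX P by case: cP.
split; first split=> //.
- exact/conn_pre.
- exact: pre_in.
- exact/nilm_pre.
- by move=> g _ /norm_pre /sP; apply.
- split; rewrite -uniq_pre.
    by apply/(small_pre (P `\` uniq_conj setT P) (sg_ne' gP)).
  rewrite -gclos_pre.
  by apply/(small_pre (Q := setT) (setT `\` gclos setT (uniq_conj setT P))) => //; exists (gone LX).
move=> R [cR AR _ nR eR]; have gR : sg R by case: cR.
have eRR := pre_qimg gR AR; have gR' : is_subgroup LX (qimg R).
  by apply/(sg_pre nA); rewrite eRR.
have [|h [_ hP]] := conjP (qimg R).
  split=> //.
  - by apply/(conn_pre _ cA); rewrite eRR.
  - by move=> _ ->; case: gR'.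
  - by apply/nilm_pre; rewrite eRR.
  have nn : exists q, (setT `&` norm LX (qimg R)) q.
    by exists (gone LX); split=> //; case: (sg_norm LX (qimg R)).
  apply/eqP; rewrite -(eqn_add2r (gd A)); apply/eqP.
  rewrite -(gd_pre nn) -(gd_pre (sg_ne' gR')) eRR -eR.
  apply: gd_eq => x; split=> -[_ h]; split=> //.
    by rewrite -eRR; apply/norm_pre.
  by apply/norm_pre; rewrite eRR.
have [g gh] := surj h; exists g; split=> // y.
by rewrite -[R in R y]eRR /qpre hP !piM piV gh.
Qed.
End FromQuotient.
End Transport.

(** * The normalizer condition and Frattini arguments *)

Section CarterTools.
Context {d : Order.disp_t} {M : orderType d} {S : ominimal_structure M}.
Variable G : igroup S.
Local Notation L := (ilaw G).
Local Notation "x * y" := (gmul L x y).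
Local Notation "x ^-1" := (ginv L x).
Local Notation "1" := (gone L).
Local Notation sg := (is_subgroup L).
Let uG : uniform G := iunif G.
Implicit Types (A B D E F H K P Q R : set G) (x y g h : G).

(** If [H] contains a term of the lower central series of [Q], the preceding term normalizes [H],
    hence lies in it; the descent ends at [Q]. *)
Lemma norm_cond Q H c : sg H -> H `<=` Q -> sg Q -> lcs L Q c `<=` H ->
  (forall x, Q x -> norm L H x -> H x) -> Q `<=` H.
Proof.
move=> gH HQ gQ + nH; elim: c => [//|c IH] hc; apply: IH => x hx.
have key y : lcs L Q c y -> conjs L H y `<=` H.
  move=> hy z /conjsE Hz.
  rewrite (_ : z = (y * z * y^-1) * (comm L y (y * z * y^-1))^-1); last by grp.
  by apply: gH.2.1 => //; apply: gH.2.2; apply: hc; apply: commg_in => //; apply: HQ.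
apply: nH; first exact: lcs_sub hx.
apply: norm_sub; apply: key => //; exact: (sg_lcs c gQ).2.2.
Qed.

Lemma conn_conjs R g : conn R -> conn (conjs L R g).
Proof.
move=> [dR gR cR]; split; [exact: dset_conjs|exact: sg_conjs|move=> K dK gK KR e].
have eK : conjs L K g^-1 = R.
  apply: cR; [exact: dset_conjs|exact: sg_conjs| |].
    by move=> x /conjsE /KR /conjsE; rewrite (_ : _ * _ = x) //; grp.
  by rewrite gd_conjs ?e ?gd_conjs //; apply: sg_ne.
by rewrite -eK conjs_mul (_ : _ * _ = 1) ?conjs_one //; grp.
Qed.

Lemma conn_unique R R' H : dset H -> sg H -> conn R -> conn R' -> R `<=` H -> R' `<=` H ->
  gd R = gd H -> gd R' = gd H -> R = R'.
Proof.
move=> dH gH cR cR' RH R'H e e'; have [dR gR _] := cR; have [dR' gR' _] := cR'.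
rewrite eqEsubset; split; first exact: (conn_min (H := H)).
exact: (conn_min (H := H)).
Qed.

(** [R] and its conjugate are connected of full dimension in the normalizer of [R], and such a
    subgroup is unique. *)
Lemma conn_norm_normal R x : conn R -> gd (norm L R) = gd R ->
  conjs L R x `<=` norm L R -> conjs L R x = R.
Proof.
move=> cR e sR; have [dR gR _] := cR.
apply: (@conn_unique _ _ (norm L R)) => //.
- exact: dset_norm.
- exact: sg_norm.
- exact: conn_conjs.
- by move=> y Ry; apply: norm_self.
- by rewrite gd_conjs //; apply: sg_ne.
Qed.

(** By [conn_norm_normal] the normalizer of [R] is selfnormalizing, so the normalizer condition
    makes it all of [G]; connectedness of [G] then gives [R]. *)
Lemma carter_nilpotent A R c : conn (setT : set G) -> lcs L setT c `<=` A -> A `<=` R -> conn R ->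
  gd (norm L R) = gd R -> R = setT.
Proof.
move=> [dT gT cT] hc AR cR e; have [dR gR _] := cR.
have nT : setT `<=` norm L R.
  apply: (@norm_cond _ _ c) => //; first exact: sg_norm.
    by move=> x /hc /AR Rx; apply: norm_self.
  move=> x _ nx; apply/norm_conjs/conn_norm_normal => // y /conjsE Ry.
  by apply/(nx y); apply: norm_self.
apply: cT => //; rewrite -e; apply: gd_eq => x; split=> // _; exact: nT.
Qed.

(** A subgroup of full dimension meets [A] and [B] in full dimension by [gd_inter], so it contains
    both. *)
Lemma conn_prodg A B : conn A -> conn B -> (forall g, norm L A g) -> conn (prodg L A B).
Proof.
move=> [dA gA cA] [dB gB cB] nA.
have gAB : sg (prodg L A B) by apply: sg_prodg.
have dAB := dset_prodg dA dB.
split=> // K dK gK KAB e.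
have sub C : dset C -> sg C -> C `<=` prodg L A B ->
  (forall K', dset K' -> sg K' -> K' `<=` C -> gd K' = gd C -> K' = C) -> C `<=` K.
  move=> dC gC CAB cC; have <- : K `&` C = C; last by move=> x [].
  apply: cC; first by dfn.
  - exact: sg_I.
  - by move=> x [].
  - exact: (gd_inter dK dC dAB).
rewrite eqEsubset; split=> //; apply: prodg_sub => //; apply: sub => //.
  exact: prodg_l.
exact: prodg_r.
Qed.

Lemma prodg_id A H : sg H -> A `<=` H -> sg A -> prodg L A H = H.
Proof.
move=> gH AH gA; rewrite eqEsubset; split; first exact: prodg_sub.
exact: prodg_r.
Qed.

(** [A R] and [R] have the same image modulo [A], and lower central series commute with taking
    images. *)
Lemma nilm_prodg A R c : dset A -> sg A -> (forall g, norm L A g) -> lcs L R c `<=` A ->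
  lcs L (prodg L A R) c `<=` A.
Proof.
move=> dA gA nA hc x hx; have qE := qpiE gA; set f := qpi A; pose LX := ilaw (quo_igroup dA gA nA).
have fM : forall x y, f (x * y) = gmul LX (f x) (f y) by apply: (qpiM gA nA).
have fA y : f y = f 1 <-> A y.
  split=> [/esym/qE|Ay]; last apply/esym/qE.
    by rewrite (_ : _ * y = y) //; grp.
  by rewrite (_ : _ * y = y) //; grp.
have e : f @` prodg L A R = f @` R.
  apply: set_ext => q; split=> [[_ [a [r [Aa [Rr ->]]]] <-]|[r Rr <-]].
    by exists r => //; rewrite fM (fA a).2 // -fM gmul1.
  by exists r => //; exists 1, r; split; [exact: gA.1|split=> //; grp].
have : lcs LX (f @` prodg L A R) c (f x) by rewrite (lcs_img (L' := LX) fM); exists x.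
rewrite e (lcs_img (L' := LX) fM) => -[y /hc Ay yx]; apply/fA; rewrite -yx; exact/fA.
Qed.

Lemma carter_conjs H R x : dset H -> sg H -> carter H [set 1] R -> norm L H x ->
  carter H [set 1] (conjs L R x).
Proof.
move=> dH gH [cR R1 RH [c nR] eR] nx; have [dR gR _] := cR; split.
- exact: conn_conjs.
- by move=> _ ->; case: (sg_conjs x gR).
- by move=> y /conjsE /RH /nx.
- exists c; pose f y := x^-1 * y * x.
  have fM y z : f (y * z) = f y * f z by rewrite /f; grp.
  have -> : conjs L R x = f @` R by [].
  by rewrite (lcs_img fM) => _ [y /nR -> <-]; rewrite /= /f; grp.
have dn := dset_norm dR; have dHn : dset (H `&` norm L R) by dfn.
rewrite (gd_conjs x dR (sg_ne gR)) -eR -[RHS](gd_conjs x dHn); last first.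
  by exists 1; split; [case: gH|case: (sg_norm L R)].
by apply: gd_eq => y; rewrite conjsE; split=> -[h n]; split; move: h n; rewrite -/(norm L H) ?nx -?norm_conjsE // => /nx.
Qed.

Lemma frattini H R x : dset H -> sg H -> carter_theory H [set 1] -> carter H [set 1] R ->
  norm L H x -> exists h, H h /\ norm L R (x * h^-1).
Proof.
move=> dH gH [P [_ _ _ cP]] cR nx; have [h1 [Hh1 e1]] := cP R cR.
have [h2 [Hh2 e2]] := cP _ (carter_conjs dH gH cR nx).
exists (h1^-1 * h2); split; first by apply: gH.2.1 => //; apply: gH.2.2.
move=> y; have := e2 (h2^-1 * h1 * y * (h2^-1 * h1)^-1); rewrite conjsE.
rewrite (_ : h2 * _ * h2^-1 = h1 * y * h1^-1); last by grp.
by rewrite -e1 => <-; rewrite (_ : x * (h1^-1 * h2)^-1 * y * _ = x * (h2^-1 * h1 * y * (h2^-1 * h1)^-1) * x^-1) //; grp.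
Qed.

(** By [frattini] the normalizer of [H] lies in N(R) H, and N(R) meets [H] at least in [R];
    [gd_prodg] does the count. *)
Lemma frattini_gd R H : conn R -> conn H -> R `<=` H -> carter_theory H [set 1] ->
  gd (norm L R) = gd R -> nilm [set 1] R -> gd (norm L H) = gd H.
Proof.
move=> cR cH RH thH eR nR; have [dR gR _] := cR; have [dH gH _] := cH.
have dn := dset_norm dR; have gn := sg_norm L R.
have dnH := dset_norm dH; have gnH := sg_norm L H.
have carR : carter H [set 1] R.
  split=> //; first by move=> _ ->; case: gR.
  apply/eqP; rewrite eqn_leq; apply/andP; split.
    rewrite -[X in _ <= X]eR; apply: gd_sub => //; last by move=> x [].
    by exists 1; split; [case: gH|case: gn].
  apply: gd_sub => //; first exact: sg_ne.
  by move=> x Rx; split; [apply: RH|apply: norm_self].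
apply/eqP; rewrite eqn_leq; apply/andP; split; last first.
  by apply: gd_sub => //; [apply: sg_ne|move=> x hx; apply: norm_self].
have nsub : norm L H `<=` prodg L (norm L R) H.
  move=> x /(frattini dH gH thH carR) [h [hh nh]].
  by exists (x * h^-1), h; split=> //; split=> //; grp.
have h1 := gd_prodg dn dH gn gH.
have h2 : gd (norm L H) <= gd (prodg L (norm L R) H) by apply: gd_sub => //; apply: sg_ne.
have h3 : gd R <= gd (norm L R `&` H).
  apply: gd_sub => //; first exact: sg_ne.
  by move=> x Rx; split; [apply: norm_self|apply: RH].
by lia.
Qed.
End CarterTools.

(** * Dimension of a union of conjugates *)

Section GenericSets.
Context {d : Order.disp_t} {M : orderType d} {S : ominimal_structure M}.
Variable G : igroup S.
Local Notation L := (ilaw G).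
Local Notation "x * y" := (gmul L x y).
Local Notation "x ^-1" := (ginv L x).
Local Notation "1" := (gone L).
Local Notation sg := (is_subgroup L).
Let uG : uniform G := iunif G.
Local Notation GG := (prod_isort G G).
Let uGG : uniform GG := uniform_prod (iunif G) (iunif G).
Implicit Types (A B D E F H K P Q R W U : set G) (x y g h : G).

Lemma small_lt D E : (exists x, D x) -> small D E -> gd D < gd E.
Proof. by move=> nD sD; rewrite ltnNge; apply/negP => /(gdP _ uG nD). Qed.

Lemma lt_small D E : ((exists x, D x) -> gd D < gd E) -> small D E.
Proof.
by move=> h hk; have nD := dge_ne hk; have := h nD; rewrite ltnNge => /negP; apply; apply/(gdP _ uG nD).
Qed.

Lemma small_sub D D' E : D `<=` D' -> small D' E -> small D E.
Proof. by move=> DD' sD' /(dge_mono DD'). Qed.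

Lemma small_or D D1 D2 E : D `<=` D1 `|` D2 -> dset D1 -> dset D2 -> small D1 E -> small D2 E -> small D E.
Proof.
by move=> DD d1 d2 s1 s2 h; case: (dge_or d1 d2 (dge_mono DD h)).
Qed.

Lemma dset_uniq_conj H P : dset H -> dset P -> dset (uniq_conj H P).
Proof. by move=> dH dP; have dn := dset_norm dP; rewrite /uniq_conj; dfn. Qed.

Lemma dset_gclos H B : dset H -> dset B -> dset (gclos H B).
Proof. by move=> dH dB; rewrite /gclos; dfn. Qed.

Section Conjugates.
Variables (H P B : set G).
Hypotheses (dH : dset H) (gH : sg H) (dP : dset P) (gP : sg P) (dB : dset B) (neB : exists x, B x).
Let E (p : GG) := H p.1 /\ B p.2.
Let f (p : GG) : G := p.1^-1 * p.2 * p.1.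
Let df : @dmap _ _ S GG G f. Proof. by rewrite /f; dfn. Qed.
Let dE : @dset _ _ S GG E. Proof. by rewrite /E; dfn. Qed.
Let neE : exists p, E p.
Proof. by have [b Bb] := neB; exists (1, b); split=> //; case: gH. Qed.

Let fimgE y : fimg f E y <-> gclos H B y.
Proof.
split=> [[[g b] [[/= Hg Bb] <-]]|[g [Hg Bg]]].
  by exists g; split=> //; rewrite (_ : _ * _ = b) //; rewrite /f; grp.
by exists (g, g * y * g^-1); split=> //; rewrite /f /=; grp.
Qed.

(** Pairs [g], [b] with the same conjugate differ, in [g], by an element normalizing [P], because
    [b] lies in only one conjugate. The fibres therefore embed in cosets of [P]. *)
Lemma gclos_ge : (forall g, H g -> norm L P g -> P g) -> B `<=` uniq_conj H P ->
  gd H + gd B <= gd (gclos H B) + gd P.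
Proof.
move=> nP Bu; rewrite -(gd_prod uG uG dH dB (sg_ne gH) neB) -(gd_eq fimgE).
apply: (gd_fib_le uGG uG df dE) => // -[g0 b0] [/= Hg0 Bb0].
have dF : @dset _ _ S GG (fun p => E p /\ f p = f (g0, b0)) by dfn.
rewrite -(gd_inj uGG uG (dmap_fst _ _) dF) /=.
- rewrite -(gd_rcoset g0 dP (sg_ne gP)); apply: gd_sub => //; first by exists g0, (g0, b0).
  move=> _ [[g b] [[[/= Hg Bb] e] <-]] /=.
  have [Pb0 ub0] := Bu _ Bb0; have Hgg : H (g * g0^-1).
    by apply: gH.2.1 => //; apply: gH.2.2.
  apply: nP => //; apply: ub0 => //.
  rewrite (_ : _ * _ = b); first by case: (Bu _ Bb).
  have {}e : g^-1 * b * g = g0^-1 * b0 * g0 by exact: e.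
  transitivity (g * (g0^-1 * b0 * g0) * g^-1); first by grp.
  by rewrite -e; grp.
- move=> [g b] [g' b'] [_ e] [_ e'] /= gg; subst g'; congr pair.
  have : f (g, b) = f (g, b') by rewrite e e'.
  by rewrite /f /= => h; apply: gmulI (gmulIr h).
- by exists (g0, b0).
Qed.

(** [P] acts on the pairs [g], [b] without changing the conjugate they define, so every fibre has at
    least the dimension of [P]. *)
Lemma gclos_le : P `<=` H -> (forall p b, P p -> B b -> B (p * b * p^-1)) ->
  gd (gclos H B) + gd P <= gd H + gd B.
Proof.
move=> PH PB; rewrite -(gd_prod uG uG dH dB (sg_ne gH) neB) -(gd_eq fimgE).
apply: (gd_fib_ge uGG uG df dE) => // -[g0 b0] [/= Hg0 Bb0].
have dh : @dmap _ _ S G GG (fun p => (p * g0, p * b0 * p^-1)) by dfn.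
rewrite -(gd_inj uG uGG dh dP) /=.
- apply: gd_sub => //; first by exists (1 * g0, 1 * b0 * 1^-1), 1; split=> //; case: gP.
  move=> _ [p [Pp <-]]; split; last by rewrite /f /=; grp.
  by split=> /=; [apply: gH.2.1 => //; apply: PH|apply: PB].
- by move=> p p' _ _ [e _]; apply: gmulIr e.
- exact: sg_ne.
Qed.
End Conjugates.
End GenericSets.

(** * Passing from a proper subgroup [Q] to the whole group *)

Section Lifting.
Context {d : Order.disp_t} {M : orderType d} {S : ominimal_structure M}.
Variable G : igroup S.
Local Notation L := (ilaw G).
Local Notation "x * y" := (gmul L x y).
Local Notation "x ^-1" := (ginv L x).
Local Notation "1" := (gone L).
Local Notation sg := (is_subgroup L).
Let uG : uniform G := iunif G.
Implicit Types (B D E F H K P R W U : set G) (x y g h : G).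
Variables A Q : set G.
Hypotheses (cG : conn (setT : set G)) (cA : conn A) (nA : forall g, norm L A g) (cQ : conn Q)
  (AQ : A `<=` Q) (nQ : nilm A Q) (sQ : forall g, norm L Q g -> Q g) (gQ : generic setT Q).

Let dQ : dset Q. Proof. by case: cQ. Qed.
Let gpQ : sg Q. Proof. by case: cQ. Qed.
Let dA : dset A. Proof. by case: cA. Qed.
Let gA : sg A. Proof. by case: cA. Qed.
Let dT : @dset _ _ S G setT. Proof. by case: cG. Qed.

(* A generic element of [P] that lies in no other conjugate of [Q] lies in no *)
(* other conjugate of [P].                                                    *)
Lemma generic_trans P : conn P -> P `<=` Q -> (forall g, Q g -> norm L P g -> P g) ->
  generic Q P -> generic setT P.
Proof.
move=> [dP gP _] PQ sP [sm1 sm2]; have [sm3 sm4] := gQ.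
set W := uniq_conj Q P in sm1 sm2; set U := uniq_conj setT Q in sm3 sm4.
have dW : dset W by apply: dset_uniq_conj.
have dU : dset U by apply: dset_uniq_conj.
have WU : W `&` U `<=` uniq_conj setT P.
  move=> x [[Px hW] [Qx hU]]; split=> // g _ hg; apply: hW => //.
  by apply/sQ/hU => //; apply: PQ.
have Uinv q x : Q q -> U x -> U (q * x * q^-1).
  move=> Qq [Qx hx]; split; first by apply/(norm_self gpQ Qq x).
  move=> g _ hg; have : norm L Q (g * q).
    by apply: hx => //; rewrite (_ : _ * _ = g * (q * x * q^-1) * g^-1) //; grp.
  move=> /sQ Qgq; apply: norm_self => //; rewrite (_ : g = g * q * q^-1); last by grp.
  by apply: gpQ.2.1 => //; apply: gpQ.2.2.
have dPU : dset (P `\` U) by rewrite /setD /mkset; dfn.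
have dPW : dset (P `\` W) by rewrite /setD /mkset; dfn.
have dPUW : dset ((P `\` U) `&` W) by rewrite /setD /mkset; dfn.
(* If the part of [P] outside [U] had full dimension, so would its intersection with [W], whose
   [Q]-conjugates would have the dimension of [Q] by [gclos_ge]. They lie outside [U], however. *)
have smPU : small (P `\` U) P.
  apply: (small_or (D1 := P `\` W) (D2 := (P `\` U) `&` W)) => //.
    by move=> x [Px nU]; have [Wx|nW] := pselect (W x); [right|left].
  apply: lt_small => nD; rewrite ltnNge; apply/negP => leD.
  have := gclos_ge dQ gpQ dP gP dPUW nD sP (@subIsetr _ _ _).
  have : gd (gclos Q ((P `\` U) `&` W)) < gd Q.
    have [x [[Px nUx] Wx]] := nD.
    apply: (@leq_ltn_trans (gd (Q `\` U))); last first.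
      by apply: small_lt sm3; exists x; split=> //; apply: PQ.
    apply: gd_sub => //; first by exists x, 1; split; [case: gpQ|rewrite (_ : _ * _ = x) //; grp].
    move=> y [q [Qq [[Py nU] Wy]]]; split; first by apply/(norm_self gpQ Qq y)/PQ.
    by move=> Uy; apply: nU; apply: Uinv.
  by lia.
split.
  apply: (small_or (D1 := P `\` W) (D2 := P `\` U)) => // x [Px nx].
  have [Wx|nW] := pselect (W x); last by left.
  by right; split=> // Ux; apply/nx/WU.
have dWU : dset (W `&` U) by dfn.
(* The exceptional part of [U]: it is invariant under [Q] and small in [Q], so by [gclos_le] its
   conjugates form a small set in [G]. *)
pose B := U `\` gclos Q (W `&` U).
have dB : dset B by have dg := dset_gclos dQ dWU; rewrite /B /setD /mkset; dfn.
have dgU : dset (setT `\` gclos setT U) by have dg := dset_gclos dT dU; rewrite /setD /mkset; dfn.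
apply: (small_or (D1 := setT `\` gclos setT U) (D2 := gclos setT B)) => //.
- move=> x [_ nx]; have [[g [_ Ug]]|nU] := pselect (gclos setT U x); last by left.
  right; exists g; split=> //; split=> // -[q [Qq WUq]]; apply: nx.
  exists (q * g); split=> //; apply: WU.
  by rewrite (_ : _ * _ = q * (g * x * g^-1) * q^-1) //; grp.
- exact: dset_gclos.
apply: lt_small => -[x [g [_ Bg]]].
have nB : exists x, B x by eexists; exact: Bg.
have Binv q b : Q q -> B b -> B (q * b * q^-1).
  move=> Qq [Ub nb]; split; first exact: Uinv.
  move=> [q' [Qq' h]]; apply: nb; exists (q' * q); split; first exact: gpQ.2.1.
  by rewrite (_ : _ * _ = q' * (q * b * q^-1) * q'^-1) //; grp.
have := gclos_le dT (sg_T L) dQ gpQ dB nB (fun _ _ => I) Binv.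
have : gd B < gd Q.
  have BQ : B `<=` Q `\` gclos Q W.
    move=> y [Uy ny]; split; first by case: Uy.
    by move=> [q [Qq Wq]]; apply: ny; exists q; split=> //; split=> //; apply: Uinv.
  by apply: small_lt nB _; apply: small_sub BQ sm2.
by lia.
Qed.

Hypothesis conjQ : forall R, carter setT A R -> exists h, setT h /\ forall y, R y <-> Q (h * y * h^-1).
Hypothesis QT : Q <> setT.
Hypothesis IH : forall H, conn H -> gd H < gd (setT : set G) -> carter_theory H [set 1].

Lemma proper_lt H : conn H -> H <> setT -> gd H < gd (setT : set G).
Proof.
move=> [dH gH _] HT; rewrite ltn_neqAle gd_sub ?andbT //; last exact: sg_ne.
by apply/eqP => e; apply: HT; case: cG => _ _; apply.
Qed.

(** A Carter subgroup [P] of [Q] satisfies [A P = Q], which controls its normalizer in [G]. For any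
    other Carter subgroup [R] of [G], the product [A R] is Carter modulo [A], so it can be
    conjugated onto [Q]; then [R] is conjugate to [P] inside [Q]. *)
Lemma carter_theory_lift : carter_theory (setT : set G) [set 1].
Proof.
have [P [[cP _ PQ nP] sP gP conjP]] := IH cQ (proper_lt cQ QT).
have [dP gpP _] := cP; have P1 : [set 1] `<=` P by move=> _ ->; case: gpP.
have carterP K : conn K -> P `<=` K -> K `<=` Q -> carter K [set 1] P.
  move=> cK PK KQ; split=> //; apply: gd_eq => x; split=> [[Kx nx]|Px].
    by apply: sP => //; apply: KQ.
  by split; [apply: PK|apply: norm_self].
(* [Q / A] is nilpotent, and [A P] is its own normalizer in [Q]: by the Frattini argument, an
   element of [Q] normalizing [A P] normalizes [P] up to a factor in [A P]. *)
have PAQ : prodg L A P = Q.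
  have cPA := conn_prodg cA cP nA; have [dPA gPA _] := cPA.
  have PAQ : prodg L A P `<=` Q by apply: prodg_sub.
  have PPA : P `<=` prodg L A P by apply: prodg_r.
  rewrite eqEsubset; split=> //; have [c hc] := nQ.
  apply: (norm_cond (c := c)) => //; first by move=> x /hc; apply: prodg_l.
  move=> x Qx nx; have thPA : carter_theory (prodg L A P) [set 1].
    by apply: IH => //; apply: leq_ltn_trans (proper_lt cQ QT); apply: gd_sub => //; apply: sg_ne.
  have [h [hPA nh]] := frattini dPA gPA thPA (carterP _ cPA PPA PAQ) nx.
  rewrite (_ : x = x * h^-1 * h); last by grp.
  apply: gPA.2.1 => //; apply: PPA; apply: sP => //; apply: gpQ.2.1 => //.
  by apply: gpQ.2.2; apply: PAQ.
(* An element normalizing [P] normalizes [A P = Q], so it lies in [Q] and then in [P]. *)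
have sPT g : norm L P g -> P g.
  move=> ng; apply: sP => //; apply: sQ; rewrite -PAQ => y; split=> -[a [p [Aa [Pp e]]]].
    exists (g^-1 * a * g^-1^-1), (g^-1 * p * g^-1^-1); split; first by apply/(norm_inv (nA g) a).
    split; first by apply/(norm_inv ng p).
    by transitivity (g^-1 * (g * y * g^-1) * g); [grp|rewrite e; grp].
  exists (g * a * g^-1), (g * p * g^-1); split; first exact/nA.
  by split; [apply/ng|rewrite e; grp].
exists P; split; first by split.
- by move=> g _; apply: sPT.
- exact: generic_trans.
move=> R [cR R1 _ [c nR] eR]; have [dR gR _] := cR.
have {}eR : gd (norm L R) = gd R by rewrite -eR; apply: gd_eq => x; split=> [|[]].
have cRA := conn_prodg cA cR nA; have [dRA gRA _] := cRA.
have lRA : lcs L (prodg L A R) c `<=` A.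
  by apply: nilm_prodg => // x /nR ->; case: gA.
have RRA : R `<=` prodg L A R by apply: prodg_r.
have ARA : A `<=` prodg L A R by apply: prodg_l.
(* Otherwise [G / A] would be nilpotent with a proper selfnormalizing subgroup [Q / A]. *)
have RAT : prodg L A R <> setT.
  move=> e; apply: QT; rewrite eqEsubset; split=> //.
  apply: (norm_cond (c := c)) => //; first by rewrite -e => x /lRA /AQ.
  by move=> x _ /sQ.
have thRA := IH cRA (proper_lt cRA RAT).
have eRA : gd (setT `&` norm L (prodg L A R)) = gd (prodg L A R).
  rewrite -(frattini_gd cR cRA RRA thRA eR); last by exists c.
  by apply: gd_eq => x; split=> [[]|].
have [|h [_ hQ]] := conjQ (R := prodg L A R); first by split=> //; exists c.
have RhQ : conjs L R h^-1 `<=` Q.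
  move=> y /conjsE Ry; have /hQ := RRA _ Ry.
  by rewrite (_ : _ * _ = y) //; grp.
have [|k [Qk hk]] := conjP (conjs L R h^-1).
  have [||cR' R1' _ nR' eR'] := carter_conjs (H := setT) (R := R) (x := h^-1) dT (sg_T L); last 1 first.
  - split=> //; apply/eqP; rewrite eqn_leq; apply/andP; split.
      rewrite -eR'; apply: gd_sub => //; last by move=> x [].
      by exists 1; split; [case: gpQ|case: (sg_norm L (conjs L R h^-1))].
    apply: gd_sub => //; first by apply: sg_ne; apply: sg_conjs.
    by move=> x Rx; split; [apply: RhQ|apply: norm_self => //; apply: sg_conjs].
  - split=> //; first by exists c.
    by rewrite -eR; apply: gd_eq => x; split=> [[]|].
  - by [].
exists (k * h); split=> // y.
have := hk (h * y * h^-1); rewrite conjsE.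
rewrite (_ : h^-1 * _ * _ = y); last by grp.
by rewrite (_ : k * (h * y * h^-1) * k^-1 = k * h * y * (k * h)^-1) //; grp.
Qed.
End Lifting.

(** * Central series *)

Section Centers.
Context {d : Order.disp_t} {M : orderType d} {S : ominimal_structure M}.
Variable G : igroup S.
Local Notation L := (ilaw G).
Local Notation "x * y" := (gmul L x y).
Local Notation "x ^-1" := (ginv L x).
Local Notation "1" := (gone L).
Local Notation sg := (is_subgroup L).
Local Notation conj := (conj L).
Local Notation comm := (comm L).
Let uG : uniform G := iunif G.
Implicit Types (A B D E F H K P Q R W U : set G) (x y g h : G).

Lemma dset_one : @dset _ _ S G [set 1].
Proof. by rewrite /set1 /mkset; dfn. Qed.

Lemma commV x y : comm y x = (comm x y)^-1. Proof. by grp. Qed.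
Lemma comm1g T (L' : group_law T) (u : T) : Defs.comm L' (gone L') u = gone L'. Proof. by grp. Qed.
Lemma comm_eq1 x y : comm x y = 1 <-> conj x y = x.
Proof.
split=> e; first by transitivity (x * comm x y); [grp|rewrite e; grp].
by transitivity (x^-1 * conj x y); [grp|rewrite e; grp].
Qed.
Lemma comm1C x y : comm x y = 1 -> comm y x = 1.
Proof. by rewrite (commV x y) => ->; grp. Qed.

Lemma norm_of_inv F : (forall a y, F a -> F (conj a y)) -> forall g, norm L F g.
Proof.
move=> h g; apply: norm_sub => y; rewrite conjsE => Fy.
  by rewrite (_ : y = conj (g * y * g^-1) g); [apply: h|grp].
by rewrite (_ : y = conj (g^-1 * y * g^-1^-1) g^-1); [apply: h|grp].
Qed.

Lemma norm_one g : norm L [set 1] g.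
Proof. by apply: norm_of_inv => a y -> /=; grp. Qed.

Lemma inv_of_norm F : (forall g, norm L F g) -> forall a y, F a -> F (conj a y).
Proof. by move=> nF a y Fa; apply/(nF y); rewrite (_ : _ * _ = a) //; grp. Qed.

(** The map from [y] to [[x, y]] has an image of dimension 0, and its fibres are cosets of the
    centralizer of [x] in [H]. So the centralizer has full dimension and is [H]. *)
Lemma central_small x H F : conn H -> dset F -> gd F = 0 -> (forall y, H y -> F (comm x y)) ->
  forall y, H y -> comm x y = 1.
Proof.
move=> [dH gH cH] dF F0 HF; pose K y := H y /\ comm x y = 1.
have [H1 [HM HV]] := gH.
have dK : dset K by rewrite /K /Defs.comm; dfn.
have gK : sg K.
  split; [by split=> //; grp|split].
    move=> y z [Hy ey] [Hz ez]; split; first exact: HM.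
    by transitivity (comm x z * (z^-1 * comm x y * z)); [grp|rewrite ey ez; grp].
  move=> y [Hy ey]; split; first exact: HV.
  by transitivity (y * (comm x y)^-1 * y^-1); [grp|rewrite ey; grp].
have df : @dmap _ _ S G G (fun y => comm x y) by rewrite /Defs.comm; dfn.
suff e : gd K = gd H by move=> y; rewrite -(cH K) // => [[]|z []].
have -> : gd H = gd (fimg (fun y => comm x y) H) + gd K.
  apply: gd_fib => //; first exact: sg_ne.
  move=> y Hy; rewrite -[RHS](gd_rcoset y dK (sg_ne gK)); apply: gd_eq => z.
  have E : comm x (z * y^-1) = y * ((comm x y)^-1 * comm x z) * y^-1 by grp.
  split=> [[Hz e]|[Hz e]].
    by split; [apply: (HM) => //; apply: HV|rewrite E e; grp].
  split; first by rewrite (_ : z = z * y^-1 * y); [apply: HM|grp].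
  apply: (@gmulI _ L (comm x y)^-1); apply: (@gmulI _ L y); apply: (@gmulIr _ L y^-1).
  by rewrite -E e; grp.
suff -> : gd (fimg (fun y => comm x y) H) = 0 by [].
apply/eqP; rewrite -leqn0 -F0; apply: gd_sub => //; first by exists (comm x 1), 1.
by move=> _ [y [Hy <-]]; apply: HF.
Qed.

Lemma normal_small_central F : conn (setT : set G) -> dset F -> sg F -> (forall g, norm L F g) -> gd F = 0 ->
  forall a y, F a -> comm a y = 1.
Proof.
move=> cG dF gF nF F0 a y Fa; apply: (central_small cG dF F0) => // z _.
rewrite (_ : comm a z = a^-1 * conj a z); last by grp.
by apply: gF.2.1; [apply: gF.2.2|apply: inv_of_norm].
Qed.

(* The preimage of the center of [G / K]. *)
Definition up K : set G := fun x => forall y, K (comm x y).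

Lemma dset_up K : dset K -> dset (up K).
Proof. by move=> dK; rewrite /up /Defs.comm; dfn. Qed.

Lemma sg_up K : sg K -> (forall g, norm L K g) -> sg (up K).
Proof.
move=> [K1 [KM KV]] nK; split; [|split].
- by move=> y; rewrite (_ : comm 1 y = 1) //; grp.
- move=> x x' hx hx' y; rewrite (_ : comm _ _ = conj (comm x y) x' * comm x' y); last by grp.
  by apply: KM => //; apply: inv_of_norm.
- move=> x hx y; rewrite (_ : comm _ _ = conj (comm x y)^-1 x^-1); last by grp.
  by apply: inv_of_norm => //; apply: KV.
Qed.

Lemma norm_up K : (forall g, norm L K g) -> forall g, norm L (up K) g.
Proof.
move=> nK; apply: norm_of_inv => x g hx y.
by rewrite (_ : comm _ _ = conj (comm x (g * y * g^-1)) g); [apply: inv_of_norm|grp].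
Qed.

Lemma sub_up K : sg K -> (forall g, norm L K g) -> K `<=` up K.
Proof.
move=> [_ [KM KV]] nK x Kx y; rewrite (_ : comm _ _ = x^-1 * conj x y); last by grp.
by apply: KM; [apply: KV|apply: inv_of_norm].
Qed.

Lemma lcs_down (P : set G) c : lcs L setT c `<=` P -> (forall x, (forall y, P (comm x y)) -> P x) -> forall x, P x.
Proof.
move=> + hP; elim: c => [h x|c IH h]; first exact: h.
by apply: IH => z hz; apply: hP => y; apply: h; apply: commg_in.
Qed.

(** If the center has dimension 0, then by [central_small] an element that is central modulo the
    center is central. The lower central series propagates this to all of [G], which then has
    dimension 0 and is trivial by connectedness. *)
Lemma nilpotent_center c : conn (setT : set G) -> lcs L setT c `<=` [set 1] -> gd (up [set 1]) = 0 ->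
  forall x, x = 1.
Proof.
move=> cG hc Z0; have nZ := norm_one.
have gZ := sg_up (sg_1 L) nZ; have dZ := dset_up dset_one.
have allZ : forall x, up [set 1] x.
  apply: (lcs_down (c := c)) => [x /hc|x hx y]; first exact: (sub_up (sg_1 L) nZ).
  exact: (central_small cG dZ Z0).
move=> x; suff : [set 1] x by [].
have [_ _ cT] := cG; rewrite (cT [set 1]) //; [exact: dset_one|exact: sg_1|].
rewrite (gd_singleton uG) => [|? ? -> ->] //; apply/esym/eqP; rewrite -leqn0 -Z0.
by apply: gd_sub => //; exists 1.
Qed.
End Centers.

Section CenterQuotient.
Context {d : Order.disp_t} {M : orderType d} {S : ominimal_structure M}.
Variable G : igroup S.
Local Notation L := (ilaw G).

Lemma center_quo (K : set G) c : conn (setT : set G) -> dset K -> is_subgroup L K ->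
  (forall g, norm L K g) -> lcs L setT c `<=` K -> gd (up K) = gd K -> forall x, K x.
Proof.
move=> cG dK gK nK hc e x; pose X := quo_igroup dK gK nK.
have cX : conn (setT : set X) by apply: conn_quo.
have piM : forall x y : G, qpi K (gmul L x y) = gmul (ilaw X) (qpi K x) (qpi K y) by apply: (qpiM gK nK).
have [|c' hc'] := (nilm_pre (nA := nK) (dA := dK) (gA := gK) (setT : set X)).2; first by exists c.
have q1 y : qpi K y = gone (ilaw X) <-> K y.
  split=> [/esym/(qpiE (gK))|Ky]; last apply/esym/(qpiE (gK)).
    by rewrite (_ : gmul _ _ y = y) //; grp.
  by rewrite (_ : gmul _ _ y = y) //; grp.
apply/q1; apply: (nilpotent_center cX hc').
have ne : exists q, @up _ _ _ X [set gone (ilaw X)] q.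
  by exists (gone (ilaw X)) => q; apply: (comm1g (ilaw X)).
apply/eqP; rewrite -(eqn_add2r (gd K)) add0n -(gd_pre ne) -e; apply/eqP/gd_eq => y.
split=> [h z|h q].
  by have hz := h (qpi K z); apply/q1; rewrite (hom_comm piM); apply: hz.
have [z <-] := qpi_surj q.
have : qpi K (comm L y z) = gone (ilaw X) by apply/q1.
by rewrite (hom_comm piM).
Qed.
End CenterQuotient.

(** * Abelian normal subgroups with nilpotent quotient *)

Section Complement.
Context {d : Order.disp_t} {M : orderType d} {S : ominimal_structure M}.
Variable G : igroup S.
Local Notation L := (ilaw G).
Local Notation "x * y" := (gmul L x y).
Local Notation "x ^-1" := (ginv L x).
Local Notation "1" := (gone L).
Local Notation sg := (is_subgroup L).
Local Notation conj := (conj L).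
Local Notation comm := (comm L).
Let uG : uniform G := iunif G.
Implicit Types (B D E F H K P Q R W : set G) (x y g h : G).

Variables (A : set G) (c0 : nat).
Hypotheses (cG : conn (setT : set G)) (cA : conn A) (nA : forall g, norm L A g).
Hypothesis Amin : forall K, dset K -> sg K -> (forall g, norm L K g) -> K `<=` A -> K = A \/ gd K = 0.
Hypothesis abA : forall a b, A a -> A b -> a * b = b * a.
Hypothesis lcsA : lcs L setT c0 `<=` A.
Hypothesis nnil : forall c, ~ lcs L setT c `<=` [set 1].

Let dA : dset A. Proof. by case: cA. Qed.
Let gA : sg A. Proof. by case: cA. Qed.
Let A1 : A 1. Proof. by case: gA. Qed.
Let AM x y : A x -> A y -> A (x * y). Proof. exact: gA.2.1. Qed.
Let AV x : A x -> A x^-1. Proof. exact: gA.2.2. Qed.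
Let Aconj a x : A a -> A (conj a x). Proof. exact: inv_of_norm. Qed.
Let Acomm a x : A a -> A (comm a x).
Proof. by move=> Aa; rewrite (_ : comm a x = a^-1 * conj a x); [apply: AM; [apply: AV|apply: Aconj]|grp]. Qed.
Let dT : @dset _ _ S G setT. Proof. by case: cG. Qed.
Let conjM a x y : conj a (x * y) = conj (conj a x) y. Proof. by grp. Qed.
Let conjD a b x : conj (a * b) x = conj a x * conj b x. Proof. by grp. Qed.
Let conjN a x : conj a^-1 x = (conj a x)^-1. Proof. by grp. Qed.
Let conjK a x : conj (conj a x) x^-1 = a. Proof. by grp. Qed.
Let conjVK a x : conj (conj a x^-1) x = a. Proof. by grp. Qed.

Let conjA a b : A a -> A b -> conj a b = a.
Proof. by move=> Aa Ab; rewrite /Defs.conj -gmulA abA //; [grp|apply: AV|apply: AM]. Qed.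

Definition centA : set G := fun x => forall a, A a -> comm a x = 1.
Local Notation C := centA.
Definition upA : set G := up C.
Local Notation U := upA.
Definition fixA x : set G := fun a => A a /\ conj a x = a.
Local Notation V := fixA.

Let Cfix x a : C x -> A a -> conj a x = a.
Proof. by move=> Cx Aa; apply/comm_eq1/Cx. Qed.
Let fixC x : (forall a, A a -> conj a x = a) -> C x.
Proof. by move=> h a Aa; apply/comm_eq1/h. Qed.

Let AC : A `<=` C. Proof. by move=> x Ax; apply: fixC => a Aa; apply: conjA. Qed.

Let dC : dset C. Proof. by rewrite /centA /Defs.comm; dfn. Qed.
Let gC : sg C.
Proof.
split; [|split].
- by apply: fixC => a _; grp.
- by move=> x y Cx Cy; apply: fixC => a Aa; rewrite conjM !Cfix.
- by move=> x Cx; apply: fixC => a Aa; rewrite -{1}(Cfix Cx Aa) conjK.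
Qed.
Let nC g : norm L C g.
Proof.
apply: norm_of_inv => {g} x g Cx; apply: fixC => a Aa.
rewrite (_ : conj a (conj x g) = conj (conj (conj a g^-1) x) g); last by grp.
by rewrite (Cfix Cx) ?conjVK //; apply: Aconj.
Qed.
Let dU : dset U. Proof. exact: dset_up. Qed.
Let gU : sg U. Proof. exact: sg_up. Qed.
Let nU g : norm L U g. Proof. exact: norm_up. Qed.
Let CU : C `<=` U. Proof. exact: sub_up. Qed.

(** [u] and [y] commute modulo C_G(A), so [U] acts on [A] by [G]-equivariant maps; kernels and
    images of such maps are normal in [G]. *)
Let U_comm u y a : U u -> A a -> conj (conj a u) y = conj (conj a y) u.
Proof.
move=> Uu Aa; rewrite -!conjM (_ : u * y = y * u * comm u y); last by grp.
by rewrite conjM Cfix //; apply: Aconj.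
Qed.

Let gV x : sg (V x).
Proof.
split; [by split=> //; grp|split].
  move=> a b [Aa ea] [Ab eb]; split; first exact: AM.
  by rewrite conjD ea eb.
move=> a [Aa ea]; split; first exact: AV.
by rewrite conjN ea.
Qed.
Let dV x : dset (V x). Proof. by rewrite /fixA /Defs.conj; dfn. Qed.
Let V_U x u a : U u -> V x a -> V x (conj a u).
Proof. by move=> Uu [Aa e]; split; [apply: Aconj|rewrite U_comm // e]. Qed.

Let commAl a b x : A a -> A b -> comm (a * b) x = comm a x * comm b x.
Proof.
move=> Aa Ab; rewrite (_ : comm _ x = conj (comm a x) b * comm b x); last by grp.
by rewrite conjA //; apply: Acomm.
Qed.
Let commAV a x : A a -> comm a^-1 x = (comm a x)^-1.
Proof.
move=> Aa; have : comm (a^-1 * a) x = 1 by rewrite gmulV; grp.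
by rewrite commAl //; [move=> e; rewrite -[LHS](gmulr1 L) -(gmulrV L (comm a x)) gmulA e gmul1|apply: AV].
Qed.

Let img x := fimg (fun a => comm a x) A.
Let dimg x : dset (img x).
Proof. by rewrite /img /fimg /Defs.comm; dfn. Qed.
Let gimg x : sg (img x).
Proof.
split; [by exists 1; split=> //; grp|split].
  by move=> _ _ [a [Aa <-]] [b [Ab <-]]; exists (a * b); split; [apply: AM|apply: commAl].
by move=> _ [a [Aa <-]]; exists a^-1; split; [apply: AV|apply: commAV].
Qed.
Let imgA x : img x `<=` A. Proof. by move=> _ [a [Aa <-]]; apply: Acomm. Qed.

Let not_small u F : ~ C u -> dset F -> sg F -> gd F = 0 -> (forall a, A a -> F (comm a u)) -> False.
Proof.
move=> nCu dF gF F0 hF; apply: nCu => a Aa; apply: comm1C.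
apply: (central_small cA dF F0) Aa => b Ab.
by rewrite commV; apply: gF.2.2; apply: hF.
Qed.

(** Schur's lemma up to dimension 0. By minimality the kernel [V u] of the map [[., u]] and the
    kernel [F] of its square have dimension 0, hence are central, so [F] lies in [V u]. The image is
    all of [A]; an element of the kernel is therefore [[b, u]] with [b] in [F], which is 1. *)
Lemma fixed_U u a : U u -> ~ C u -> V u a -> a = 1.
Proof.
move=> Uu nCu.
have nV g : norm L (V u) g.
  by apply: norm_of_inv => b y [Ab e]; split; [apply: Aconj|rewrite -U_comm // e].
have V0 : gd (V u) = 0.
  have [|e|//] := Amin (dV u) (gV u) nV; first by move=> b [].
  by case: nCu; apply: fixC => b; rewrite -{1}e => -[].
have Vc := normal_small_central cG (dV u) (gV u) nV V0.
pose F b := A b /\ V u (comm b u).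
have dF : dset F by rewrite /F /fixA /Defs.conj /Defs.comm; dfn.
have gF : sg F.
  split; [by split=> //; rewrite comm1g; case: (gV u)|split].
    move=> b b' [Ab h] [Ab' h']; split; first exact: AM.
    by rewrite commAl //; apply: (gV u).2.1.
  by move=> b [Ab h]; split; [apply: AV|rewrite commAV //; apply: (gV u).2.2].
have nF g : norm L F g.
  apply: norm_of_inv => b y [Ab h]; split; first exact: Aconj.
  rewrite (_ : comm (conj b y) u = conj (comm b u) y); first exact: inv_of_norm.
  rewrite (_ : comm _ u = (conj b y)^-1 * conj (conj b y) u); last by grp.
  by rewrite -U_comm //; grp.
have F0 : gd F = 0.
  have [|e|//] := Amin dF gF nF; first by move=> b [].
  by case: (not_small nCu (dV u) (gV u) V0) => b; rewrite -{1}e => -[].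
have Fc := normal_small_central cG dF gF nF F0.
have FV b : F b -> V u b by move=> Fb; split; [case: Fb|apply/comm_eq1/Fc].
have imA : img u = A.
  have nI g : norm L (img u) g.
    apply: norm_of_inv => _ y [b [Ab <-]]; exists (conj b y); split; first exact: Aconj.
    rewrite (_ : comm _ u = (conj b y)^-1 * conj (conj b y) u); last by grp.
    by rewrite -U_comm //; grp.
  have [//|I0] := Amin (dimg u) (gimg u) nI (@imgA u).
  by case: (not_small nCu (dimg u) (gimg u) I0) => b Ab; exists b.
move=> Va; have [Aa _] := Va; rewrite -imA in Aa; case: Aa => b [Ab e].
by rewrite -e; apply/comm_eq1; apply: (FV b _).2; split=> //; rewrite e.
Qed.

(** An injective endomorphism of [A] has an image of full dimension, which is [A] by
    connectedness. *)
Lemma img_full x : (forall a, V x a -> a = 1) -> forall b, A b -> exists a, A a /\ comm a x = b.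
Proof.
move=> Vx b Ab; suff : img x b by [].
have df : @dmap _ _ S G G (fun a => comm a x) by rewrite /Defs.comm; dfn.
have [_ _ cA3] := cA; rewrite (cA3 (img x)) //.
apply: gd_inj => //; last by exists 1.
move=> a a' Aa Aa' e; have AV' := AV Aa'.
have /Vx h : V x (a * a'^-1).
  by split; [apply: AM|apply/comm_eq1; rewrite commAl // commAV // e gmulrV].
by transitivity (a * a'^-1 * a'); [grp|rewrite h; grp].
Qed.

Let exists_U : exists u, U u /\ ~ C u.
Proof.
apply: contrapT => nex; have UC x : U x -> C x.
  by move=> Ux; apply: contrapT => nCx; apply: nex; exists x.
have allC : forall x, C x by apply: (lcs_down (c := c0)) => [x /lcsA /AC|x /UC].
apply: (nnil (c := c0.+1)); apply: commg_sub; first exact: sg_1.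
by move=> x y /lcsA Ax _; apply: allC.
Qed.

Let C_proper : ~ forall x, C x.
Proof. by have [u [_ nC']] := exists_U; move=> /(_ u). Qed.

Hypothesis Z0 : gd (@up _ _ _ G [set 1]) = 0.

(** Suppose that [up A] centralizes [A]. For [u] in [U] outside [C], surjectivity of [[., u]] gives
    [up A = A B], where [B] is the centralizer of [u] in [up A]. This [B] turns out to be central,
    so it has dimension 0. Then [up A] has the dimension of [A], and [center_quo] collapses [G] to
    [A], which is impossible. *)
Lemma exists_central : exists g, up A g /\ ~ C g.
Proof.
apply: contrapT => nex; have NC x : up A x -> C x.
  by move=> Ux; apply: contrapT => nCx; apply: nex; exists x.
have [u [Uu nCu]] := exists_U; have Vu := fixed_U Uu nCu.
pose B x := up A x /\ comm x u = 1.
have dN := dset_up dA; have gN := sg_up gA nA.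
have dB : dset B by rewrite /B /Defs.comm; dfn.
have NAB : up A `<=` prodg L A B.
  move=> x Nx; have [a [Aa ea]] := img_full Vu (AV (Nx u)).
  exists a^-1, (a * x); split; [exact: AV|split; last by grp].
  split; first by apply: gN.2.1 => //; apply: sub_up.
  rewrite (_ : comm _ u = conj (comm a u) x * comm x u); last by grp.
  by rewrite ea Cfix ?gmulV //; [apply: NC|apply: AV].
have BC b x : B b -> C x -> comm b x = 1.
  move=> [Nb eb]; have Cb := NC _ Nb.
  (* Descending induction along the lower central series. If [b] commutes with [[y, u]], which lies
     one term further down, then [[b, y]] is fixed by [u], and it is in [A], so it is 1. *)
  have : forall j, lcs L setT j x -> C x -> comm b x = 1; last by move=> /(_ 0); apply.
  have key : forall i j x, (i + j = c0)%N -> lcs L setT j x -> C x -> comm b x = 1.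
    elim=> [|i IH] j y; first by rewrite add0n => -> /lcsA Ay _; apply/comm1C/Cb.
    move=> ij hy Cy; apply: Vu; split; first exact: Nb.
    have e1 : comm b (comm y u) = 1.
      apply: (IH j.+1); [by rewrite -ij addnS|exact: commg_in|].
      exact: CU.
    have ebu : conj b u = b by apply/comm_eq1.
    rewrite (_ : conj (comm b y) u = comm (conj b u) (y * comm y u)); last by grp.
    rewrite ebu (_ : comm b _ = comm b (comm y u) * conj (comm b y) (comm y u)); last by grp.
    by rewrite e1 gmul1; apply: Cfix; [apply: CU|apply: Nb].
  by move=> j hj Cx; apply: (key c0 0) => //; rewrite addn0.
have BZ b : B b -> up [set 1] b.
  move=> Bb y; apply: Vu; have [Nb eb] := Bb; split; first exact: Nb.
  have ebu : conj b u = b by apply/comm_eq1.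
  rewrite (_ : conj (comm b y) u = comm (conj b u) (y * comm y u)); last by grp.
  have Cyu : C (comm y u) by rewrite commV; apply: gC.2.2; apply: Uu.
  rewrite ebu (_ : comm b _ = comm b (comm y u) * conj (comm b y) (comm y u)); last by grp.
  by rewrite (BC _ _ Bb Cyu) gmul1; apply: Cfix => //; apply: Nb.
have gB : sg B.
  split; [split; [by case: gN|exact: comm1g]|split].
    move=> x y [Nx ex] [Ny ey]; split; first exact: gN.2.1.
    rewrite (_ : comm _ u = conj (comm x u) y * comm y u); last by grp.
    by rewrite ex ey; grp.
  move=> x [Nx ex]; split; first exact: gN.2.2.
  by transitivity (conj (comm x u)^-1 x^-1); [grp|rewrite ex; grp].
have AN : A `<=` up A by apply: sub_up.
have eN : gd (up A) = gd A.
  apply/eqP; rewrite eqn_leq; apply/andP; split; last by apply: gd_sub => //; apply: sg_ne.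
  have h1 := gd_prodg dA dB gA gB.
  have h2 : gd (up A) <= gd (prodg L A B) by apply: gd_sub => //; apply: sg_ne.
  have h3 : gd B <= 0 by rewrite -Z0; apply: gd_sub => //; apply: sg_ne.
  by lia.
have allA := center_quo cG dA gA nA lcsA eN.
by apply: C_proper => x; apply: AC.
Qed.

Definition bad x := exists a, V x a /\ a <> 1.

Let V1 x a : ~ bad x -> V x a -> a = 1.
Proof. by move=> nb Va; apply: contrapT => ne; apply: nb; exists a. Qed.

Let dbad : dset bad.
Proof. by rewrite /bad /fixA /Defs.conj; dfn. Qed.

Let gdCU : gd C < gd U.
Proof.
rewrite ltn_neqAle gd_sub ?andbT //; last exact: sg_ne.
apply/eqP => e; apply: C_proper.
by apply: (center_quo (c := c0) cG) => // x /lcsA /AC.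
Qed.

(** [U] acts on C_A(x). If that group had dimension 0, the connected component of [U] would
    centralize it; this component is not contained in [C] for dimension reasons, so [fixed_U] would
    make the group trivial. *)
Let V_infinite x : bad x -> 0 < gd (V x).
Proof.
move=> [a [Va a1]]; rewrite lt0n; apply/eqP => V0.
have [U0 [cU0 U0U eU0 _]] := component_exists dU gU; have [dU0 gU0 _] := cU0.
have [w [U0w nCw]] : exists w, U0 w /\ ~ C w.
  apply: contrapT => nex; have : gd U0 <= gd C; last by rewrite eU0 leqNgt gdCU.
  apply: gd_sub => //; first exact: sg_ne.
  by move=> w U0w; apply: contrapT => nC'; apply: nex; exists w.
apply: a1; apply: (fixed_U (U0U _ U0w) nCw); split; first by case: Va.
apply/comm_eq1; apply: (central_small cU0 (dV x) V0) U0w => y U0y.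
rewrite (_ : comm a y = a^-1 * conj a y); last by grp.
by apply: (gV x).2.1; [apply: (gV x).2.2|apply: V_U => //; apply: U0U].
Qed.

(* The fixed point groups in [A] of bad elements of a coset of [U] that are   *)
(* distinct modulo [C] are independent, like eigenspaces.                     *)
Section Cosets.
Variable x0 : G.
Let X z := U (x0^-1 * z).
Fixpoint span (us : seq G) : set G :=
  if us is u :: us' then prodg L (V u) (span us') else [set 1].
Fixpoint far (us : seq G) (z : G) : Prop :=
  if us is u :: us' then ~ C (u^-1 * z) /\ far us' z else True.
Fixpoint indep (us : seq G) : Prop :=
  if us is u :: us' then [/\ bad u, X u, far us' u & indep us'] else True.

Let XU u z : X u -> X z -> U (u^-1 * z).
Proof.
move=> Xu Xz; rewrite (_ : u^-1 * z = (x0^-1 * u)^-1 * (x0^-1 * z)); last by grp.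
by apply: gU.2.1 => //; apply: gU.2.2.
Qed.

Let V_X u z a : X u -> X z -> V u a -> V u (conj a z).
Proof.
move=> Xu Xz Va; rewrite (_ : z = u * (u^-1 * z)); last by grp.
by rewrite conjM; have [_ ->] := Va; apply: V_U => //; apply: XU.
Qed.

Lemma span_sg us : [/\ dset (span us), sg (span us) & span us `<=` A].
Proof.
elim: us => [|u us [ds gs sA]] /=; first by split; [exact: dset_one|exact: sg_1|move=> _ ->].
split; first exact: dset_prodg.
  apply: sg_prodg => // b /sA Ab; apply: norm_sub => y /conjsE [Ay e].
    have Ay' : A y by rewrite (_ : y = conj (b * y * b^-1) b); [apply: Aconj|grp].
    have -> : y = b * y * b^-1 by rewrite (abA Ab Ay'); grp.
    by split.
  have Ay' : A y by rewrite (_ : y = conj (b^-1 * y * b^-1^-1) b^-1); [apply: Aconj|grp].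
  have -> : y = b^-1 * y * b^-1^-1 by rewrite (abA (AV Ab) Ay'); grp.
  by split.
by apply: prodg_sub => // a [].
Qed.

Lemma span_X us z a : indep us -> X z -> span us a -> span us (conj a z).
Proof.
elim: us a => [|u us IH] a /=; first by move=> _ _ ->; rewrite /set1 /mkset; grp.
move=> [_ Xu _ ind] Xz [v [s [Vv [ss ->]]]].
by exists (conj v z), (conj s z); split; [apply: V_X|split; [apply: IH|apply: conjD]].
Qed.

(** The eigenvector argument: if [v * s] is fixed by [z], then [[v, z]] lies in [V u] and in the
    span of the later groups, so it is 1 by induction. Then [v] is fixed by [u^-1 * z], which is in
    [U] but not in [C], so [v = 1], and [s] is treated by induction. *)
Lemma span_disjoint us z a : indep us -> X z -> far us z -> V z a -> span us a -> a = 1.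
Proof.
elim: us z a => [|u us IH] z a /=; first by move=> _ _ _ _ ->.
move=> [bu Xu fu ind] Xz [nC' fz] Vz [v [s [Vv [ss e]]]]; subst a.
have [_ gs sA] := span_sg us; have [Av ev] := Vv.
have h : comm v z = 1.
  apply: (IH u) => //.
    rewrite (_ : comm v z = v^-1 * conj v z); last by grp.
    by apply: (gV u).2.1; [apply: (gV u).2.2|apply: V_X].
  have [_] := Vz; rewrite conjD => e.
  rewrite (_ : comm v z = s * (conj s z)^-1).
    by apply: gs.2.1 => //; apply: gs.2.2; apply: span_X.
  rewrite (_ : comm v z = v^-1 * (conj v z * conj s z) * (conj s z)^-1); last by grp.
  by rewrite e; grp.
have v1 : v = 1.
  apply: (fixed_U (XU Xu Xz) nC'); split=> //.
  have eu : conj v u^-1 = v by rewrite -{1}ev conjK.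
  by rewrite conjM eu; apply/comm_eq1.
by move: Vz; rewrite v1 gmul1 => Vz; apply: (IH z).
Qed.

Lemma span_gd us : indep us -> size us <= gd A.
Proof.
move=> ind; have [ds gs sA] := span_sg us.
apply: (@leq_trans (gd (span us))); last by apply: gd_sub => //; apply: sg_ne.
elim: us ind {ds gs sA} => [|u us IH] //= [bu Xu fu ind].
have [ds gs sA] := span_sg us; have := gd_prodg (dV u) ds (gV u) gs.
have -> : gd (V u `&` span us) = 0.
  apply: gd_singleton => // a b [Va sa] [Vb sb].
  by rewrite (span_disjoint ind Xu fu Va sa) (span_disjoint ind Xu fu Vb sb).
by have := IH ind; have := V_infinite bu; lia.
Qed.

Lemma not_far_gd us k : dge k (fun z => ~ far us z) -> k <= gd C.
Proof.
have df vs : dset (far vs).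
  by elim: vs => [|v vs IH] /=; [exact: dset_prop|dfn].
elim: us => [|u us IH] /=; first by move=> /dge_ne [z []].
move=> h; have : dge k (fun z => C (u^-1 * z) \/ ~ far us z).
  apply: dge_mono h => z nf; have [Cz|nCz] := pselect (C (u^-1 * z)); first by left.
  by right=> fz; apply: nf.
have d1 : dset (fun z => C (u^-1 * z)) by dfn.
have d2 : dset (fun z => ~ far us z) by have := df us; move=> ?; dfn.
move=> /(dge_or d1 d2) [h1|/IH//].
rewrite -(gd_lcoset u dC (sg_ne gC)); apply/(gdP _ uG) => //.
by exists u; rewrite gmulV; case: gC.
Qed.

(** Independent lists have length at most [gd A] by [span_gd]. With a maximal list, every bad
    element of the coset lies in one of finitely many cosets of [C]. *)
Lemma bad_coset : bad x0 -> gd (fun z => bad z /\ X z) <= gd C.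
Proof.
move=> b0; have [us ind usmax] : exists2 us, indep us & forall z, X z -> bad z -> ~ far us z.
  apply: contrapT => nex.
  have [us [ind e]] : exists us, indep us /\ size us = (gd A).+1.
    elim: (gd A).+1 => [|n [us [ind <-]]]; first by exists [::].
    apply: contrapT => nex'; apply: nex; exists us => // z Xz bz fz; apply: nex'.
    by exists (z :: us).
  by have := span_gd ind; rewrite e ltnn.
apply: (@not_far_gd us); have ne : exists z, bad z /\ X z.
  by exists x0; split=> //; rewrite /X gmulV; case: gU.
by apply: dge_mono (gd_dge uG ne) => z [bz Xz]; apply: usmax.
Qed.
End Cosets.

(** Fibre the bad set over [G / U]: each fibre has dimension at most that of [C], which is less than
    that of [U]. *)
Lemma bad_lt : (exists x, bad x) -> gd bad < gd (setT : set G).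
Proof.
move=> nb; pose Y := quo_isort dU gU.
have uY : uniform Y := iunif (quo_igroup dU gU nU).
have df : @dmap _ _ S G Y (qpi U) by apply: dmap_qpi.
have h1 : gd bad <= gd (fimg (qpi U : G -> Y) bad) + gd C.
  apply: gd_fib_le => // x bx; apply: leq_trans (bad_coset bx); apply: gd_sub => //.
    by exists x.
  by move=> z [bz /esym /(qpiE gU)].
have h2 : gd (fimg (qpi U : G -> Y) bad) <= gd (setT : set Y).
  by apply: gd_sub => //; have [x bx] := nb; exists (qpi U x), x.
have h3 : gd (setT : set Y) + gd U = gd (setT : set G) := gd_quo_type dU gU nU.
by have := gdCU; rewrite -h3 => h4; apply: leq_ltn_trans h1 _; rewrite -addnS leq_add.
Qed.

(** The centralizer [P] of the element [g] from [exists_central] is a complement of [A]. Elements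
    that are not bad are conjugate into [P] and, when in [P], belong to no other conjugate; [bad_lt]
    then gives both genericity statements. *)
Lemma carter_theory_complement :
  (forall H, conn H -> gd H < gd (setT : set G) -> carter_theory H [set 1]) ->
  carter_theory (setT : set G) [set 1].
Proof.
move=> IH; have [g [Ng nCg]] := exists_central.
have Ug : U g by move=> y; apply: AC; apply: Ng.
have fg := fixed_U Ug nCg; have sjg := img_full fg.
have Ng' x : A (comm x g) by rewrite commV; apply: AV; apply: Ng.
pose P x := comm x g = 1.
have dP : dset P by rewrite /P /Defs.comm; dfn.
have gP : sg P.
  split; [exact: comm1g|split].
    move=> x y ex ey; rewrite /P (_ : comm _ g = conj (comm x g) y * comm y g); last by grp.
    by rewrite ex ey; grp.
  by move=> x ex; rewrite /P; transitivity (conj (comm x g)^-1 x^-1); [grp|rewrite ex; grp].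
have PA1 x : P x -> A x -> x = 1 by move=> Px Ax; apply: fg; split=> //; apply/comm_eq1.
have GPA x : exists p a, [/\ P p, A a & x = p * a].
  have [a [Aa ea]] := sjg _ (AV (Ng' x)); exists (x * a), a^-1; split; [|exact: AV|by grp].
  rewrite /P (_ : comm _ g = conj (comm x g) a * comm a g); last by grp.
  by rewrite ea conjA // gmulrV.
have AP0 : gd (A `&` P) = 0.
  by apply: gd_singleton => // a b [Aa Pa] [Ab Pb]; rewrite (PA1 a) // (PA1 b).
have eAP : gd (prodg L A P) = gd (setT : set G).
  apply: gd_eq => x; split=> // _; have [p [a [Pp Aa ->]]] := GPA x.
  by exists (conj a p^-1), p; split; [apply: Aconj|split=> //; grp].
have h1 := gd_prodg dA dP gA gP.
(* For [K] of full dimension in [P], the product [A K] has the dimension of [G], so it is [G], and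
   [K = P] because [A] meets [P] trivially. *)
have cP : conn P.
  split=> // K dK gK KP e; rewrite eqEsubset; split=> // p Pp.
  have AK0 : gd (A `&` K) = 0.
    by apply: gd_singleton => // a b [Aa /KP Pa] [Ab /KP Pb]; rewrite (PA1 a) // (PA1 b).
  have h2 := gd_prodg dA dK gA gK.
  have [_ _ cT] := cG.
  have eT : prodg L A K = setT.
    apply: cT => //; [exact: dset_prodg|exact: sg_prodg|].
    by move: h1 h2; rewrite AP0 AK0 eAP e !addn0 => -> ->.
  have : prodg L A K p by rewrite eT.
  move=> [a [k [Aa [Kk ep]]]]; suff -> : p = k by [].
  rewrite ep (_ : a = 1) ?gmul1 //; apply: PA1 => //.
  rewrite (_ : a = p * k^-1); first by apply: gP.2.1 => //; apply: gP.2.2; apply: KP.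
  by rewrite ep; grp.
(* Modulo [P] the element is some [a] in [A]; then [[a, g]] lies in [A] and in [P], so [a] is fixed
   by [g]. *)
have sP x : norm L P x -> P x.
  move=> nx; have [p [a [Pp Aa e]]] := GPA x.
  have na : norm L P a.
    have -> : a = p^-1 * x by rewrite e; grp.
    by apply: (sg_norm L P).2.1 => //; apply: norm_inv; apply: norm_self.
  have Pg : P g by rewrite /P /Defs.comm; grp.
  suff a1 : a = 1 by rewrite e a1 gmulr1.
  apply: fg; split=> //; apply/comm_eq1; apply: PA1; last exact: Acomm.
  rewrite (_ : comm a g = conj g^-1 a * g); last by grp.
  apply: gP.2.1 => //; apply/(na _); rewrite (_ : _ * _ = g^-1); last by grp.
  exact: gP.2.2.
(* Modulo [P] a conjugating element is some [a] in [A]. As [[a^-1, x]] lies in [A] and in [P], [x]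
   centralizes [a^-1], which is then 1. *)
have good_uniq x : P x -> ~ bad x -> uniq_conj setT P x.
  move=> Px nb; split=> // y _ Py; have [p [a [Pp Aa e]]] := GPA y.
  have Pa : P (a * x * a^-1).
    rewrite (_ : _ * _ = p^-1 * (y * x * y^-1) * p); last by rewrite e; grp.
    by apply: gP.2.1 => //; apply: gP.2.1 => //; apply: gP.2.2.
  have a1 : a^-1 = 1.
    apply: (V1 nb); split; first exact: AV.
    apply/comm_eq1; apply: PA1; last by apply: Acomm; apply: AV.
    rewrite (_ : comm a^-1 x = (a * x^-1 * a^-1) * x); last by grp.
    apply: gP.2.1 => //; rewrite (_ : _ * _ = (a * x * a^-1)^-1); last by grp.
    exact: gP.2.2.
  apply: norm_self => //; suff a2 : a = 1 by rewrite e a2 gmulr1.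
  by rewrite -(ginvK L a) a1 ginv1.
have bad_r x a : A a -> bad (x * a) -> bad x.
  move=> Aa [b [[Ab eb] b1]]; exists b; split=> //; split=> //.
  by rewrite -[RHS]eb conjM (conjA (Aconj x Ab) Aa).
(* Write [x = p * a]. Since C_A(p) = 1, there is [u] in [A] with [[u, p] = a^-1], and it conjugates
   [x] to [p]. *)
have good_conj x : ~ bad x -> gclos setT (uniq_conj setT P) x.
  move=> nb; have [p [a [Pp Aa e]]] := GPA x.
  have nbp : ~ bad p.
    move=> bp; apply: nb; rewrite e; apply: (bad_r _ a^-1); first exact: AV.
    by rewrite (_ : p * a * a^-1 = p) //; grp.
  have [u [Au eu]] := img_full (fun a' => @V1 p a' nbp) (AV Aa).
  exists u; split=> //; rewrite (_ : u * x * u^-1 = p); first exact: good_uniq.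
  have ea : a = (comm u p)^-1 by rewrite eu ginvK.
  by rewrite e ea; grp.
have clP : lcs L P c0 `<=` [set 1].
  move=> x hx; apply: PA1; first exact: lcs_sub hx.
  by apply: lcsA; apply: lcs_mono hx.
exists P; split.
- by split=> //; [move=> _ ->; case: gP|exists c0].
- by move=> x _; apply: sP.
- split; apply: lt_small => -[x [hx nx]].
    have nb : exists x, (P `&` bad) x.
      by exists x; split=> //; apply: contrapT => nb; apply: nx; apply: good_uniq.
    have dPb : dset (P `&` bad) by dfn.
    (* Multiplication is injective from bad elements of [P] times [A] into the bad set, since
       badness depends only on the coset of [A]. *)
    have : gd (P `&` bad) + gd A <= gd bad.
      rewrite -(gd_prod uG uG dPb dA nb (sg_ne gA)).
      have dPA : @dset _ _ S (prod_isort G G) (fun p => (P `&` bad) p.1 /\ A p.2) by dfn.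
      rewrite -(gd_inj (uniform_prod uG uG) uG (imul G) dPA).
      + apply: gd_sub => //; first by have [y hy] := nb; exists (y * 1), (y, 1).
        move=> _ [[p a] [[[/= Pp bp] Aa] <-]]; apply: (bad_r _ a^-1); first exact: AV.
        by rewrite (_ : p * a * a^-1 = p) //; grp.
      + move=> [p a] [p' a'] [[/= Pp _] Aa] [[/= Pp' _] Aa'] e.
        have e1 : p'^-1 * p = 1.
          apply: PA1; first by apply: gP.2.1 => //; apply: gP.2.2.
          rewrite (_ : _ * _ = p'^-1 * (p * a) * a^-1); last by grp.
          by rewrite e (_ : _ * _ = a' * a^-1); [apply: AM => //; apply: AV|grp].
        have ep : p = p' by transitivity (p' * (p'^-1 * p)); [grp|rewrite e1; grp].
        by subst p'; congr pair; apply: gmulI e.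
      + by have [y hy] := nb; exists (y, 1).
    have hb : exists x, bad x by have [y [_ By]] := nb; exists y.
    have := bad_lt hb.
    have : gd (P `\` uniq_conj setT P) <= gd (P `&` bad).
      apply: gd_sub => //; first by exists x.
      move=> y [Py ny]; split=> //; apply: contrapT => nb'; apply: ny; exact: good_uniq.
    by move: h1; rewrite AP0 eAP; lia.
  apply: (@leq_ltn_trans (gd bad)).
    apply: gd_sub => //; first by exists x.
    by move=> y [_ ny]; apply: contrapT => nb; apply: ny; apply: good_conj.
  by apply: bad_lt; exists x; apply: contrapT => nb; apply: nx; apply: good_conj.
move=> R [cR R1 _ [c nR] eR]; have [dR gR _] := cR.
have {}eR : gd (norm L R) = gd R by rewrite -eR; apply: gd_eq => x; split=> [|[]].
have cRA := conn_prodg cA cR nA; have [dRA gRA _] := cRA.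
have lRA : lcs L (prodg L A R) c `<=` A.
  by apply: nilm_prodg => // x /nR ->.
have RRA : R `<=` prodg L A R by apply: prodg_r.
have ARA : A `<=` prodg L A R by apply: prodg_l.
(* Otherwise induction applies to [A R], and [frattini_gd] gives it finite index in its normalizer;
   modulo [A], where [G] is nilpotent, this forces [A R = G]. *)
have RAT : prodg L A R = setT.
  apply: contrapT => RAT; have thRA := IH _ cRA (proper_lt cG cRA RAT).
  apply: RAT; apply: (carter_nilpotent cG lcsA) => //.
  by apply: (frattini_gd cR cRA RRA thRA eR); exists c.
have dAR : dset (A `&` R) by dfn.
have gAR : sg (A `&` R) by apply: sg_I.
(* The intersection is normalized by [R], and by [A] because [A] is abelian. *)
have nAR x : norm L (A `&` R) x.
  have : prodg L A R x by rewrite RAT.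
  move=> [a [r [Aa [Rr ->]]]]; apply: (sg_norm L (A `&` R)).2.1.
    have hA b : A b -> a * b * a^-1 = b by move=> Ab; rewrite (abA Aa Ab); grp.
    move=> y; split=> -[Ay Ry].
      by have e := hA y ((nA a y).1 Ay); rewrite e in Ay Ry.
    by rewrite hA.
  by move=> y; split=> -[Ay Ry]; split; [exact/(nA r y)|exact/(norm_self gR Rr y)|exact/nA|exact/(norm_self gR Rr y)].
have AR0 : gd (A `&` R) = 0.
  have [|e|//] := Amin dAR gAR nAR; first by move=> y [].
  case: (nnil (c := c)); rewrite -RAT prodg_id //.
  by move=> a; rewrite -e => -[].
have AR1 x : A x -> R x -> x = 1.
  move=> Ax Rx; apply: fg; split=> //; apply/comm_eq1.
  exact: (normal_small_central cG dAR gAR nAR AR0).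
(* Since [[A, g] = A], the component [r] of [g] in [R] is conjugate to [g] by some [u] in [A]. As
   [r] is central modulo [A], it commutes with [R], so [u] conjugates [R] into the centralizer of
   [g]. *)
have [a [r [Aa [Rr eg]]]] : prodg L A R g by rewrite RAT.
have [u [Au eu]] := sjg (conj a g) (Aconj g Aa).
have er : r = u^-1 * g * u.
  have e : g^-1 * a^-1 * g = comm g u by rewrite commV eu; grp.
  have -> : r = a^-1 * g by rewrite eg; grp.
  by transitivity (g * (g^-1 * a^-1 * g)); [grp|rewrite e; grp].
have Rsub y : R y -> P (u * y * u^-1).
  move=> Ry; have e1 : comm y r = 1.
    apply: AR1; last exact: comm_in.
    rewrite er (_ : comm y _ = conj (comm (u * y * u^-1) g) u); last by grp.
    exact: Aconj.
  have e2 : comm (u * y * u^-1) g = u * comm y r * u^-1 by rewrite er; grp.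
  by rewrite /P e2 e1; grp.
exists u; split=> // y; split=> [|Py]; first exact: Rsub.
have [b [s [Ab [Rs ey]]]] : prodg L A R y by rewrite RAT.
suff b1 : u * b * u^-1 = 1.
  by rewrite ey (_ : b = u^-1 * (u * b * u^-1) * u); [rewrite b1 (_ : _ * s = s) //; grp|grp].
apply: PA1; last exact/nA.
rewrite (_ : _ * _ = (u * y * u^-1) * (u * s * u^-1)^-1); last by rewrite ey; grp.
by apply: gP.2.1 => //; apply: gP.2.2; apply: Rsub.
Qed.
End Complement.

(** * Existence and conjugacy of Carter subgroups *)

Section Induction.
Context {d : Order.disp_t} {M : orderType d} {S : ominimal_structure M}.

Section OneGroup.
Variable G : igroup S.
Local Notation L := (ilaw G).
Local Notation "x * y" := (gmul L x y).
Local Notation "x ^-1" := (ginv L x).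
Local Notation "1" := (gone L).
Local Notation sg := (is_subgroup L).
Let uG : uniform G := iunif G.
Implicit Types (A B D E F H K P Q R W : set G) (x y g h : G).
Hypothesis cG : conn (setT : set G).
Let dT : @dset _ _ S G setT. Proof. by case: cG. Qed.

Lemma component_normal K H g : conn K -> K `<=` H -> gd K = gd H -> dset H -> sg H ->
  norm L H g -> norm L K g.
Proof.
move=> cK KH e dH gH nH; have [dK gK _] := cK.
apply/norm_conjs; apply: (conn_unique (H := H)) => //; first exact: conn_conjs.
  by move=> y /conjsE /KH /nH.
by rewrite gd_conjs //; apply: sg_ne.
Qed.

Lemma minimal_normal : 0 < gd (setT : set G) -> exists A, [/\ conn A, forall g, norm L A g, 0 < gd A &
  forall K, dset K -> sg K -> (forall g, norm L K g) -> K `<=` A -> K = A \/ gd K = 0].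
Proof.
move=> G0; pose Pi A := [/\ conn A, forall g, norm L A g & 0 < gd A].
have [A [cA nA A0] Amin] : exists2 A, Pi A & forall K, Pi K -> gd A <= gd K.
  have : exists m A, Pi A /\ gd A < m by exists (gd (setT : set G)).+1, setT.
  move=> [m]; elim: m => [|m IH] [A [PA lt]] //.
  have [[K [PK lt']]|nK] := pselect (exists K, Pi K /\ gd K < gd A).
    by apply: IH; exists K; split=> //; apply: leq_trans lt' _.
  by exists A => // K PK; rewrite leqNgt; apply/negP => h; apply: nK; exists K.
exists A; split=> // K dK gK nK KA; have [K0|] := posnP (gd K); [by right|move=> K0; left].
have [K' [cK' K'K eK' _]] := component_exists dK gK; have [dK' gK' _] := cK'.
have le : gd A <= gd K'.
  by apply: Amin; split=> //; [move=> g; apply: (component_normal cK' K'K)|rewrite eK'].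
have [dA gA cA3] := cA; rewrite eqEsubset; split=> // x.
rewrite -(cA3 K') //; first exact: K'K; first by move=> y /K'K /KA.
apply/eqP; rewrite eqn_leq le andbT; apply: gd_sub => //; first exact: sg_ne.
by move=> y /K'K /KA.
Qed.

(** The hull of the commutator subgroup of [A] is [A] or has dimension 0. In the first case [A] lies
    in the hull of every derived term, hence is trivial by solvability; in the second case
    [central_small] makes all commutators trivial. *)
Lemma minimal_abelian A c : derived L setT c `<=` [set 1] -> conn A -> (forall g, norm L A g) -> 0 < gd A ->
  (forall K, dset K -> sg K -> (forall g, norm L K g) -> K `<=` A -> K = A \/ gd K = 0) ->
  forall a b, A a -> A b -> a * b = b * a.
Proof.
move=> hc cA nA A0 Amin; have [dA gA _] := cA.
have [dD gD CD Dmin] := hullP (derived L A 1); set D := hull (derived L A 1) in dD gD CD Dmin.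
have DA : D `<=` A by apply: Dmin => //; apply: commg_sub => // x y; apply: comm_in.
have nD g : norm L D g by apply/norm_hull/norm_derived.
have [e|D0] := Amin D dD gD nD DA.
  have hullA i : A `<=` hull (derived L A i).
    elim: i => [|i IH]; first by rewrite /= hull_definable.
    have [dE gE _ _] := hullP (derived L A i.+1).
    rewrite -{1}e; apply: Dmin => //; apply: subset_trans (hull_commg _ _); last 2 first.
    - exact: sg_derived.
    - exact: sg_derived.
    exact: commg_mono.
  have A1 : A `<=` [set 1].
    apply: subset_trans (hullA c) _; have [_ _ _ h] := hullP (derived L A c).
    apply: h; [exact: dset_one|exact: sg_1|].
    by apply: subset_trans hc; apply: derived_mono.
  by move: A0; rewrite (gd_singleton uG) // => x y /A1 -> /A1 ->.
move=> a b Aa Ab; have e : comm L a b = 1.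
  by apply: (central_small cA dD D0) Ab => y Ay; apply: CD; apply: commg_in.
by transitivity (b * a * comm L a b); [grp|rewrite e gmulr1].
Qed.

Lemma carter_theory_nilpotent c : lcs L setT c `<=` [set 1] -> carter_theory (setT : set G) [set 1].
Proof.
move=> hc; exists setT; split.
- by split=> //; exists c.
- by [].
- split; apply: lt_small => -[x [_ nx]]; case: nx; first by split.
  by exists 1; split.
move=> R [cR R1 _ _ eR]; exists 1; split=> // y.
rewrite (carter_nilpotent cG hc R1 cR) // -eR.
by apply: gd_eq => x; split=> [|[]].
Qed.
End OneGroup.

(** Strong induction on dimension over all groups at once, because both proper connected subgroups
    and quotients are needed. *)
Lemma carter_theory_solvable (G : igroup S) c : conn (setT : set G) ->
  derived (ilaw G) setT c `<=` [set gone (ilaw G)] -> carter_theory (setT : set G) [set gone (ilaw G)].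
Proof.
have [k] := ubnP (gd (setT : set G)); elim: k G => [//|k IH] G ltk cG hc.
have uG : uniform G := iunif G.
have [[c' hc']|nnil] := pselect (exists c, lcs (ilaw G) setT c `<=` [set gone (ilaw G)]).
  exact: carter_theory_nilpotent hc'.
have dT : @dset _ _ S G setT by case: cG.
have IHsub (H : set G) : conn H -> gd H < gd (setT : set G) -> carter_theory H [set gone (ilaw G)].
  move=> cH ltH; have [dH gH _] := cH.
  apply: (carter_theory_sub (dH := dH) (gH := gH)); apply: IH.
  - by rewrite gd_sub_type; apply: leq_trans ltH _.
  - exact: conn_sub.
  - exact: solv_sub hc.
(* Either the preimage [Q] is proper and the result lifts from it, or [Q = G] and [G / A] is
   nilpotent. *)
have lift (A : set G) : conn A -> (forall g, norm (ilaw G) A g) -> 0 < gd A ->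
    carter_theory (setT : set G) [set gone (ilaw G)] \/ exists c, lcs (ilaw G) setT c `<=` A.
  move=> cA nA A0; have [dA gA _] := cA.
  have [|Q [[cQ AQ _ nQ] sQ gQ conjQ]] := carter_theory_quo (nA := nA) (dA := dA) (gA := gA) cA.
    apply: IH; [|exact: conn_quo|exact: solv_quo hc].
    by have := gd_quo_type dA gA nA; lia.
  have [eQ|QT] := pselect (Q = setT); first by right; rewrite -eQ.
  by left; apply: (carter_theory_lift cG cA nA cQ) => // g; apply: sQ.
have G0 : 0 < gd (setT : set G).
  rewrite lt0n; apply/eqP => e; apply: nnil; exists 0 => x _.
  have [_ _ cT] := cG; suff -> : [set gone (ilaw G)] = setT by [].
  apply: cT => //; [exact: dset_one|exact: sg_1|].
  by rewrite e (gd_singleton uG) // => ? ? -> ->.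
have n1 := @norm_one _ _ _ G.
have dZ := dset_up (dset_one G); have gZ := sg_up (sg_1 (ilaw G)) n1.
(* With a center of positive dimension, take its connected component for [A]: nilpotency of [G / A]
   would then make [G] nilpotent. *)
have [Z0|Z0] := posnP (gd (@up _ _ _ G [set gone (ilaw G)])); last first.
  have [A [cA AZ eA _]] := component_exists dZ gZ.
  have [||//|[c' hc']] := lift A cA; last 1 first.
  - case: nnil; exists c'.+1; apply: commg_sub; first exact: sg_1.
    by move=> x y /hc' /AZ.
  - by move=> g; apply: (component_normal cA AZ) => //; apply: norm_up.
  - by rewrite eA.
have [A [cA nA A0 Amin]] := minimal_normal cG G0.
have [//|[c' hc']] := lift A cA nA A0.
apply: (carter_theory_complement (A := A) (c0 := c')) => //.
  exact: (minimal_abelian hc).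
by move=> c'' h; apply: nnil; exists c''.
Qed.
End Induction.

(** * Cartan subgroups *)

Section CartanSubgroups.
Context {d : Order.disp_t} {M : orderType d} {S : ominimal_structure M}.
Variable G : igroup S.
Local Notation L := (ilaw G).
Local Notation "x * y" := (gmul L x y).
Local Notation "x ^-1" := (ginv L x).
Local Notation "1" := (gone L).
Local Notation sg := (is_subgroup L).
Let uG : uniform G := iunif G.
Implicit Types (D H K P Q R X : set G) (x y g h : G).

Lemma generic_conjs P h : dset (setT : set G) -> dset P -> generic setT P -> generic setT (conjs L P h).
Proof.
move=> dT dP [sm1 sm2]; have dU := dset_uniq_conj dT dP.
have E x : uniq_conj setT (conjs L P h) x <-> uniq_conj setT P (h * x * h^-1).
  split=> [[/conjsE Px hx]|[Px hx]].
    split=> // g _ Pg; have : norm L (conjs L P h) (h^-1 * g * h).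
      by apply: hx => //; apply/conjsE; rewrite (_ : _ * _ = g * (h * x * h^-1) * g^-1) //; grp.
    by rewrite norm_conjsE (_ : h * _ * h^-1 = g) //; grp.
  split; first exact/conjsE.
  move=> g _ /conjsE Pg; apply/norm_conjsE/hx => //.
  by rewrite (_ : _ * _ = h * (g * x * g^-1) * h^-1) //; grp.
split.
  have dPU : dset (P `\` uniq_conj setT P) by rewrite /setD /mkset; dfn.
  apply: lt_small => -[x [/conjsE Px nx]].
  have ne : exists x, (P `\` uniq_conj setT P) x by exists (h * x * h^-1); split=> //; rewrite -E.
  rewrite gd_conjs //; last by exists (h * x * h^-1).
  apply: leq_ltn_trans (small_lt ne sm1); rewrite -(gd_conjs h dPU ne); apply: gd_sub => //.
    by exists x; split=> //; apply/conjsE.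
  by move=> y [/conjsE Py]; rewrite E => ny; apply/conjsE.
apply: small_sub sm2 => x [_ nx]; split=> // -[g [_ hg]]; apply: nx.
by exists (h^-1 * g); split=> //; apply/E; rewrite (_ : _ * _ = g * x * g^-1) //; grp.
Qed.

Hypothesis cG : conn (setT : set G).
Let dT : @dset _ _ S G setT. Proof. by case: cG. Qed.

(** Maximality is the normalizer condition. A finite-index subgroup of [P] has definable hull [P] by
    connectedness, so its normalizer normalizes [P] and lies in [P]. *)
Lemma carter_cartan P : conn P -> nilm [set 1] P -> (forall g, norm L P g -> P g) -> cartan L setT P.
Proof.
move=> [dP gP cP] [c hc] sP; split=> //; split; last split.
- split=> //; exists c; rewrite eqEsubset; split=> // _ ->; exact: (sg_lcs c gP).1.
- move=> Q PQ _ [gQ [c' hc']]; rewrite eqEsubset; split=> //.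
  apply: (norm_cond (c := c')) => //; first by rewrite hc' => _ ->; case: gP.
  by move=> x _; apply: sP.
move=> X [gX [XP nX]] [_ [_ [k [g hg]]]].
have [dD gD XD Dmin] := hullP X; have DP : hull X `<=` P by apply: Dmin.
have eD : hull X = P.
  apply: cP => //; apply/(finite_index_gd dD dP gD gP DP).
  by split=> //; split=> //; exists k, g => x /hg [i Xi]; exists i; apply: XD.
split=> //; split.
  by move=> x Xx; split=> //; apply/normE; apply: norm_self.
by exists k, g => x [_ /normE nx]; apply/hg/sP; rewrite -eD; apply: norm_hull.
Qed.

(** The hull of a Cartan subgroup [Q] is nilpotent, so it is [Q], which is thus definable. Its
    component [K] is Carter, hence a conjugate of [P] and selfnormalizing; as [Q] normalizes [K],
    the two are equal. *)
Lemma cartan_conj P Q : conn P -> (forall g, norm L P g -> P g) ->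
  (forall R, carter setT [set 1] R -> exists h, setT h /\ forall y, R y <-> P (h * y * h^-1)) ->
  cartan L setT Q -> exists h, Q = conjs L P h.
Proof.
move=> cP sP conjP [_ [[gQ [c hc]] [Qmax Qfin]]].
have [dD gD QD Dmin] := hullP Q.
have lD : lcs L (hull Q) c `<=` [set 1].
  move=> x /(hull_lcs gQ); rewrite hc; move: x.
  by have [_ _ _ h] := @hullP _ _ _ G [set 1]; apply: h => //; [exact: dset_one|exact: sg_1].
have eQ : hull Q = Q.
  apply: Qmax => //; split=> //; exists c; rewrite eqEsubset; split=> // _ ->.
  exact: (sg_lcs c gD).1.
rewrite eQ in dD gD lD; have [K [cK KQ eK _]] := component_exists dD gQ.
have [dK gK _] := cK.
have nK x : Q x -> norm L K x.
  by move=> Qx; apply: (component_normal cK KQ) => //; apply: norm_self.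
have fK : finite_index L K (normalizer_in L setT K).
  apply: Qfin; first by split=> //; split=> // g /nK /norm_conjs.
  exact/(finite_index_gd dK dD gK gQ KQ).
have [|h [_ hP]] := conjP K.
  split=> //; first by move=> _ ->; case: gK.
    by exists c => x /(lcs_mono KQ) /lD.
  have E : normalizer_in L setT K = setT `&` norm L K.
    by apply: set_ext => x; split=> -[_ /normE].
  rewrite -E; apply/esym/finite_index_gd => //.
  - by rewrite E; have dn := dset_norm dK; dfn.
  - by rewrite E; apply: sg_I => //; apply: sg_norm.
  - by rewrite E => x Kx; split=> //; apply: norm_self.
have eKP : K = conjs L P h by apply: set_ext => y; rewrite conjsE.
exists h; rewrite -eKP; rewrite eqEsubset; split=> // x /nK.
by rewrite eKP norm_conjsE => /sP Px; apply/conjsE.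
Qed.
End CartanSubgroups.

Section FromDefinableGroup.
Context {d : Order.disp_t} {M : orderType d} {S : ominimal_structure M}.
Variables (n : nat) (T : Type) (G : definable_group S n T).
Local Notation L := (dg_law G).
Local Notation X := (dg_isort G).

Lemma dg_sep (H : set X) : dset H -> is_subgroup L H -> exists N, forall K : set X, dset K ->
  is_subgroup L K -> K `<=` H -> gd K = gd H -> ~ separated L K H N.
Proof.
move=> dH gH; have uX := dg_uniform G; have neH : exists x, H x by exists (gone L); case: gH.
have [||N hN] := @separated_bound _ _ S n T G H dH gH (gd H).
- exact: gd_dge.
- by move=> /(gdP _ uX neH); rewrite ltnn.
exists N => K dK gK KH e; apply: hN => //; rewrite -e; apply: gd_dge => //.
by exists (gone L); case: gK.
Qed.

Definition dg_igroup : igroup S := IGroup (dg_mul G) (dg_uniform G) dg_sep.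
Local Notation GI := dg_igroup.

Lemma gdimE (P : set T) : gdefinable G P ->
  gdim G P = if `[< exists x, P x >] then Posz (@gd _ _ S GI P) else Negz 0.
Proof.
move=> dP; rewrite /gdim /dim.
have -> : `[< exists x, (dg_emb G @` P) x >] = `[< exists x, P x >].
  by apply/asbool_equiv_eq; split=> [[_ [x Px _]]|[x Px]]; [exists x|exists (dg_emb G x), x].
case: asboolP => // _; congr Posz; apply: eq_bigl => k; apply/asbool_equiv_eq.
rewrite (dim_geE _ dP) dg_dge.
by split; apply: dq_mono => v [x]; [move=> Px <-; exists x|move=> [Px <-]; exists x].
Qed.

Lemma small_large (P Q : set GI) : dset P -> dset Q -> (exists x, Q x) ->
  small (Q `\` P) Q -> large G P Q.
Proof.
move=> dP dQ nQ sm; have dD : dset (Q `\` P) by rewrite /setD /mkset; dfn.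
rewrite /large !gdimE; [|exact/dg_dset|exact/dg_dset].
rewrite (asboolT nQ); case: asboolP => // nD.
by rewrite ltz_nat; apply: (small_lt (G := GI)).
Qed.

Lemma def_connectedE (H : set GI) : def_connected G H <-> conn H.
Proof.
split.
  move=> [/dg_dset dH [gH cH]]; split=> // K dK gK KH e; apply: cH => //; first exact/dg_dset.
  exact/(finite_index_gd (G := GI)).
move=> [dH gH cH]; split; first exact/dg_dset.
split=> // K /dg_dset dK gK KH fi; apply: cH => //.
exact/(finite_index_gd (G := GI)).
Qed.
End FromDefinableGroup.

Unset Implicit Arguments. Set Strict Implicit.

Theorem theorem8p1 (d : Order.disp_t) (M : orderType d)
    (S : ominimal_structure M) (n : nat) (T : Type)
    (G : definable_group S n T) :
  let L := dg_law G in
  def_connected G setT -> solvable L setT ->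
  (* existence *)
  (exists Q, cartan L setT Q) /\
  (* conjugacy *)
  (forall Q1 Q2, cartan L setT Q1 -> cartan L setT Q2 ->
     exists g, Q2 = conjs L Q1 g) /\
  (* definably connected and selfnormalizing *)
  (forall Q, cartan L setT Q ->
     def_connected G Q /\ normalizer L Q = Q) /\
  (* genericity *)
  (forall Q, cartan L setT Q ->
     let Q0 := [set x | Q x /\
                  forall g, conjs L Q g x -> conjs L Q g = Q] in
     gdefinable G Q0 /\ large G Q0 Q /\ largely_generous G Q0).
Proof.
move=> L cG [_ [c hc]]; pose GI := dg_igroup G.
have {}cG : conn (setT : set GI) by apply/def_connectedE.
have dT : dset (setT : set GI) by case: cG.
have [|P [[cP _ _ nP] sP gP conjP]] := carter_theory_solvable (G := GI) (c := c) cG.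
  by rewrite hc.
have {}sP g : norm L P g -> P g by apply: sP.
have [dP gpP _] := cP.
have cart Q : cartan L setT Q -> exists h, Q = conjs L P h by apply: (cartan_conj (G := GI)).
split; [|split; [|split]].
- by exists P; apply: (carter_cartan (G := GI)).
- move=> Q1 Q2 /cart [h1 ->] /cart [h2 ->]; exists (gmul L (ginv L h1) h2).
  by rewrite conjs_mul gmulA gmulrV gmul1.
- move=> Q /cart [h ->]; split; first exact/def_connectedE/(conn_conjs (G := GI)).
  apply: set_ext => x; rewrite normE norm_conjsE conjsE; split; first exact: sP.
  exact: norm_self.
move=> Q /cart [h eQ] Q0; have cQ : @conn _ _ S GI Q by rewrite eQ; apply: (conn_conjs (G := GI)).
have [dQ gQ _] := cQ.
have eQ0 : Q0 = @uniq_conj _ _ S GI setT Q.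
  apply: set_ext => x; split=> -[Qx hx]; split=> // g.
    by move=> _ Qg; apply/norm_conjs/hx/conjsE.
  by move=> /conjsE Qg; apply/norm_conjs/hx.
have dQ0 : @dset _ _ S GI Q0 by rewrite eQ0; apply: (dset_uniq_conj (G := GI)).
have [sm1 sm2] : @generic _ _ S GI setT Q by rewrite eQ; apply: (generic_conjs (G := GI)).
split; first exact/dg_dset.
split.
  apply: (small_large (G := G)) => //; first by exists (gone L); case: gQ.
  by rewrite eQ0.
have ecl : conj_closure L Q0 setT = @gclos _ _ S GI setT Q0.
  apply: set_ext => y; split=> [[x Qx [g _ <-]]|[g [_ Qg]]].
    by exists g; split=> //; rewrite (_ : gmul _ _ _ = x) //; grp.
  by exists (gmul L (gmul L g y) (ginv L g)) => //; exists g => //; grp.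
apply: (small_large (G := G)) => //.
- by rewrite ecl; apply: (dset_gclos (G := GI)).
- by exists (gone L).
by rewrite ecl eQ0.
Qed.
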